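(* Let $S$ be an admissible operator on $L^2(\mathbb{R}_+)$. For any trace-class operator $T$ on $L^2(\mathbb{R}_+)$, we have $T\star_{\mathrm{Aff}}S\in L^1_r(\mathrm{Aff})$ with $$\int_{\mathrm{Aff}}T\star_{\mathrm{Aff}}S(x,a)\,\frac{dx\,da}{a}=\mathrm{tr}(T)\,\mathrm{tr}(\mathcal{D}^{-1}S\mathcal{D}^{-1}).$$
   Context: $\mathrm{Aff}=\mathbb{R}\times\mathbb{R}_+$, $\mathbb{R}_+=(0,\infty)$, is the affine group with $(x,a)\cdot(y,b)=(ay+x,ab)$; $L^1_r(\mathrm{Aff})=L^1(\mathrm{Aff},a^{-1}dx\,da)$. $L^2(\mathbb{R}_+)=L^2(\mathbb{R}_+,r^{-1}dr)$, with unitary representation $U(x,a)\psi(r)=e^{2\pi i xr}\psi(ar)$. For $T$ trace-class and $S$ bounded, $T\star_{\mathrm{Aff}}S(x,a)=\mathrm{tr}(TU(-x,a)^*SU(-x,a))$. $\mathcal{D}\psi(r)=r^{1/2}\psi(r)$ and $\mathcal{D}^{-1}\psi(r)=r^{-1/2}\psi(r)$ are the (unbounded, positive self-adjoint) multiplication operators on $L^2(\mathbb{R}_+)$ with their maximal domains. A non-zero bounded operator $S$ on $L^2(\mathbb{R}_+)$ mapping $\mathrm{dom}(\mathcal{D})$ into $\mathrm{dom}(\mathcal{D}^{-1})$ is admissible if $\mathcal{D}^{-1}S\mathcal{D}^{-1}$ is bounded on $\mathrm{dom}(\mathcal{D}^{-1})$ and extends to a trace-class operator on $L^2(\mathbb{R}_+)$,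 again denoted $\mathcal{D}^{-1}S\mathcal{D}^{-1}$. *)

(* Defs.v *)
From HB Require Import structures.
From mathcomp Require Import all_boot all_order all_algebra.
From mathcomp Require Import generic_quotient ring_quotient complex.
From mathcomp Require Import all_classical all_reals all_analysis.
From mathcomp Require Import measurable_realfun ring.

Set Implicit Arguments.
Unset Strict Implicit.
Unset Printing Implicit Defensive.

Import Order.TTheory GRing.Theory Num.Theory.
Import numFieldNormedType.Exports.

Local Open Scope classical_set_scope.
Local Open Scope ring_scope.
Local Open Scope quotient_scope.
Local Open Scope complex_scope.

Section ComplexIntegral.
Context d (T : measurableType d) (R : realType).
Variables (mu : {measure set T -> \bar R}) (D : set T) (f : T -> R[i]).

Definition cmeasurable_fun :=
  measurable_fun D (fun t => complex.Re (f t)) /\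
  measurable_fun D (fun t => complex.Im (f t)).

Definition cintegrable :=
  mu.-integrable D (fun t => (complex.Re (f t))%:E) /\
  mu.-integrable D (fun t => (complex.Im (f t))%:E).

Definition cintegral : R[i] :=
  (\int[mu]_(t in D) complex.Re (f t)) +i* (\int[mu]_(t in D) complex.Im (f t)).

End ComplexIntegral.

Section L2_space.
Variable R : realType.
Local Notation C := R[i].
Local Notation mu := (@lebesgue_measure R).
Local Notation Rplus := (`]0%R, +oo[%classic : set R).
Local Notation normc := ComplexField.Normc.normc.

(* Elements of L^2(R_+, dr/r) are represented by functions on the whole line  *)
(* whose values on ]-oo, 0] are irrelevant; the density 1/r of dr/r is        *)
(* written inside the Lebesgue integrals.                                     *)
Definition sqint (f : R -> C) : Prop :=
  cmeasurable_fun Rplus f /\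
  (\int[mu]_(r in Rplus) (normc (f r) ^+ 2 / r)%:E < +oo)%E.

Definition sqint_pred : {pred (R -> C)} := [pred f | `[< sqint f >]].

Lemma sqint_submod_closed : submod_closed sqint_pred.
Proof.
have pos r : Rplus r -> 0 < r by rewrite /= in_itv /= andbT.
split.
  apply/asboolP; split; first by split; exact: measurable_cst.
  rewrite integral0_eq // => r _.
  by rewrite (_ : normc _ = 0) ?expr0n ?mul0r // ComplexField.Normc.normc0.
move=> a f g /asboolP[[mfr mfi] If] /asboolP[[mgr mgi] Ig]; apply/asboolP.
pose q (h : R -> C) (r : R) : R := normc (h r) ^+ 2 / r.
have mn (h : R -> C) : cmeasurable_fun Rplus h ->
    measurable_fun Rplus (EFin \o q h).
  case=> hr hi; apply/measurable_EFinP; apply: measurable_funM => //.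
    rewrite (_ : (fun _ => _) = (fun r =>
      complex.Re (h r) ^+ 2 + complex.Im (h r) ^+ 2)); last first.
      apply/funext => r; case: (h r) => x y /=.
      by rewrite sqr_sqrtr // addr_ge0 ?sqr_ge0.
    by apply: measurable_funD; exact: measurable_funX.
  apply: open_continuous_measurable_fun => //.
  by move=> r /set_mem /pos r0; apply: inv_continuous; rewrite gt_eqF.
have mh : cmeasurable_fun Rplus (a *: f + g).
  split.
    rewrite (_ : (fun _ => _) = (fun r => complex.Re a * complex.Re (f r)
      - complex.Im a * complex.Im (f r) + complex.Re (g r))); last first.
      by apply/funext => r; rewrite /= !fctE; case: a (f r) (g r) => ? ? [? ?] [? ?].
    by apply: measurable_funD => //; apply: measurable_funB;
      apply: measurable_funM.
  rewrite (_ : (fun _ => _) = (fun r => complex.Re a * complex.Im (f r)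
    + complex.Im a * complex.Re (f r) + complex.Im (g r))); last first.
    by apply/funext => r; rewrite /= !fctE; case: a (f r) (g r) => ? ? [? ?] [? ?].
  by apply: measurable_funD => //; apply: measurable_funD;
    apply: measurable_funM.
split=> //.
pose k := 2 * normc a ^+ 2.
have nf0 (h : R -> C) r : Rplus r -> (0 <= (normc (h r) ^+ 2 / r)%:E)%E.
  by move=> /pos r0; rewrite lee_fin divr_ge0 ?sqr_ge0 // ltW.
apply: (@le_lt_trans _ _ (\int[mu]_(r in Rplus)
   (k%:E * (normc (f r) ^+ 2 / r)%:E + 2%:E * (normc (g r) ^+ 2 / r)%:E))%E).
  apply: ge0_le_integral => //.
  - exact: nf0.
  - exact: mn.
  - by apply: emeasurable_funD; apply: measurable_funeM; exact: mn.
  - move=> r /pos r0; rewrite -!EFinM -EFinD lee_fin !mulrA -mulrDl.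
    rewrite ler_pM2r ?invr_gt0 //.
    have := le_normcD (a * f r) (g r).
    rewrite ComplexField.Normc.normcM => tri.
    have n0 (z : C) : 0 <= normc z by case: z => x y; exact: sqrtr_ge0.
    apply: (@le_trans _ _ ((normc a * normc (f r) + normc (g r)) ^+ 2)).
      by rewrite ler_sqr ?nnegrE ?addr_ge0 ?mulr_ge0.
    rewrite /k -subr_ge0 (_ : _ - _ =
      (normc a * normc (f r) - normc (g r)) ^+ 2) ?sqr_ge0 //.
    ring.
have k0 : 0 <= k by rewrite mulr_ge0 ?sqr_ge0.
have If0 (h : R -> C) c : 0 <= c -> forall r, Rplus r ->
    (0 <= c%:E * (normc (h r) ^+ 2 / r)%:E)%E.
  by move=> c0 r r0; rewrite mule_ge0 ?nf0.
have mc (h : R -> C) (c : R) : cmeasurable_fun Rplus h ->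
    measurable_fun Rplus (fun r : R => c%:E * (q h r)%:E)%E.
  by move=> mh'; apply: measurable_funeM; exact: mn.
rewrite [ltLHS](_ : _ = k%:E * (\int[mu]_(r in Rplus) (q f r)%:E) +
    2%:E * (\int[mu]_(r in Rplus) (q g r)%:E))%E; last first.
  apply: etrans.
    apply: ge0_integralD => //; [exact: If0|exact: mc|exact: If0|exact: mc].
  congr (_ + _)%E; apply: ge0_integralZl_EFin => //;
    solve [exact: nf0|exact: mn].
by rewrite lte_add_pinfty // lte_mul_pinfty // ?lee_fin // mulr_ge0 ?sqr_ge0.
Qed.

HB.instance Definition _ :=
  GRing.isSubmodClosed.Build C (R -> C) sqint_pred sqint_submod_closed.

Record L2fun := MkL2fun {
  L2fun_val :> R -> C ; L2funP : L2fun_val \in sqint_pred }.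
HB.instance Definition _ := [isSub for L2fun_val].
HB.instance Definition _ := [Choice of L2fun by <:].
HB.instance Definition _ := [SubChoice_isSubLmodule of L2fun by <:].

Definition L2null : {pred L2fun} :=
  [pred f : L2fun | `[< {ae mu, forall r, 0 < r -> f r = 0} >]].

Lemma L2null_zmod_closed : zmod_closed L2null.
Proof.
have val0 : L2fun_val 0 = 0 by exact: (raddf0 val).
have valB f g : L2fun_val (f - g) = L2fun_val f - L2fun_val g.
  exact: (raddfB val).
split; first by apply/asboolP; apply: aeW => r _; rewrite val0.
move=> f g /asboolP f0 /asboolP g0; apply/asboolP.
apply: (@filterS2 _ _ (ae_filter_ringOfSetsType mu) _ _ _ _ f0 g0) => r f0' g0' r0.
by rewrite valB !fctE f0' // g0' // subr0.
Qed.
HB.instance Definition _ :=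
  GRing.isZmodClosed.Build L2fun L2null L2null_zmod_closed.

Definition L2 := Quotient.quot L2null.
HB.instance Definition _ := GRing.Zmodule.on L2.
HB.instance Definition _ := EqQuotient.on L2.

Definition L2scale (a : C) (x : L2) : L2 := \pi_L2 (a *: repr x).

Lemma L2scale_pi a (f : L2fun) : L2scale a (\pi_L2 f) = \pi_L2 (a *: f).
Proof.
apply/eqP; rewrite -[_ == _]Quotient.idealrBE -scalerBr.
have : repr (\pi_L2 f) - f \in L2null by rewrite Quotient.idealrBE reprK.
move=> /asboolP h; apply/asboolP.
apply: (@filterS _ _ (ae_filter_ringOfSetsType mu) _ _ _ h) => r h' r0.
have -> : L2fun_val (a *: (repr (\pi_L2 f) - f)) =
  a *: L2fun_val (repr (\pi_L2 f) - f) by [].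
by rewrite fctE h' // scaler0.
Qed.

Fact L2scaleA a b x : L2scale a (L2scale b x) = L2scale (a * b) x.
Proof. by rewrite [L2scale b x]/L2scale L2scale_pi scalerA. Qed.
Fact L2scale1 : left_id 1 L2scale.
Proof. by move=> x; rewrite /L2scale scale1r reprK. Qed.
Fact L2scaleDr : right_distributive L2scale +%R.
Proof.
move=> a x y; rewrite -[in LHS](reprK x) -[in LHS](reprK y).
by rewrite -(raddfD (\pi_L2)) L2scale_pi scalerDr raddfD.
Qed.
Fact L2scaleDl x : {morph L2scale^~ x : a b / a + b}.
Proof. by move=> a b; rewrite /L2scale scalerDl raddfD. Qed.
HB.instance Definition _ :=
  GRing.Zmodule_isLmodule.Build C L2 L2scaleA L2scale1 L2scaleDr L2scaleDl.

(* The class of f; only meaningful when sqint f holds (it is 0 otherwise). *)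
Definition L2class (f : R -> C) : L2 := \pi_L2 (insubd (0 : L2fun) f).

Definition inner (f g : L2) : C :=
  cintegral mu Rplus
    (fun r => (repr f : L2fun) r * conjc ((repr g : L2fun) r) / r%:C).

Definition L2norm (f : L2) : R := Num.sqrt (complex.Re (inner f f)).

End L2_space.

Section Operators.
Variable R : realType.
Local Notation C := R[i].
Local Notation L2 := (L2 R).
Implicit Types (A B P S T : L2 -> L2) (f g : L2) (e : nat -> L2).

Definition bounded_op A : Prop :=
  linear A /\ exists M : R, forall f, L2norm (A f) <= M * L2norm f.

Definition is_adjoint A B : Prop := forall f g, inner (A f) g = inner f (B g).

Definition adjoint A : L2 -> L2 := xget (fun=> 0) [set B | is_adjoint A B].

Definition is_onb e : Prop :=
  (forall m n, inner (e m) (e n) = (m == n)%:R) /\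
  (forall f, L2norm (f - \sum_(k < n) inner f (e k) *: e k)
     @[n --> \oo] --> (0 : R)).

(* P = |T| = (T^* T)^(1/2). The inequality in C says that the inner product   *)
(* is a nonnegative real number.                                              *)
Definition is_abs P T : Prop :=
  [/\ bounded_op P, forall f, 0 <= inner (P f) f &
      exists2 B, is_adjoint T B & forall f, P (P f) = B (T f)].

(* tr |T| does not depend on the orthonormal basis e in which it is computed. *)
Definition trace_class T : Prop :=
  bounded_op T /\
  exists P e, [/\ is_abs P T, is_onb e &
    (\sum_(0 <= k <oo) (complex.Re (inner (P (e k)) (e k)))%:E < +oo)%E].

(* The common sum, over all orthonormal bases e, of the diagonal of A. *)
Definition trace A : C :=
  xget 0 [set t : C | forall e, is_onb e ->
    (\sum_(k < n) inner (A (e k)) (e k) : C^o) @[n --> \oo] --> (t : C^o)].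

Definition mul_fun (w : R -> R) f : R -> C :=
  fun r => (w r)%:C * (repr f : L2fun R) r.
Definition mul_dom (w : R -> R) : set L2 := [set f | sqint (mul_fun w f)].
Definition mul_op (w : R -> R) f : L2 := L2class (mul_fun w f).

Definition domD : set L2 := mul_dom (fun r => Num.sqrt r).
Definition domDinv : set L2 := mul_dom (fun r => (Num.sqrt r)^-1).
Definition Dinv : L2 -> L2 := mul_op (fun r => (Num.sqrt r)^-1).

(* A is the trace-class extension of D^-1 S D^-1; it is unique because        *)
(* dom(D^-1) is dense.                                                        *)
Definition DinvSDinv_extension S A : Prop :=
  trace_class A /\ forall f, domDinv f -> A f = Dinv (S (Dinv f)).

Definition DinvSDinv S : L2 -> L2 :=
  xget (fun=> 0) [set A | DinvSDinv_extension S A].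

(* D^-1 maps dom(D^-1) into dom(D), so the third condition makes              *)
(* D^-1 S D^-1 well defined on dom(D^-1).                                     *)
Definition admissible S : Prop :=
  [/\ S <> (fun=> 0), bounded_op S,
      forall f, domD f -> domDinv (S f),
      exists M : R, forall f, domDinv f ->
        L2norm (Dinv (S (Dinv f))) <= M * L2norm f &
      exists A, DinvSDinv_extension S A].

Definition U (x a : R) f : L2 :=
  L2class (fun r => (cos (2 * pi * x * r) +i* sin (2 * pi * x * r)) *
                    (repr f : L2fun R) (a * r)).

Definition aff_conv T S (p : R * R) : C :=
  trace (T \o adjoint (U (- p.1) p.2) \o S \o U (- p.1) p.2).

End Operators.

Section Aff.
Variable R : realType.
Local Notation mu2 := (@lebesgue_measure R \x @lebesgue_measure R)%E.
Implicit Type F : R * R -> R[i].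

Definition Aff : set (R * R) := [set p | 0 < p.2].

Definition L1r F : Prop := cintegrable mu2 Aff (fun p => F p / (p.2)%:C).

Definition int_Aff F : R[i] := cintegral mu2 Aff (fun p => F p / (p.2)%:C).

End Aff.

(* Main.v *)
From HB Require Import structures.
Require Import Defs.
From mathcomp Require Import all_boot all_order all_algebra.
From mathcomp Require Import generic_quotient ring_quotient complex.
From mathcomp Require Import all_classical all_reals all_analysis.
From mathcomp Require Import measurable_realfun ring lra.

(** The convolution of a rank one operator f |-> <f,u> v with S is the matrix
    coefficient <S U v, U u>, where U = U(-x,a). Trace-class operators are absolutely
    summable series of rank one operators, so the theorem follows from the
    integral of these coefficients, namely <v,u> tr(A) with A the extension of
    D^-1 S D^-1 (orbit_form_integral), together with the bound
    c |u| |v| for the integral of their modulus, which allows termwise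
    integration (cintegral_series).

    For f and g in dom D the coefficient is <S U f, U g> = <A D U f, D U g>
    (admissible_form). Expanding A in rank one operators h |-> <h,p> q as well, it
    is a series of products <D U f, p> <q, D U g>, and the Duflo-Moore relation
      int <D U f, p> conj <D U g, q> dx da / a = <f,g> <q,p>
    (duflo_moore) gives the value <f,g> tr(A). The resulting bound involves only
    the norms of f and g, so truncations extend everything from dom D to all
    of L^2. The Duflo-Moore relation in turn is Plancherel's theorem: for fixed a,
    x |-> <D U(-x,a) f, p> is the Fourier transform of the function
    f(a r) conj p(r) r^(-1/2) of r on the half-line, and the invariance of
    da / a separates the norms of f and p (duflo_moore_norm); polarization
    does the rest.

    The rank one expansion of a trace-class T (trace_class_expansion) comes
    from Cholesky elimination of |T| in an orthonormal basis in which the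
    trace of |T| is finite: successive rank one operators are subtracted so that
    the remainder stays positive and annihilates one more basis vector. The trace of T o B is then the
    series of the <B v_k, u_k>, in whichever basis it is computed
    (trace_comp_expansion). Plancherel's theorem (plancherel) for integrable
    square-integrable u is obtained with the weight exp(-eps |x|), whose Fourier
    transform is the Poisson kernel; the difference between the weighted
    integral and the squared norm of u is an average of the mean square distances
    between u and its translates, and translation is continuous
    (sqn_translation_cvg). *)

Set Implicit Arguments.
Unset Strict Implicit.
Unset Printing Implicit Defensive.

Import Order.TTheory GRing.Theory Num.Theory.
Import numFieldNormedType.Exports.

Local Open Scope classical_set_scope.
Local Open Scope ring_scope.
Local Open Scope quotient_scope.
Local Open Scope complex_scope.

(** * Complex numbers and complex-valued integrals *)

Notation normc := ComplexField.Normc.normc.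
Notation normcM := ComplexField.Normc.normcM.
Notation normc0 := ComplexField.Normc.normc0.

Section ComplexNumbers.
Variable R : realType.
Implicit Types z w : R[i].

Lemma complex_eqP z w : complex.Re z = complex.Re w ->
  complex.Im z = complex.Im w -> z = w.
Proof. by case: z w => [a b] [c d] /= -> ->. Qed.

Lemma ReD z w : complex.Re (z + w) = complex.Re z + complex.Re w.
Proof. by case: z w => [a b] [c d]. Qed.
Lemma ImD z w : complex.Im (z + w) = complex.Im z + complex.Im w.
Proof. by case: z w => [a b] [c d]. Qed.
Lemma ReN z : complex.Re (- z) = - complex.Re z.
Proof. by case: z. Qed.
Lemma ImN z : complex.Im (- z) = - complex.Im z.
Proof. by case: z. Qed.
Lemma ReM z w : complex.Re (z * w) =
  complex.Re z * complex.Re w - complex.Im z * complex.Im w.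
Proof. by case: z w => [a b] [c d]. Qed.
Lemma ImM z w : complex.Im (z * w) =
  complex.Re z * complex.Im w + complex.Im z * complex.Re w.
Proof. by case: z w => [a b] [c d]. Qed.
Lemma ReJ z : complex.Re (conjc z) = complex.Re z.
Proof. by case: z. Qed.
Lemma ImJ z : complex.Im (conjc z) = - complex.Im z.
Proof. by case: z. Qed.
Lemma Re_real (x : R) : complex.Re (x%:C) = x. Proof. by []. Qed.
Lemma Im_real (x : R) : complex.Im (x%:C) = 0. Proof. by []. Qed.
Lemma Re_sum I (r : seq I) (P : pred I) (F : I -> R[i]) :
  complex.Re (\sum_(i <- r | P i) F i) = \sum_(i <- r | P i) complex.Re (F i).
Proof. by apply: (big_morph (@complex.Re R)) => // x y; rewrite ReD. Qed.
Definition reimE := (ReD, ImD, ReN, ImN, ReM, ImM, ReJ, ImJ,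
  Re_real, Im_real).

Lemma conjcD z w : conjc (z + w) = conjc z + conjc w.
Proof. exact: (raddfD (@conjc R)). Qed.
Lemma conjcN z : conjc (- z) = - conjc z.
Proof. exact: (raddfN (@conjc R)). Qed.
Lemma conjcM z w : conjc (z * w) = conjc z * conjc w.
Proof. exact: (rmorphM (@conjc R)). Qed.
Lemma normc_ge0 z : 0 <= normc z.
Proof. by case: z => a b; exact: sqrtr_ge0. Qed.
Lemma sqr_normcE z : normc z ^+ 2 = complex.Re z ^+ 2 + complex.Im z ^+ 2.
Proof. by case: z => a b /=; rewrite sqr_sqrtr ?addr_ge0 ?sqr_ge0. Qed.
Lemma ler_normc_sum I (r : seq I) (P : pred I) (F : I -> R[i]) :
  normc (\sum_(i <- r | P i) F i) <= \sum_(i <- r | P i) normc (F i).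
Proof.
elim/big_rec2: _ => [|i x y _]; first by rewrite normc0.
by move=> le; apply: le_trans (le_normcD _ _) _; rewrite lerD2l.
Qed.
Lemma normc_conj z : normc (conjc z) = normc z.
Proof. by case: z => a b /=; rewrite sqrrN. Qed.
Lemma distcC z w : normc (z - w) = normc (w - z).
Proof. by rewrite -normcN opprB. Qed.
Lemma normc_real (x : R) : normc (x%:C) = `|x|.
Proof. by rewrite /= expr0n addr0 sqrtr_sqr. Qed.
Lemma ler_sqr_normc (x : R) z : 0 <= x -> (normc z <= x) = (normc z ^+ 2 <= x ^+ 2).
Proof. by move=> x0; rewrite ler_sqr ?nnegrE ?normc_ge0. Qed.
Lemma Re_le_normc z : `|complex.Re z| <= normc z.
Proof.
rewrite -[leRHS]ger0_norm ?normc_ge0// -ler_sqr ?nnegrE// !real_normK ?num_real//.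
by rewrite sqr_normcE lerDl sqr_ge0.
Qed.
Lemma Im_le_normc z : `|complex.Im z| <= normc z.
Proof.
rewrite -[leRHS]ger0_norm ?normc_ge0// -ler_sqr ?nnegrE// !real_normK ?num_real//.
by rewrite sqr_normcE lerDr sqr_ge0.
Qed.
Lemma ler_dist_normc z w : `|normc z - normc w| <= normc (z - w).
Proof.
rewrite ler_norml; apply/andP; split.
  rewrite lerNl opprB lerBlDr distcC.
  by apply: le_trans (le_normcD _ _); rewrite subrK.
by rewrite lerBlDr; apply: le_trans (le_normcD _ _); rewrite subrK.
Qed.
Lemma normc_le_ReIm z : normc z <= `|complex.Re z| + `|complex.Im z|.
Proof.
rewrite ler_sqr_normc ?addr_ge0// sqr_normcE sqrrD !real_normK ?num_real//.
by rewrite addrAC lerDl mulrn_wge0 ?mulr_ge0.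
Qed.
Lemma mul_conjc z : z * conjc z = (normc z ^+ 2)%:C.
Proof.
by apply: complex_eqP; rewrite !reimE; [rewrite sqr_normcE|]; ring.
Qed.

Lemma cvg_real_normc (z : nat -> R[i]) (t : R[i]) :
  complex.Re (z n) @[n --> \oo] --> complex.Re t ->
  complex.Im (z n) @[n --> \oo] --> complex.Im t ->
  normc (z n - t) @[n --> \oo] --> (0 : R).
Proof.
move=> hr hi.
apply: (@squeeze_cvgr _ _ _ _ (cst 0)
  (fun n => `|complex.Re (z n) - complex.Re t| + `|complex.Im (z n) - complex.Im t|)).
- near=> n; rewrite normc_ge0 andTb.
  by have := normc_le_ReIm (z n - t); rewrite !reimE.
- exact: cvg_cst.
- rewrite -(addr0 0); apply: cvgD.
  + by apply/norm_cvg0P/subr_cvg0.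
  + by apply/norm_cvg0P/subr_cvg0.
Unshelve. all: by end_near. Qed.

Lemma normc_cvg_Re (z : nat -> R[i]) (t : R[i]) :
  normc (z n - t) @[n --> \oo] --> (0 : R) ->
  complex.Re (z n) @[n --> \oo] --> complex.Re t.
Proof.
move=> h; apply/subr_cvg0/norm_cvg0P.
apply: (@squeeze_cvgr _ _ _ _ (cst 0) (fun n => normc (z n - t))) => //.
  near=> n; rewrite /= normr_ge0/=.
  by have := Re_le_normc (z n - t); rewrite !reimE.
exact: cvg_cst.
Unshelve. all: by end_near. Qed.

Lemma normc_cvg_Im (z : nat -> R[i]) (t : R[i]) :
  normc (z n - t) @[n --> \oo] --> (0 : R) ->
  complex.Im (z n) @[n --> \oo] --> complex.Im t.
Proof.
move=> h; apply/subr_cvg0/norm_cvg0P.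
apply: (@squeeze_cvgr _ _ _ _ (cst 0) (fun n => normc (z n - t))) => //.
  near=> n; rewrite /= normr_ge0/=.
  by have := Im_le_normc (z n - t); rewrite !reimE.
exact: cvg_cst.
Unshelve. all: by end_near. Qed.

End ComplexNumbers.

Section ComplexIntegral.
Context d (T : measurableType d) (R : realType).
Variables (mu : {measure set T -> \bar R}) (D : set T).
Hypothesis mD : measurable D.
Implicit Types f g : T -> R[i].

Lemma cmeasurable_normc f : cmeasurable_fun D f ->
  measurable_fun D (fun t => normc (f t)).
Proof.
move=> [mr mi]; rewrite (_ : (fun _ => _) = (fun t => Num.sqrt
  (complex.Re (f t) ^+ 2 + complex.Im (f t) ^+ 2))); last first.
  by apply/funext => t; case: (f t).
apply: (measurable_comp (F := setT)) => //.
  by apply: continuous_measurable_fun; exact: sqrt_continuous.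
by apply: measurable_funD; exact: measurable_funX.
Qed.

Lemma cmeasurableD f g : cmeasurable_fun D f -> cmeasurable_fun D g ->
  cmeasurable_fun D (fun t => f t + g t).
Proof.
move=> [fr fi] [gr gi]; split.
  apply: (eq_measurable_fun (fun t => complex.Re (f t) + complex.Re (g t))).
    by move=> t _; rewrite reimE.
  exact: measurable_funD.
apply: (eq_measurable_fun (fun t => complex.Im (f t) + complex.Im (g t))).
  by move=> t _; rewrite reimE.
exact: measurable_funD.
Qed.

Lemma cmeasurableN f : cmeasurable_fun D f -> cmeasurable_fun D (fun t => - f t).
Proof.
move=> [fr fi]; split.
  apply: (eq_measurable_fun (fun t => - complex.Re (f t))).
    by move=> t _; rewrite reimE.
  exact: measurableT_comp.
apply: (eq_measurable_fun (fun t => - complex.Im (f t))).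
  by move=> t _; rewrite reimE.
exact: measurableT_comp.
Qed.

Lemma cmeasurableB f g : cmeasurable_fun D f -> cmeasurable_fun D g ->
  cmeasurable_fun D (fun t => f t - g t).
Proof. by move=> mf mg; apply: cmeasurableD => //; exact: cmeasurableN. Qed.

Lemma cmeasurableM f g : cmeasurable_fun D f -> cmeasurable_fun D g ->
  cmeasurable_fun D (fun t => f t * g t).
Proof.
move=> [fr fi] [gr gi]; split.
  apply: (eq_measurable_fun (fun t => complex.Re (f t) * complex.Re (g t)
      - complex.Im (f t) * complex.Im (g t))).
    by move=> t _; rewrite reimE.
  by apply: measurable_funB; exact: measurable_funM.
apply: (eq_measurable_fun (fun t => complex.Re (f t) * complex.Im (g t)
    + complex.Im (f t) * complex.Re (g t))).
  by move=> t _; rewrite reimE.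
by apply: measurable_funD; exact: measurable_funM.
Qed.

Lemma cmeasurable_conj f : cmeasurable_fun D f ->
  cmeasurable_fun D (fun t => conjc (f t)).
Proof.
move=> [fr fi]; split.
  apply: (eq_measurable_fun (fun t => complex.Re (f t))) => //.
  by move=> t _; rewrite reimE.
apply: (eq_measurable_fun (fun t => - complex.Im (f t))).
  by move=> t _; rewrite reimE.
exact: measurableT_comp.
Qed.

Lemma cmeasurable_cst (z : R[i]) : cmeasurable_fun D (fun=> z).
Proof. by split; exact: measurable_cst. Qed.

Lemma cmeasurable_real (h : T -> R) : measurable_fun D h ->
  cmeasurable_fun D (fun t => (h t)%:C).
Proof. by move=> mh; split => //; exact: measurable_cst. Qed.

Lemma cmeasurable_eq f g : {in D, f =1 g} -> cmeasurable_fun D f ->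
  cmeasurable_fun D g.
Proof.
by move=> fg [fr fi]; split; [apply: eq_measurable_fun fr|
  apply: eq_measurable_fun fi] => x Dx /=; rewrite fg.
Qed.

Lemma cmeasurable_lim (F : nat -> T -> R[i]) f :
  (forall n, cmeasurable_fun D (F n)) ->
  (forall t, D t -> normc (F n t - f t) @[n --> \oo] --> (0 : R)) ->
  cmeasurable_fun D f.
Proof.
move=> mF Ff; split.
  apply: (@measurable_fun_cvg _ _ _ _ (fun n t => complex.Re (F n t))) => //.
    by move=> n; case: (mF n).
  by move=> t Dt; exact: normc_cvg_Re (Ff t Dt).
apply: (@measurable_fun_cvg _ _ _ _ (fun n t => complex.Im (F n t))) => //.
  by move=> n; case: (mF n).
by move=> t Dt; exact: normc_cvg_Im (Ff t Dt).
Qed.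

Lemma cintegrable_measurable f : cintegrable mu D f -> cmeasurable_fun D f.
Proof.
by move=> [/measurable_int/measurable_EFinP ? /measurable_int/measurable_EFinP ?].
Qed.

Lemma cintegrable_le f (g : T -> R) : cmeasurable_fun D f ->
  mu.-integrable D (EFin \o g) -> (forall t, D t -> normc (f t) <= g t) ->
  cintegrable mu D f.
Proof.
move=> [mr mi] ig fg; split.
  apply: (le_integrable mD _ _ ig); first exact/measurable_EFinP.
  move=> t Dt; rewrite /= lee_fin; apply: le_trans (Re_le_normc _) _.
  by rewrite (le_trans (fg _ Dt))// ler_norm.
apply: (le_integrable mD _ _ ig); first exact/measurable_EFinP.
move=> t Dt; rewrite /= lee_fin; apply: le_trans (Im_le_normc _) _.
by rewrite (le_trans (fg _ Dt))// ler_norm.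
Qed.

Lemma cintegrable_normc f : cintegrable mu D f ->
  mu.-integrable D (fun t => (normc (f t))%:E).
Proof.
move=> If; have [Ir Ii] := If.
apply: (le_integrable mD _ _ (integrableD mD (integrable_norm Ir) (integrable_norm Ii))).
  by apply/measurable_EFinP/cmeasurable_normc; exact: cintegrable_measurable.
move=> t Dt; rewrite /= lee_fin ger0_norm ?normc_ge0//.
by rewrite (le_trans (normc_le_ReIm _))// ler_norm.
Qed.

Lemma cintegrableP f : cintegrable mu D f <->
  cmeasurable_fun D f /\ (\int[mu]_(t in D) (normc (f t))%:E < +oo)%E.
Proof.
split=> [If|[mf If]].
  split; first exact: cintegrable_measurable.
  have /integrableP[_] := cintegrable_normc If.
  by under eq_integral do rewrite gee0_abs ?lee_fin ?normc_ge0//.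
apply: (cintegrable_le (g := fun t => normc (f t))) => //.
apply/integrableP; split.
  by apply/measurable_EFinP; exact: cmeasurable_normc.
by under eq_integral do rewrite gee0_abs ?lee_fin ?normc_ge0//.
Qed.

Lemma eq_cintegrable f g : (forall t, D t -> f t = g t) ->
  cintegrable mu D f -> cintegrable mu D g.
Proof.
by move=> fg [fr fi]; split; [apply: eq_integrable fr|apply: eq_integrable fi] =>
  // t /set_mem Dt; rewrite fg.
Qed.

Lemma cintegrableD f g : cintegrable mu D f -> cintegrable mu D g ->
  cintegrable mu D (fun t => f t + g t).
Proof.
move=> [fr fi] [gr gi]; split.
  apply: (eq_integrable mD _ _ _ (integrableD mD fr gr)) => t _.
  by rewrite reimE EFinD.
apply: (eq_integrable mD _ _ _ (integrableD mD fi gi)) => t _.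
by rewrite reimE EFinD.
Qed.

Lemma cintegrableZ z f : cintegrable mu D f ->
  cintegrable mu D (fun t => z * f t).
Proof.
move=> [fr fi]; split.
  apply: (eq_integrable mD _ _ _ (integrableB mD
    (integrableZl mD (complex.Re z) fr) (integrableZl mD (complex.Im z) fi))).
  by move=> t _; rewrite reimE EFinB !EFinM.
apply: (eq_integrable mD _ _ _ (integrableD mD
  (integrableZl mD (complex.Re z) fi) (integrableZl mD (complex.Im z) fr))).
by move=> t _; rewrite reimE EFinD !EFinM.
Qed.

Lemma cintegrable_cst0 : cintegrable mu D (fun=> 0).
Proof. by split; exact: integrable0. Qed.

Lemma cintegrable_sum (I : Type) (r : seq I) (F : I -> T -> R[i]) :
  (forall i, cintegrable mu D (F i)) ->
  cintegrable mu D (fun t => \sum_(i <- r) F i t).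
Proof.
move=> mF; elim: r => [|i r IH].
  by apply: eq_cintegrable cintegrable_cst0 => t _; rewrite big_nil.
apply: eq_cintegrable (cintegrableD (mF i) IH) => t _.
by rewrite big_cons.
Qed.

Lemma eq_cintegral f g : (forall t, D t -> f t = g t) ->
  cintegral mu D f = cintegral mu D g.
Proof.
move=> fg; apply: complex_eqP => /=; apply: eq_Rintegral => t /set_mem Dt;
  by rewrite fg.
Qed.

Lemma cintegralD f g : cintegrable mu D f -> cintegrable mu D g ->
  cintegral mu D (fun t => f t + g t) = cintegral mu D f + cintegral mu D g.
Proof.
move=> [fr fi] [gr gi]; apply: complex_eqP; rewrite !reimE /=.
  by rewrite -RintegralD//; apply: eq_Rintegral => t _; rewrite !reimE.
by rewrite -RintegralD//; apply: eq_Rintegral => t _; rewrite !reimE.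
Qed.

Lemma cintegralZ z f : cintegrable mu D f ->
  cintegral mu D (fun t => z * f t) = z * cintegral mu D f.
Proof.
move=> [fr fi]; apply: complex_eqP; rewrite !reimE /=.
  rewrite -!RintegralZl// -RintegralB//; last 2 first.
  - exact: (integrableZl mD (complex.Re z) fr).
  - exact: (integrableZl mD (complex.Im z) fi).
  by apply: eq_Rintegral => t _; rewrite !reimE.
rewrite -!RintegralZl// -RintegralD//; last 2 first.
- exact: (integrableZl mD (complex.Re z) fi).
- exact: (integrableZl mD (complex.Im z) fr).
by apply: eq_Rintegral => t _; rewrite !reimE.
Qed.

Lemma cintegral_conj f : cintegrable mu D f ->
  cintegral mu D (fun t => conjc (f t)) = conjc (cintegral mu D f).
Proof.
move=> [fr fi]; apply: complex_eqP; rewrite !reimE /=.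
  by apply: eq_Rintegral => t _; rewrite !reimE.
rewrite -mulN1r -RintegralZl//.
by apply: eq_Rintegral => t _; rewrite !reimE mulN1r.
Qed.

Lemma cintegral_cst0 : cintegral mu D (fun=> 0) = 0.
Proof.
by apply: complex_eqP => /=; rewrite /Rintegral integral0.
Qed.

Lemma cintegralB f g : cintegrable mu D f -> cintegrable mu D g ->
  cintegral mu D (fun t => f t - g t) = cintegral mu D f - cintegral mu D g.
Proof.
move=> If Ig; rewrite -mulN1r -cintegralZ// -cintegralD//.
  by apply: eq_cintegral => t _; rewrite mulN1r.
exact: cintegrableZ.
Qed.

Lemma cintegral_sum (I : Type) (r : seq I) (F : I -> T -> R[i]) :
  (forall i, cintegrable mu D (F i)) ->
  cintegral mu D (fun t => \sum_(i <- r) F i t) =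
  \sum_(i <- r) cintegral mu D (F i).
Proof.
move=> mF; elim: r => [|i r IH].
  rewrite big_nil; apply: etrans cintegral_cst0.
  by apply: eq_cintegral => t _; rewrite big_nil.
rewrite big_cons -IH -cintegralD//; last exact: cintegrable_sum.
by apply: eq_cintegral => t _; rewrite big_cons.
Qed.

Lemma ae_eq_cintegral f g : cmeasurable_fun D f -> cmeasurable_fun D g ->
  {ae mu, forall t, D t -> f t = g t} -> cintegral mu D f = cintegral mu D g.
Proof.
move=> [fr fi] [gr gi] fg; apply: complex_eqP => /=; congr fine.
  apply: ae_eq_integral => //; [exact/measurable_EFinP|exact/measurable_EFinP|].
  by apply: filterS fg => t fg Dt /=; rewrite fg.
apply: ae_eq_integral => //; [exact/measurable_EFinP|exact/measurable_EFinP|].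
by apply: filterS fg => t fg Dt; rewrite fg.
Qed.

(** Rotating the integral onto the positive real axis reduces the triangle
    inequality to the one for the real part. *)
Lemma normc_cintegral_le f : cintegrable mu D f ->
  ((normc (cintegral mu D f))%:E <= \int[mu]_(t in D) (normc (f t))%:E)%E.
Proof.
move=> If; set z := cintegral mu D f.
have In := cintegrable_normc If.
rewrite -[leRHS]fineK; last first.
  apply: integrable_fin_num => //; exact: In.
rewrite lee_fin -/(Rintegral mu D (fun t => normc (f t))).
have [z0|z0] := eqVneq (normc z) 0.
  by rewrite z0; apply: Rintegral_ge0 => t _; exact: normc_ge0.
have zp : 0 < normc z by rewrite lt_neqAle eq_sym z0 normc_ge0.
rewrite -(ler_pM2l zp) -expr2.
have <- : complex.Re (cintegral mu D (fun t => conjc z * f t)) = normc z ^+ 2.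
  by rewrite cintegralZ// -/z mulrC mul_conjc.
rewrite -RintegralZl//; apply: le_Rintegral => //.
- by case: (cintegrableZ (conjc z) If).
- exact: (integrableZl mD (normc z) In).
move=> t Dt; apply: le_trans (ler_norm _) _; apply: le_trans (Re_le_normc _) _.
rewrite normcM.
by rewrite normc_conj.
Qed.

(** Completeness of L^1 with the limit known pointwise: Fatou's lemma turns the
    Cauchy estimate into the estimate for the limit. *)
Lemma cintegral_cvg_L1 (F : nat -> T -> R[i]) f (b : nat -> R) :
  (forall n, cintegrable mu D (F n)) ->
  (forall t, D t -> normc (F n t - f t) @[n --> \oo] --> (0 : R)) ->
  (forall n m, (n <= m)%N ->
    (\int[mu]_(t in D) (normc (F m t - F n t))%:E <= (b n)%:E)%E) ->
  b @ \oo --> (0 : R) ->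
  [/\ cintegrable mu D f,
      forall n, (\int[mu]_(t in D) (normc (f t - F n t))%:E <= (b n)%:E)%E &
      normc (cintegral mu D (F n) - cintegral mu D f) @[n --> \oo] --> (0 : R)].
Proof.
move=> IF Ff Fb b0.
have mF n : cmeasurable_fun D (F n) by exact: cintegrable_measurable.
have mf : cmeasurable_fun D f by exact: cmeasurable_lim Ff.
have fb n : (\int[mu]_(t in D) (normc (f t - F n t))%:E <= (b n)%:E)%E.
  have -> : (\int[mu]_(t in D) (normc (f t - F n t))%:E =
      \int[mu]_(t in D) limn_einf (fun m => (normc (F m t - F n t))%:E))%E.
    apply: eq_integral => t /set_mem Dt; apply/esym.
    suff h : normc (F m t - F n t) @[m --> \oo] --> normc (f t - F n t).
      have h' : (normc (F m t - F n t))%:E @[m --> \oo] --> (normc (f t - F n t))%:E.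
        by apply/fine_cvgP; split => //; exact: nearW.
      by have [] := cvg_limn_einf_sup h'.
    apply/subr_cvg0/norm_cvg0P.
    apply: (@squeeze_cvgr _ _ _ _ (cst 0) (fun n => normc (F n t - f t))).
    - near=> m; rewrite /= normr_ge0/=; apply: le_trans (ler_dist_normc _ _) _.
      by rewrite opprB addrA subrK.
    - exact: cvg_cst.
    - exact: Ff.
  apply: le_trans.
    apply: fatou => // m.
    - by apply/measurable_EFinP/cmeasurable_normc; exact: cmeasurableB.
    - by move=> t _; rewrite lee_fin normc_ge0.
  rewrite limn_einf_lim; apply: lime_le; first exact: is_cvg_einfs.
  near=> k; apply: ereal_inf_le.
  have kn : (n <= k)%N by near: k; exists n.
  exists (\int[mu]_(t in D) (normc (F k t - F n t))%:E)%E; last exact: Fb.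
  by exists k => /=.
have If n : cintegrable mu D (fun t => f t - F n t).
  apply/cintegrableP; split; first exact: cmeasurableB.
  by apply: le_lt_trans (fb n) _; rewrite ltry.
have Iff : cintegrable mu D f.
  have := cintegrableD (If 0%N) (IF 0%N).
  by apply: eq_cintegrable => t _; rewrite subrK.
split => //.
apply: (@squeeze_cvgr _ _ _ _ (cst 0) b) => //; last exact: cvg_cst.
near=> n; rewrite normc_ge0 andTb distcC -cintegralB// -lee_fin.
by apply: le_trans (normc_cintegral_le (If n)) (fb n).
Unshelve. all: by end_near. Qed.

End ComplexIntegral.

(** * The inner product of square-integrable functions on the half-line *)

Section L2Structure.
Variable R : realType.
Local Notation C := R[i].
Local Notation mu := (@lebesgue_measure R).
Local Notation Rplus := (`]0%R, +oo[%classic : set R).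
Local Notation L2 := (L2 R).
Implicit Types f g h : L2.

(** A representative of the class f: identities between such values hold almost
    everywhere on the half-line only. *)
Definition L2fn f : R -> C := L2fun_val (repr f).

Lemma RplusE (r : R) : Rplus r = (0 < r) :> Prop.
Proof. by rewrite /= in_itv /= andbT. Qed.

Lemma measurable_Rplus : measurable (Rplus : set (measurableTypeR R)).
Proof. exact: measurable_itv. Qed.
Hint Resolve measurable_Rplus : core.

Lemma ae_mp (P Q : R -> Prop) : (forall r, P r -> Q r) ->
  {ae mu, forall r, P r} -> {ae mu, forall r, Q r}.
Proof. exact: (@filterS _ _ (ae_filter_ringOfSetsType mu)). Qed.

Lemma ae_mp2 (P P' Q : R -> Prop) : (forall r, P r -> P' r -> Q r) ->
  {ae mu, forall r, P r} -> {ae mu, forall r, P' r} -> {ae mu, forall r, Q r}.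
Proof. exact: (@filterS2 _ _ (ae_filter_ringOfSetsType mu)). Qed.

Lemma ae_pos_mp (P Q : R -> Prop) : (forall r, 0 < r -> P r -> Q r) ->
  {ae mu, forall r, 0 < r -> P r} -> {ae mu, forall r, 0 < r -> Q r}.
Proof. by move=> PQ; apply: ae_mp => r h r0; apply: PQ => //; exact: h. Qed.

Lemma ae_pos_mp2 (P P' Q : R -> Prop) : (forall r, 0 < r -> P r -> P' r -> Q r) ->
  {ae mu, forall r, 0 < r -> P r} -> {ae mu, forall r, 0 < r -> P' r} ->
  {ae mu, forall r, 0 < r -> Q r}.
Proof.
move=> PQ.
by apply: ae_mp2 => r h h' r0; apply: PQ => //; [exact: h|exact: h'].
Qed.

Lemma L2fn_sqint f : sqint (L2fn f).
Proof. by have /asboolP := L2funP (repr f). Qed.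

Lemma L2fn_measurable f : cmeasurable_fun Rplus (L2fn f).
Proof. by case: (L2fn_sqint f). Qed.

Lemma L2fn_pi (u : L2fun R) :
  {ae mu, forall r, 0 < r -> L2fn (\pi_(Defs.L2 R) u) r = u r}.
Proof.
have : repr (\pi_(Defs.L2 R) u) - u \in @L2null R.
  by rewrite Quotient.idealrBE reprK.
move=> /asboolP; apply: ae_pos_mp => r r0 /eqP.
by rewrite /L2fn subr_eq0 => /eqP.
Qed.

Lemma L2class_fn (u : R -> C) : sqint u ->
  {ae mu, forall r, 0 < r -> L2fn (L2class u) r = u r}.
Proof.
move=> su; have := L2fn_pi (insubd (0 : L2fun R) u).
by rewrite insubdK//; apply/asboolP.
Qed.

Lemma L2_ext f g : {ae mu, forall r, 0 < r -> L2fn f r = L2fn g r} -> f = g.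
Proof.
move=> fg; rewrite -[f]reprK -[g]reprK; apply/eqP.
rewrite -[_ == _]Quotient.idealrBE; apply/asboolP.
by apply: ae_pos_mp fg => r _ fg; rewrite -[LHS]/(L2fn f r - L2fn g r) fg subrr.
Qed.

Lemma L2fnD f g : {ae mu, forall r, 0 < r -> L2fn (f + g) r = L2fn f r + L2fn g r}.
Proof.
have := L2fn_pi (repr f + repr g).
by rewrite raddfD /= !reprK.
Qed.

Lemma L2fnZ c f : {ae mu, forall r, 0 < r -> L2fn (c *: f) r = c * L2fn f r}.
Proof. exact: (L2fn_pi (c *: repr f)). Qed.

Lemma L2fn0 : {ae mu, forall r, 0 < r -> L2fn 0 r = 0}.
Proof.
by have := L2fnZ 0 0; rewrite scale0r; apply: ae_pos_mp => r _ ->; rewrite mul0r.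
Qed.

Lemma L2fnB f g : {ae mu, forall r, 0 < r -> L2fn (f - g) r = L2fn f r - L2fn g r}.
Proof.
have := L2fnZ (-1) g; have := L2fnD f (- g); rewrite scaleN1r.
by apply: ae_pos_mp2 => r _ -> ->; rewrite mulN1r.
Qed.

Lemma cmeasurable_invr : cmeasurable_fun Rplus (fun r : R => (r^-1)%:C).
Proof.
apply: cmeasurable_real; apply: open_continuous_measurable_fun => //.
by move=> r /set_mem; rewrite RplusE => r0; apply: inv_continuous; rewrite gt_eqF.
Qed.

Definition inner_fun (u v : R -> C) : R -> C :=
  fun r => u r * conjc (v r) / r%:C.

Lemma invr_real (r : R) : r%:C^-1 = (r^-1)%:C :> C.
Proof. exact: (esym (fmorphV (real_complex R) r)). Qed.

Lemma inner_fun_measurable (u v : R -> C) :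
  cmeasurable_fun Rplus u -> cmeasurable_fun Rplus v ->
  cmeasurable_fun Rplus (inner_fun u v).
Proof.
move=> mu' mv; apply: (@cmeasurable_eq _ _ _ _
  (fun r => u r * conjc (v r) * (r^-1)%:C)).
  by move=> r _; rewrite /inner_fun invr_real.
apply: cmeasurableM => //; last exact: cmeasurable_invr.
by apply: cmeasurableM => //; exact: cmeasurable_conj.
Qed.

Lemma measurable_sqr_normc_inv (u : R -> C) : cmeasurable_fun Rplus u ->
  measurable_fun Rplus (fun r => (normc (u r) ^+ 2 / r)%:E).
Proof.
move=> mu'; apply/measurable_EFinP; apply: measurable_funM.
  by apply: measurable_funX; exact: cmeasurable_normc.
by case: cmeasurable_invr.
Qed.

Lemma sqr_normc_inv_ge0 (u : R -> C) r : Rplus r -> (0 <= (normc (u r) ^+ 2 / r)%:E)%E.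
Proof. by rewrite RplusE => r0; rewrite lee_fin divr_ge0 ?sqr_ge0// ltW. Qed.

Lemma sqint_integrable (u : R -> C) : sqint u ->
  mu.-integrable Rplus (fun r => (normc (u r) ^+ 2 / r)%:E).
Proof.
move=> [mu' Iu]; apply/integrableP; split; first exact: measurable_sqr_normc_inv.
move: Iu; congr (_ < _)%E; apply: eq_integral => r /set_mem r0.
by rewrite gee0_abs//; exact: sqr_normc_inv_ge0.
Qed.

Lemma inner_fun_integrable (u v : R -> C) : sqint u -> sqint v ->
  cintegrable mu Rplus (inner_fun u v).
Proof.
move=> su sv; have Iu := sqint_integrable su; have Iv := sqint_integrable sv.
apply: (cintegrable_le measurable_Rplus (g := fun r =>
  normc (u r) ^+ 2 / r + normc (v r) ^+ 2 / r)).
- by apply: inner_fun_measurable; [case: su|case: sv].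
- exact: (integrableD measurable_Rplus Iu Iv).
move=> r; rewrite RplusE => r0; rewrite /inner_fun !normcM.
rewrite normc_conj invr_real normc_real gtr0_norm ?invr_gt0// -mulrDl.
rewrite ler_pM2r ?invr_gt0//.
have h := sqr_ge0 (normc (u r) - normc (v r)).
have h1 := mulr_ge0 (normc_ge0 (u r)) (normc_ge0 (v r)).
move: h h1; set a := normc (u r); set b := normc (v r) => h h1.
nra.
Qed.

Lemma innerE f g u v : cmeasurable_fun Rplus u -> cmeasurable_fun Rplus v ->
  {ae mu, forall r, 0 < r -> L2fn f r = u r} ->
  {ae mu, forall r, 0 < r -> L2fn g r = v r} ->
  inner f g = cintegral mu Rplus (inner_fun u v).
Proof.
move=> mu' mv fu gv; apply: (ae_eq_cintegral measurable_Rplus).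
- by apply: inner_fun_measurable; exact: L2fn_measurable.
- exact: inner_fun_measurable.
apply: ae_mp2 fu gv => r fu gv; rewrite RplusE => r0.
by rewrite /inner_fun -/(L2fn f r) -/(L2fn g r) fu// gv.
Qed.

Lemma inner_integrable f g : cintegrable mu Rplus (inner_fun (L2fn f) (L2fn g)).
Proof. by apply: inner_fun_integrable; exact: L2fn_sqint. Qed.

Lemma innerDl f g h : inner (f + g) h = inner f h + inner g h.
Proof.
rewrite (innerE (v := L2fn h) _ _ (L2fnD f g)).
- rewrite -(cintegralD measurable_Rplus (inner_integrable f h) (inner_integrable g h)).
  by apply: (eq_cintegral) => r _; rewrite /inner_fun mulrDl mulrDl.
- by apply: cmeasurableD => //; exact: L2fn_measurable.
- exact: L2fn_measurable.
- exact: aeW.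
Qed.

Lemma innerZl c f h : inner (c *: f) h = c * inner f h.
Proof.
rewrite (innerE (v := L2fn h) _ _ (L2fnZ c f)).
- rewrite -(cintegralZ measurable_Rplus c (inner_integrable f h)).
  by apply: (eq_cintegral) => r _; rewrite /inner_fun !mulrA.
- by apply: cmeasurableM; [exact: cmeasurable_cst|exact: L2fn_measurable].
- exact: L2fn_measurable.
- exact: aeW.
Qed.

Lemma inner_conj f g : inner f g = conjc (inner g f).
Proof.
rewrite -(cintegral_conj measurable_Rplus (inner_integrable g f)).
apply: eq_cintegral => r _; rewrite /inner_fun invr_real !conjcM conjcK.
by rewrite conjc_real [_ * L2fn f r]mulrC.
Qed.

Lemma innerDr f g h : inner f (g + h) = inner f g + inner f h.
Proof. by rewrite inner_conj innerDl conjcD -!inner_conj. Qed.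

Lemma innerZr c f h : inner f (c *: h) = conjc c * inner f h.
Proof. by rewrite inner_conj innerZl conjcM -inner_conj. Qed.

Lemma innerNl f g : inner (- f) g = - inner f g.
Proof. by rewrite -scaleN1r innerZl mulN1r. Qed.
Lemma innerNr f g : inner f (- g) = - inner f g.
Proof. by rewrite inner_conj innerNl conjcN -inner_conj. Qed.
Lemma innerBl f g h : inner (f - g) h = inner f h - inner g h.
Proof. by rewrite innerDl innerNl. Qed.
Lemma innerBr f g h : inner f (g - h) = inner f g - inner f h.
Proof. by rewrite innerDr innerNr. Qed.
Lemma inner0l f : inner 0 f = 0.
Proof. by rewrite -(scale0r 0) innerZl mul0r. Qed.
Lemma inner0r f : inner f 0 = 0.
Proof. by rewrite inner_conj inner0l conjc0. Qed.
Lemma inner_suml (I : Type) (r : seq I) (P : pred I) (F : I -> L2) g :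
  inner (\sum_(i <- r | P i) F i) g = \sum_(i <- r | P i) inner (F i) g.
Proof.
apply: (big_morph (fun f => inner f g) (id1 := 0) (op1 := +%R)).
- by move=> x y; rewrite innerDl.
- exact: inner0l.
Qed.
Lemma inner_sumr (I : Type) (r : seq I) (P : pred I) (F : I -> L2) g :
  inner g (\sum_(i <- r | P i) F i) = \sum_(i <- r | P i) inner g (F i).
Proof.
apply: (big_morph (fun f => inner g f) (id1 := 0) (op1 := +%R)).
- by move=> x y; rewrite innerDr.
- exact: inner0r.
Qed.

Lemma inner_fun_self (u : R -> C) r :
  inner_fun u u r = (normc (u r) ^+ 2 / r)%:C.
Proof. by rewrite /inner_fun mul_conjc invr_real -rmorphM. Qed.

Lemma inner_self f :
  inner f f = (\int[mu]_(r in Rplus) (normc (L2fn f r) ^+ 2 / r))%:C.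
Proof.
have -> : inner f f = cintegral mu Rplus
    (fun r => (normc (L2fn f r) ^+ 2 / r)%:C : C).
  by apply: eq_cintegral => r _; rewrite -inner_fun_self.
apply: complex_eqP; rewrite !reimE//=.
by rewrite /Rintegral integral0.
Qed.

Lemma sqr_L2norm f : L2norm f ^+ 2 = complex.Re (inner f f).
Proof.
rewrite /L2norm sqr_sqrtr// inner_self; apply: Rintegral_ge0 => r; rewrite RplusE => r0.
by rewrite divr_ge0 ?sqr_ge0// ltW.
Qed.

Lemma inner_selfE f : inner f f = (L2norm f ^+ 2)%:C.
Proof. by rewrite sqr_L2norm inner_self. Qed.

Lemma sqr_L2norm_int f :
  (L2norm f ^+ 2)%:E = (\int[mu]_(r in Rplus) (normc (L2fn f r) ^+ 2 / r)%:E)%E.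
Proof.
rewrite sqr_L2norm inner_self /= /Rintegral fineK//.
by apply: integrable_fin_num => //; exact: sqint_integrable (L2fn_sqint f).
Qed.

Lemma L2norm_ge0 f : 0 <= L2norm f. Proof. exact: sqrtr_ge0. Qed.

Lemma L2norm_eq0 f : L2norm f = 0 -> f = 0.
Proof.
move=> f0; have := sqr_L2norm_int f; rewrite f0 expr0n /= => /esym.
have mf : measurable_fun (Rplus : set (measurableTypeR R))
    (fun r => (normc (L2fn f r) ^+ 2 / r)%:E).
  exact: measurable_int (sqint_integrable (L2fn_sqint f)).
move=> I0; apply: L2_ext.
have := (ae_eq_integral_abs mu measurable_Rplus mf).1.
rewrite (_ : (\int[_]_(_ in _) _)%E = 0%E); last first.
  rewrite -[RHS]I0; apply: eq_integral => r /set_mem; rewrite RplusE => r0.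
  by rewrite gee0_abs// lee_fin divr_ge0 ?sqr_ge0// ltW.
move=> /(_ erefl); apply: ae_mp2 L2fn0 => r fr0 h r0.
rewrite fr0//; move: h; rewrite RplusE => /(_ r0) /= [] /eqP.
rewrite mulf_eq0 invr_eq0 (gt_eqF r0) orbF sqrf_eq0 => /eqP.
exact: ComplexField.Normc.eq0_normc.
Qed.

Section CauchySchwarz.
Variable B : L2 -> L2 -> C.
Hypothesis BD : forall f g h, B (f + g) h = B f h + B g h.
Hypothesis BZ : forall c f h, B (c *: f) h = c * B f h.
Hypothesis BJ : forall f g, B f g = conjc (B g f).
Hypothesis B0 : forall f, 0 <= complex.Re (B f f).

(** Cauchy-Schwarz for a degenerate form: choosing the multiple of g by
    t <f,g> with t real makes the quadratic polynomial in t real, and its sign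
    for all t is the inequality. *)
Lemma form_CS f g :
  normc (B f g) ^+ 2 <= complex.Re (B f f) * complex.Re (B g g).
Proof.
set c := normc (B f g) ^+ 2; set a := complex.Re (B f f).
set b := complex.Re (B g g).
have h t : 0 <= a - 2 * t * c + t ^+ 2 * c * b.
  have := B0 (f + (- (t%:C * B f g)) *: g).
  rewrite !BD !BZ (BJ f) (BJ g (f + _)) !BD !BZ (BJ g f) !conjcD !conjcM !conjcK.
  rewrite !reimE -/a -/b /c sqr_normcE.
  have -> : complex.Im (B g g) = 0.
    by have := congr1 (@complex.Im R) (BJ g g); rewrite ImJ; lra.
  by congr (0 <= _); ring.
have c0 : 0 <= c by exact: sqr_ge0.
have b0 : 0 <= b by exact: B0.
have [bz|bn] := eqVneq b 0.
  rewrite bz mulr0.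
  have [->//|cn] := eqVneq c 0.
  have cp : 0 < c by rewrite lt_neqAle eq_sym cn.
  have := h ((a + 1) / (2 * c)); rewrite bz mulr0 addr0.
  rewrite (_ : a - _ = -1) ?oppr_ge0 ?ler10//.
  by field.
have bp : 0 < b by rewrite lt_neqAle eq_sym bn.
have := h b^-1; rewrite (_ : a - _ + _ = a - c / b); last by field.
by rewrite subr_ge0 ler_pdivrMr.
Qed.

End CauchySchwarz.

Lemma inner_CS f g : normc (inner f g) <= L2norm f * L2norm g.
Proof.
rewrite ler_sqr_normc ?mulr_ge0 ?L2norm_ge0// exprMn !sqr_L2norm.
apply: form_CS; [exact: innerDl|exact: innerZl|exact: inner_conj|].
by move=> h; rewrite -sqr_L2norm sqr_ge0.
Qed.

Lemma sqr_L2normD f g :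
  L2norm (f + g) ^+ 2 = L2norm f ^+ 2 + 2 * complex.Re (inner f g) + L2norm g ^+ 2.
Proof.
rewrite !sqr_L2norm innerDl !innerDr (inner_conj g f) !reimE; ring.
Qed.

Lemma L2normZ c f : L2norm (c *: f) = normc c * L2norm f.
Proof.
apply/eqP; rewrite -(eqrXn2 (n := 2)) ?mulr_ge0 ?L2norm_ge0 ?normc_ge0//.
by rewrite exprMn !sqr_L2norm innerZl innerZr mulrA mul_conjc !reimE mul0r subr0.
Qed.

Lemma L2normN f : L2norm (- f) = L2norm f.
Proof. by rewrite -scaleN1r L2normZ normcN ComplexField.Normc.normc1 mul1r. Qed.

Lemma L2normB f g : L2norm (f - g) = L2norm (g - f).
Proof. by rewrite -L2normN opprB. Qed.

Lemma L2normD f g : L2norm (f + g) <= L2norm f + L2norm g.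
Proof.
rewrite -ler_sqr ?nnegrE ?addr_ge0 ?L2norm_ge0// sqr_L2normD.
have := le_trans (ler_norm _) (le_trans (Re_le_normc _) (inner_CS f g)).
by move=> h; rewrite sqrrD lerD2r lerD2l -[leRHS]mulr_natl ler_pM2l.
Qed.

Lemma ler_dist_L2norm f g : `|L2norm f - L2norm g| <= L2norm (f - g).
Proof.
rewrite ler_norml; apply/andP; split.
  rewrite lerNl opprB lerBlDr L2normB.
  by apply: le_trans (L2normD _ _); rewrite subrK.
by rewrite lerBlDr; apply: le_trans (L2normD _ _); rewrite subrK.
Qed.

Lemma inner_inj f g : (forall h, inner f h = inner g h) -> f = g.
Proof.
move=> fg; apply/eqP; rewrite -subr_eq0; apply/eqP/L2norm_eq0/eqP.
by rewrite -sqrf_eq0 sqr_L2norm innerBl fg subrr.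
Qed.

End L2Structure.
#[global] Hint Resolve measurable_Rplus : core.
Arguments inner : simpl never.
Arguments L2norm : simpl never.
Arguments ComplexField.Normc.normc : simpl never.

(** * Rank one expansions of trace-class operators *)

Section ComplexSeries.
Variable R : realType.
Local Notation C := R[i].

Lemma normc_cvg_unique (z : nat -> C) (s t : C) :
  normc (z n - s) @[n --> \oo] --> (0 : R) ->
  normc (z n - t) @[n --> \oo] --> (0 : R) -> s = t.
Proof.
move=> zs zt; apply: complex_eqP.
  by apply: cvg_unique (normc_cvg_Re zs) (normc_cvg_Re zt); exact: Rhausdorff.
by apply: cvg_unique (normc_cvg_Im zs) (normc_cvg_Im zt); exact: Rhausdorff.
Qed.

Lemma normc_cvgP (z : nat -> C) (t : C) :
  normc (z n - t) @[n --> \oo] --> (0 : R) ->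
  (z n : C^o) @[n --> \oo] --> (t : C^o).
Proof.
move=> h; apply/cvgrPdist_lt => e e0.
have [er ei] : 0 < complex.Re e /\ complex.Im e = 0.
  by move: e0; rewrite ltcE => /andP[/eqP ? ?].
move/cvgrPdist_lt/(_ _ er) : h; apply: filterS => n.
rewrite sub0r normrN ger0_norm ?normc_ge0// => lt.
rewrite (_ : e = (complex.Re e)%:C); last by apply: complex_eqP; rewrite ?ei.
by rewrite -[`|_|]/((normc (t - z n))%:C) ltcR distcC.
Qed.

(** A sequence dominated by the increments of a convergent real sequence
    converges: adding that sequence makes real and imaginary parts monotone. *)
Lemma normc_cvg_dominated (z : nat -> C) (s : nat -> R) (sigma : R) :
  s @ \oo --> sigma ->
  (forall n m, (n <= m)%N -> normc (z m - z n) <= s m - s n) ->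
  exists2 t, normc (z n - t) @[n --> \oo] --> (0 : R) &
    forall n, normc (t - z n) <= sigma - s n.
Proof.
move=> ss h.
have s_nd : nondecreasing_seq s.
  by move=> n m nm; rewrite -subr_ge0; apply: le_trans (h _ _ nm); exact: normc_ge0.
have s_le n : s n <= sigma.
  have <- : limn s = sigma by apply/cvg_lim => //; exact: Rhausdorff.
  by apply: nondecreasing_cvgn_le => //; apply/cvg_ex; exists sigma.
have real (x : nat -> R) : (forall n m, (n <= m)%N -> `|x m - x n| <= s m - s n) ->
    exists a : R, x n @[n --> \oo] --> a.
  move=> hx; pose y n := x n + s n.
  have : cvgn y.
    apply: nondecreasing_is_cvgn.
      move=> n m nm; rewrite /y -subr_ge0.
      have := hx _ _ nm; rewrite ler_norml => /andP[+ _]; lra.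
    exists (`|x 0%N| + (sigma - s 0%N) + sigma) => _ [n _ <-]; rewrite /y.
    have := hx _ _ (leq0n n); have := s_le n; have := ler_norm (x 0%N).
    rewrite ler_norml => ? ? /andP[_ ?]; lra.
  move=> /cvg_ex[l yl]; exists (l - sigma).
  rewrite (_ : x = (fun n => y n - s n)); last by apply/funext => n; rewrite /y addrK.
  exact: cvgB.
have [|a ha] := real (fun n => complex.Re (z n)).
  move=> n m nm; apply: le_trans (h _ _ nm).
  by have := Re_le_normc (z m - z n); rewrite !reimE.
have [|b hb] := real (fun n => complex.Im (z n)).
  move=> n m nm; apply: le_trans (h _ _ nm).
  by have := Im_le_normc (z m - z n); rewrite !reimE.
have zt := @cvg_real_normc R z (a +i* b) ha hb.
exists (a +i* b) => // n; rewrite -subr_ge0.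
have hl : (s m - s n + normc (z m - (a +i* b)) - normc (a +i* b - z n))
    @[m --> \oo] --> sigma - s n + 0 - normc (a +i* b - z n).
  by apply: cvgB; [apply: cvgD => //; apply: cvgB => //|]; exact: cvg_cst.
rewrite addr0 in hl; apply: (cvgr_to_ge hl); exists n => // m /= nm.
have := h _ _ nm; have := le_normcD (a +i* b - z m) (z m - z n).
rewrite addrA subrK (distcC (a +i* b) (z m)) => ? ?; lra.
Qed.

Lemma cvg_sum_ord n (F : nat -> nat -> R) (a : nat -> R) :
  (forall k, F k N @[N --> \oo] --> a k) ->
  \sum_(k < n) F k N @[N --> \oo] --> \sum_(k < n) a k.
Proof.
move=> Fa; elim: n => [|n IH].
  rewrite big_ord0 (_ : (fun _ => _) = cst 0); first exact: cvg_cst.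
  by apply/funext => N; rewrite big_ord0.
rewrite big_ord_recr /= (_ : (fun _ => _) =
  (fun N => \sum_(k < n) F k N + F n N)); first exact: cvgD.
by apply/funext => N; rewrite big_ord_recr.
Qed.

End ComplexSeries.

Section Hilbert.
Variable R : realType.
Local Notation C := R[i].
Local Notation L2 := (L2 R).
Implicit Types (f g h : L2) (A B P Q T : L2 -> L2) (e : nat -> L2).

Lemma linear_opD A f g : linear A -> A (f + g) = A f + A g.
Proof. by move=> lA; have := lA 1 f g; rewrite !scale1r. Qed.
Lemma linear_op0 A : linear A -> A 0 = 0.
Proof.
move=> lA; have := linear_opD 0 0 lA; rewrite addr0 => /(congr1 (fun x => x - A 0)).
by rewrite subrr addrK.
Qed.
Lemma linear_opZ A c f : linear A -> A (c *: f) = c *: A f.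
Proof. by move=> lA; have := lA c f 0; rewrite (linear_op0 lA) !addr0. Qed.
Lemma linear_opB A f g : linear A -> A (f - g) = A f - A g.
Proof. by move=> lA; rewrite linear_opD// -scaleN1r linear_opZ// scaleN1r. Qed.
Lemma linear_op_sum A I (r : seq I) (F : I -> L2) : linear A ->
  A (\sum_(i <- r) F i) = \sum_(i <- r) A (F i).
Proof.
move=> lA; apply: (big_morph A); last exact: linear_op0.
by move=> x y; exact: linear_opD.
Qed.

Lemma bounded_op_ge0 A : bounded_op A ->
  exists2 M, 0 <= M & forall f, L2norm (A f) <= M * L2norm f.
Proof.
move=> [_ [M hM]]; exists (Num.max M 0); first by rewrite le_max lexx orbT.
move=> f; apply: (le_trans (hM f)).
by rewrite ler_wpM2r ?L2norm_ge0// le_max lexx.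
Qed.

Section OrthonormalBasis.
Variable e : nat -> L2.
Hypothesis onb : is_onb e.

Definition onb_proj n f := \sum_(k < n) inner f (e k) *: e k.

Lemma onb_proj_cvg f : L2norm (f - onb_proj n f) @[n --> \oo] --> (0 : R).
Proof. by case: onb. Qed.

Lemma inner_onb_proj n f (k : 'I_n) : inner (onb_proj n f) (e k) = inner f (e k).
Proof.
rewrite inner_suml (bigD1 k)//= innerZl onb.1 eqxx mulr1 big1 ?addr0// => i ik.
by rewrite innerZl onb.1 (_ : (_ == _ :> nat) = false) ?mulr0//; exact/negbTE.
Qed.

Lemma sqr_L2norm_onb_proj n f :
  L2norm (onb_proj n f) ^+ 2 = \sum_(k < n) normc (inner f (e k)) ^+ 2.
Proof.
rewrite sqr_L2norm {2}/onb_proj inner_sumr Re_sum; apply: eq_bigr => k _.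
by rewrite innerZr inner_onb_proj mulrC mul_conjc.
Qed.

Lemma inner_onb_proj_self n f :
  inner f (onb_proj n f) = inner (onb_proj n f) (onb_proj n f).
Proof.
rewrite {1 3}/onb_proj !inner_sumr; apply: eq_bigr => k _.
by rewrite !innerZr inner_onb_proj.
Qed.

Lemma L2norm_onb_proj_le n f : L2norm (onb_proj n f) <= L2norm f.
Proof.
rewrite -ler_sqr ?nnegrE ?L2norm_ge0//.
have := sqr_ge0 (L2norm (f - onb_proj n f)).
rewrite sqr_L2normD L2normN innerNr inner_onb_proj_self ReN -sqr_L2norm.
lra.
Qed.

Lemma parseval f :
  (\sum_(k < n) normc (inner f (e k)) ^+ 2) @[n --> \oo] --> L2norm f ^+ 2.
Proof.
have : L2norm (onb_proj n f) @[n --> \oo] --> L2norm f.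
  apply/subr_cvg0/norm_cvg0P.
  apply: (@squeeze_cvgr _ _ _ _ (cst 0) (fun n => L2norm (f - onb_proj n f))).
  - by near=> n; rewrite normr_ge0 andTb L2normB; exact: ler_dist_L2norm.
  - exact: cvg_cst.
  - exact: onb_proj_cvg.
move=> h; rewrite expr2 (_ : (fun n => _) =
    (fun n => L2norm (onb_proj n f) * L2norm (onb_proj n f))).
  exact: cvgM.
by apply/funext => n; rewrite -sqr_L2norm_onb_proj expr2.
Unshelve. all: by end_near. Qed.

End OrthonormalBasis.

(** Over the complex numbers a positive operator is automatically symmetric, by
    polarization. *)
Lemma positive_symmetric P f g : linear P -> (forall f, 0 <= inner (P f) f) ->
  inner (P f) g = conjc (inner (P g) f).
Proof.
move=> lP P0.
have im0 h : complex.Im (inner (P h) h) = 0 by apply: ger0_Im; exact: P0.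
have h1 := im0 (f + g); have h2 := im0 (f + 'i%C *: g).
move: h1 h2; rewrite !linear_opD// linear_opZ// !(innerDl, innerDr, innerZl, innerZr).
rewrite !(ImD, ImM, ReD, ReM) !im0; have := im0 g.
move: (inner (P f) g) (inner (P g) f) (inner (P f) f) (inner (P g) g).
move=> [a b] [c d] [x y] [z t] /= h0 h1 h2; congr (_ +i* _); lra.
Qed.

Lemma positive_CS P f g : linear P -> (forall f, 0 <= inner (P f) f) ->
  normc (inner (P f) g) ^+ 2 <=
  complex.Re (inner (P f) f) * complex.Re (inner (P g) g).
Proof.
move=> lP P0; apply: (form_CS (B := fun f g => inner (P f) g)).
- by move=> ? ? ?; rewrite linear_opD// innerDl.
- by move=> ? ? ?; rewrite linear_opZ// innerZl.
- by move=> ? ?; exact: positive_symmetric.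
- by move=> h; have := P0 h; rewrite lecE => /andP[].
Qed.

Section Cholesky.
Variable P : L2 -> L2.
Hypothesis lP : linear P.
Hypothesis P0 : forall f, 0 <= inner (P f) f.

(** One step of Cholesky elimination: subtracting the rank one operator built
    on P u annihilates u and keeps P positive; this is exactly Cauchy-Schwarz
    for the form of P. *)
Definition pivot u : L2 :=
  ((Num.sqrt (complex.Re (inner (P u) u)))^-1)%:C *: P u.

Definition deflate u f := P f - inner f (pivot u) *: pivot u.

Lemma deflate_linear u : linear (deflate u).
Proof.
move=> c f g; rewrite /deflate (linear_opD _ _ lP) (linear_opZ _ _ lP) innerDl innerZl.
by rewrite scalerDl -scalerA scalerBr opprD addrACA.
Qed.

Let P0' f : 0 <= complex.Re (inner (P f) f).
Proof. by have := P0 f; rewrite lecE => /andP[]. Qed.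

Lemma inner_deflate u f :
  inner (deflate u f) f = inner (P f) f - (normc (inner f (pivot u)) ^+ 2)%:C.
Proof. by rewrite innerBl innerZl (inner_conj (pivot u)) mul_conjc. Qed.

Let sqr_pivot u f : normc (inner f (pivot u)) ^+ 2 =
  (complex.Re (inner (P u) u))^-1 * normc (inner (P u) f) ^+ 2.
Proof.
rewrite innerZr conjc_real normcM normc_real exprMn.
by rewrite real_normK ?num_real// exprVn sqr_sqrtr// (inner_conj f (P u)) normc_conj.
Qed.

Lemma deflate_ge0 u f : 0 <= inner (deflate u f) f.
Proof.
rewrite inner_deflate lecE ImD ImN ReD ReN (ger0_Im (P0 f)).
rewrite (Im_real (normc _ ^+ 2)) (Re_real (normc _ ^+ 2)) oppr0 addr0 eqxx andTb.
rewrite subr_ge0 sqr_pivot.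
have [->|n0] := eqVneq (complex.Re (inner (P u) u)) 0.
  by rewrite invr0 mul0r.
rewrite mulrC ler_pdivrMr; last by rewrite lt_neqAle eq_sym n0 P0'.
by rewrite mulrC; exact: positive_CS.
Qed.

Lemma deflate_self u : deflate u u = 0.
Proof.
have [z|n0] := eqVneq (complex.Re (inner (P u) u)) 0.
  (* Here the normalizing factor of the pivot is 0^-1 = 0, and P u = 0 by
     Cauchy-Schwarz. *)
  have -> : P u = 0 -> deflate u u = 0.
    by rewrite /deflate /pivot => ->; rewrite scaler0 inner0r scale0r subr0.
  by [].
  apply: inner_inj => g; rewrite inner0l.
  have := positive_CS u g lP P0; rewrite z mul0r => h.
  apply: ComplexField.Normc.eq0_normc; apply/eqP; rewrite -sqrf_eq0.
  by rewrite eq_le h sqr_ge0.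
rewrite /deflate /pivot innerZr conjc_real scalerA -{1}[P u]scale1r -scalerBl.
rewrite (_ : 1 - _ = 0) ?scale0r//.
have -> : inner u (P u) = (complex.Re (inner (P u) u))%:C.
  rewrite inner_conj; apply: complex_eqP; rewrite ?ReJ ?ImJ//.
  by rewrite (ger0_Im (P0 u)) oppr0.
set x := complex.Re _.
rewrite mulrAC -!rmorphM /= -expr2 exprVn sqr_sqrtr ?P0'// mulVf// subrr.
by [].
Qed.

Lemma deflate_eq0 u f : P f = 0 -> deflate u f = 0.
Proof.
move=> Pf; rewrite /deflate Pf sub0r innerZr.
rewrite (_ : inner f (P u) = 0) ?mulr0 ?scale0r ?oppr0//.
by rewrite inner_conj (positive_symmetric _ _ lP P0) Pf inner0l !conjc0.
Qed.

End Cholesky.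

Section CholeskyExpansion.
Variables (P : L2 -> L2) (e : nat -> L2).
Hypothesis bP : bounded_op P.
Hypothesis P0 : forall f, 0 <= inner (P f) f.
Hypothesis onb : is_onb e.

Fixpoint residual n : L2 -> L2 :=
  if n is m.+1 then deflate (residual m) (e m) else P.

Definition column n : L2 := pivot (residual n) (e n).

Lemma residual_positive n :
  linear (residual n) /\ forall f, 0 <= inner (residual n f) f.
Proof.
elim: n => [|n [lr r0]]; first by split => //; case: bP.
by split=> [|f]; [exact: deflate_linear|exact: deflate_ge0].
Qed.

Lemma residual_basis n k : (k < n)%N -> residual n (e k) = 0.
Proof.
elim: n => // n IH; rewrite ltnS leq_eqVlt => /orP[/eqP ->|kn] /=.
  by apply: deflate_self; case: (residual_positive n).
by apply: deflate_eq0; [case: (residual_positive n)..|exact: IH].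
Qed.

Lemma residualE n f :
  residual n f = P f - \sum_(k < n) inner f (column k) *: column k.
Proof.
elim: n => [|n IH]; first by rewrite big_ord0 subr0.
by rewrite big_ord_recr /= opprD addrA -IH.
Qed.

(** Every column lies in the range of P; this is what transports the expansion
    of P = |T| to T. *)
Lemma column_range : exists w : nat -> L2, forall n, column n = P (w n).
Proof.
suff h n : exists w, column n = P w.
  by exists (fun n => xget 0 [set w | column n = P w]) => n;
    case: xgetP => [w _ //|hn]; case: (h n) => w hw; case: (hn w).
have [lP _] := bP.
suff : exists w, residual n (e n) = P w.
  by rewrite /column /pivot => -[w ->]; eexists; rewrite -(linear_opZ _ _ lP).
suff : forall f, exists w, residual n f = P w by exact.
elim: n => [|n IH] f; first by exists f.
rewrite /= /deflate; have [w ->] := IH f; rewrite /pivot.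
have [w' ->] := IH (e n).
by eexists; rewrite -!(linear_opZ _ _ lP) -(linear_opB _ _ lP).
Qed.

Lemma residual_form_le n f :
  complex.Re (inner (residual n f) f) <= complex.Re (inner (P f) f).
Proof.
elim: n => // n; apply: le_trans.
rewrite -[residual n.+1]/(deflate (residual n) (e n)) inner_deflate ReD ReN lerBlDr lerDl.
exact: (sqr_ge0 (normc _)).
Qed.

(** The residual kills the first n basis vectors, hence only sees the part of f
    orthogonal to them. *)
Lemma residual_cvg M : 0 <= M -> (forall f, L2norm (P f) <= M * L2norm f) ->
  forall n f, L2norm (residual n f) <= M * L2norm (f - onb_proj e n f).
Proof.
move=> M0 hM n f; have [lr r0] := residual_positive n.
set g := f - onb_proj e n f.
have qM h : complex.Re (inner (residual n h) h) <= M * L2norm h ^+ 2.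
  apply: (le_trans (residual_form_le n h)); apply: (le_trans (ler_norm _)).
  apply: (le_trans (Re_le_normc _)); apply: (le_trans (inner_CS _ _)).
  by rewrite expr2 mulrA ler_wpM2r ?L2norm_ge0.
have -> : residual n f = residual n g.
  rewrite (linear_opB _ _ lr) /onb_proj (linear_op_sum _ _ lr) big1 ?subr0// => k _.
  by rewrite (linear_opZ _ _ lr) residual_basis// scaler0.
have := positive_CS g (residual n g) lr r0; rewrite inner_selfE normc_real.
rewrite ger0_norm ?sqr_ge0//; set x := L2norm (residual n g) => h.
have x0 : 0 <= x by exact: L2norm_ge0.
have y0 := L2norm_ge0 g.
have {}h : x ^+ 2 ^+ 2 <= (M * L2norm g ^+ 2) * (M * x ^+ 2).
  apply: (le_trans h); apply: ler_pM; [|by have := r0 (residual n g);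
    rewrite lecE => /andP[]|exact: qM|exact: qM].
  by have := r0 g; rewrite lecE => /andP[].
have [->|xn] := eqVneq x 0; first by rewrite mulr_ge0.
have xp : 0 < x ^+ 2 by rewrite exprn_gt0// lt_neqAle eq_sym xn.
rewrite -ler_sqr ?nnegrE ?mulr_ge0// -(ler_pM2r xp).
by rewrite -expr2; apply: (le_trans h); rewrite le_eqVlt; apply/orP; left; apply/eqP; ring.
Qed.

(** Positivity of the residual bounds the diagonal of the sum of the rank one
    operators given by the columns by the diagonal of P; Parseval's identity for
    each column turns the trace of that sum into the sum of the squared norms. *)
Lemma sum_sqr_column_le tau :
  (forall n, \sum_(j < n) complex.Re (inner (P (e j)) (e j)) <= tau) ->
  forall n, \sum_(k < n) L2norm (column k) ^+ 2 <= tau.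
Proof.
move=> htau n.
have h : (\sum_(k < n) \sum_(j < N) normc (inner (column k) (e j)) ^+ 2)
    @[N --> \oo] --> \sum_(k < n) L2norm (column k) ^+ 2.
  apply: (@cvg_sum_ord R n (fun k N => \sum_(j < N) normc (inner (column k) (e j)) ^+ 2)
    (fun k => L2norm (column k) ^+ 2)) => k.
  exact: parseval.
apply: (cvgr_to_le h); near=> N.
rewrite exchange_big /=; apply: (le_trans _ (htau N)); apply: ler_sum => j _.
have [_ r0] := residual_positive n.
have := r0 (e j); rewrite lecE => /andP[_]; rewrite residualE innerBl ReD ReN.
rewrite inner_suml Re_sum subr_ge0; apply: le_trans.
rewrite le_eqVlt; apply/orP; left; apply/eqP; apply: eq_bigr => k _.
by rewrite (innerZl (inner _ _)) (inner_conj (column k)) mul_conjc normc_conj (Re_real (normc _ ^+ 2)).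
Unshelve. all: by end_near. Qed.

End CholeskyExpansion.

Lemma nneseries_bounded (x : nat -> R) : (forall n, 0 <= x n) ->
  (\sum_(0 <= k <oo) (x k)%:E < +oo)%E ->
  exists tau, forall n, \sum_(k < n) x k <= tau.
Proof.
move=> x0 hs; exists (fine (\sum_(0 <= k <oo) (x k)%:E)%E) => n.
rewrite -lee_fin fineK.
  rewrite -sumEFin; have := @nneseries_lim_ge R (fun k => (x k)%:E) xpredT 0 n.
  by rewrite big_mkord; apply => k _ _; rewrite lee_fin.
rewrite ge0_fin_numE//; apply: nneseries_ge0 => k _ _; by rewrite lee_fin.
Qed.

(** Since T f and P f have the same norm for P = |T|, what is proved for P carries
    over to T: the elimination writes P as the sum of the operators
    f |-> <f, u_k> u_k with u_k = P w_k, so that T is the sum of the operators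
    f |-> <f, u_k> T w_k, and T w_k has the norm of u_k. *)
Theorem trace_class_expansion T : trace_class T ->
  exists (e u v : nat -> L2) (M : R), [/\ is_onb e,
    forall n, \sum_(k < n) L2norm (u k) ^+ 2 <= M,
    forall k, L2norm (v k) = L2norm (u k) &
    forall f, L2norm (T f - \sum_(k < n) inner f (u k) *: v k)
      @[n --> \oo] --> (0 : R)].
Proof.
move=> [bT [P [e [[bP P0 [B TB PB]] onb htr]]]].
have [lP _] := bP; have [lT _] := bT.
have TP f : L2norm (T f) = L2norm (P f).
  rewrite /L2norm TB -PB inner_conj (positive_symmetric _ _ lP P0) conjcK.
  by rewrite inner_conj (positive_symmetric _ _ lP P0) conjcK.
have [w hw] := column_range e bP.
have [tau htau] : exists tau, forall n,
    \sum_(k < n) complex.Re (inner (P (e k)) (e k)) <= tau.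
  apply: (nneseries_bounded (x := fun k => complex.Re (inner (P (e k)) (e k)))) => // n.
  by have := P0 (e n); rewrite lecE => /andP[].
have [M M0 hM] := bounded_op_ge0 bP.
exists e, (column P e), (T \o w), tau; split => //.
- exact: sum_sqr_column_le.
- by move=> k /=; rewrite TP hw.
move=> f; apply: (@squeeze_cvgr _ _ _ _ (cst 0)
  (fun n => M * L2norm (f - onb_proj e n f))).
- near=> n; rewrite L2norm_ge0 andTb.
  rewrite [leLHS](_ : _ = L2norm (residual P e n f)); first exact: residual_cvg.
  rewrite residualE.
  under eq_bigr do rewrite -(linear_opZ _ _ lT).
  rewrite -(linear_op_sum _ _ lT) -(linear_opB _ _ lT) TP (linear_opB _ _ lP).
  rewrite (linear_op_sum _ _ lP); congr (L2norm (_ - _)); apply: eq_bigr => k _.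
  by rewrite (linear_opZ _ _ lP) -hw.
- exact: cvg_cst.
- by rewrite -(mulr0 M); apply: cvgM; [exact: cvg_cst|exact: onb_proj_cvg].
Unshelve. all: by end_near. Qed.

End Hilbert.

(** * The trace along a rank one expansion *)

Section Trace.
Variable R : realType.
Local Notation C := R[i].
Local Notation L2 := (L2 R).
Implicit Types (f g h : L2) (A B T : L2 -> L2) (e : nat -> L2).

Section Expansion.
Variables (T : L2 -> L2) (u v : nat -> L2) (M : R).
Hypothesis uM : forall n, \sum_(k < n) L2norm (u k) ^+ 2 <= M.
Hypothesis vu : forall k, L2norm (v k) = L2norm (u k).
Hypothesis Tuv : forall f,
  L2norm (T f - \sum_(k < n) inner f (u k) *: v k) @[n --> \oo] --> (0 : R).

Definition energy n := \sum_(k < n) L2norm (u k) ^+ 2.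

Lemma energy_cvg : exists sigma : R, energy n @[n --> \oo] --> sigma.
Proof.
suff : cvgn energy by move=> /cvg_ex.
apply: nondecreasing_is_cvgn; last by exists M => _ [n _ <-]; exact: uM.
apply/nondecreasing_seqP => n.
by rewrite /energy big_ord_recr /= lerDl sqr_ge0.
Qed.

(** This is the shape of estimate under which a complex series converges with a
    controlled tail, by comparison with the convergent sequence c * energy. *)
Lemma energyB n m (F : nat -> C) c : (n <= m)%N ->
  (forall k, normc (F k) <= c * (L2norm (v k) * L2norm (u k))) ->
  normc (\sum_(k < m) F k - \sum_(k < n) F k) <= c * energy m - c * energy n.
Proof.
move=> nm Fc; rewrite -(subnK nm) addnC.
elim: (m - n)%N => [|p IH].
  by rewrite addn0 !subrr normc0 lexx.
rewrite addnS /energy !big_ord_recr /= -/(energy _).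
have := le_normcD (\sum_(k < n + p) F k - \sum_(k < n) F k) (F (n + p)%N).
rewrite addrAC; have := Fc (n + p)%N; rewrite vu -expr2.
move: IH; rewrite /energy; lra.
Qed.

Lemma inner_expansion f g :
  normc (\sum_(k < n) inner f (u k) * inner (v k) g - inner (T f) g)
    @[n --> \oo] --> (0 : R).
Proof.
apply: (@squeeze_cvgr _ _ _ _ (cst 0)
  (fun n => L2norm (T f - \sum_(k < n) inner f (u k) *: v k) * L2norm g)).
- near=> n; rewrite normc_ge0 andTb distcC.
  apply: le_trans (inner_CS _ _); rewrite innerBl inner_suml.
  by under [X in _ <= normc (_ - X)]eq_bigr do rewrite innerZl.
- exact: cvg_cst.
- by rewrite -(mul0r (L2norm g)); apply: cvgM; [exact: Tuv|exact: cvg_cst].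
Unshelve. all: by end_near. Qed.

(** The diagonal sums of T o B truncated at N are the series of
    <B (pi_N v_k), u_k>, where pi_N is the projection onto the first N basis
    vectors. It is dominated uniformly in N and converges termwise. The limit
    does not depend on the basis, which identifies the trace. *)
Lemma trace_comp_expansion e B : is_onb e -> bounded_op B ->
  normc (\sum_(k < n) inner (B (v k)) (u k) - trace (T \o B))
    @[n --> \oo] --> (0 : R).
Proof.
move=> onb0 bB; have [lB _] := bB; have [c c0 hc] := bounded_op_ge0 bB.
have [sigma hs] := energy_cvg.
have hcs : (fun n => c * energy n) @ \oo --> c * sigma.
  by apply: cvgM => //; exact: cvg_cst.
have termle f k : L2norm f <= L2norm (v k) ->
    normc (inner (B f) (u k)) <= c * (L2norm (v k) * L2norm (u k)).
  move=> fv; apply: (le_trans (inner_CS _ _)); rewrite mulrA.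
  rewrite ler_wpM2r ?L2norm_ge0//; apply: (le_trans (hc f)).
  by rewrite ler_wpM2l.
have [t ht htail] := normc_cvg_dominated hcs
  (fun n m nm => energyB nm (fun k => termle (v k) k (lexx _))).
suff : trace (T \o B) = t by move=> ->.
have key e1 : is_onb e1 ->
    normc (\sum_(k < n) inner (T (B (e1 k))) (e1 k) - t) @[n --> \oo] --> (0 : R).
  move=> onb.
  (* N truncates in the basis, K in the expansion of T. *)
  pose D N K := \sum_(k < K) inner (B (onb_proj e1 N (v k))) (u k).
  have DE N K : D N K =
      \sum_(n < N) \sum_(k < K) inner (B (e1 n)) (u k) * inner (v k) (e1 n).
    rewrite exchange_big; apply: eq_bigr => k _.
    rewrite /onb_proj (linear_op_sum _ _ lB) inner_suml; apply: eq_bigr => n _.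
    by rewrite (linear_opZ _ _ lB) innerZl mulrC.
  pose DN N := \sum_(n < N) inner (T (B (e1 n))) (e1 n).
  have D_cvg N : normc (D N K - DN N) @[K --> \oo] --> (0 : R).
    apply: (@squeeze_cvgr _ _ _ _ (cst 0) (fun K => \sum_(n < N)
      normc (\sum_(k < K) inner (B (e1 n)) (u k) * inner (v k) (e1 n)
             - inner (T (B (e1 n))) (e1 n)))).
    - near=> K; rewrite normc_ge0 andTb DE /DN -sumrB; exact: ler_normc_sum.
    - exact: cvg_cst.
    - rewrite [X in _ --> X](_ : _ = \sum_(n < N) (0 : R)); last by rewrite big1.
      by apply: (@cvg_sum_ord R N (fun n K => normc (\sum_(k < K)
        inner (B (e1 n)) (u k) * inner (v k) (e1 n) - inner (T (B (e1 n))) (e1 n)))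
        (fun=> 0)) => n; exact: inner_expansion.
  have Dtail N K : normc (DN N - D N K) <= c * sigma - c * energy K.
    have h1 := @normc_cvg_dominated R (D N) _ _ hcs (fun n m nm => energyB nm
      (fun k => termle _ k (L2norm_onb_proj_le onb N (v k)))).
    have [s hs1 hs2] := h1.
    by have -> : DN N = s by exact: (normc_cvg_unique (D_cvg N) hs1).
  have DK K : normc (D N K - \sum_(k < K) inner (B (v k)) (u k))
      @[N --> \oo] --> (0 : R).
    apply: (@squeeze_cvgr _ _ _ _ (cst 0) (fun N => \sum_(k < K)
      c * L2norm (v k - onb_proj e1 N (v k)) * L2norm (u k))).
    - near=> N; rewrite normc_ge0 andTb /D -sumrB.
      apply: (le_trans (ler_normc_sum _ _ _)); apply: ler_sum => k _.
      rewrite -innerBl -(linear_opB _ _ lB); apply: (le_trans (inner_CS _ _)).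
      by rewrite ler_wpM2r ?L2norm_ge0// (L2normB (v k)) hc.
    - exact: cvg_cst.
    - rewrite [X in _ --> X](_ : _ = \sum_(k < K) (c * 0 * L2norm (u k))); last first.
        by rewrite big1// => k _; rewrite mulr0 mul0r.
      apply: (@cvg_sum_ord R K (fun k N => c * L2norm (v k - onb_proj e1 N (v k))
        * L2norm (u k)) (fun k => c * 0 * L2norm (u k))) => k.
      apply: cvgM; last exact: cvg_cst.
      by apply: cvgM; [exact: cvg_cst|exact: onb_proj_cvg].
  apply/cvgrPdist_lt => eps eps0.
  have eps3 : 0 < eps / 3 by rewrite divr_gt0.
  move/cvgrPdist_lt/(_ _ eps3) : hcs => -[K _ hK].
  have {hK} := hK K (leqnn K) => /= hK.
  move/cvgrPdist_lt/(_ _ eps3) : (DK K); apply: filterS => N.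
  rewrite !sub0r !normrN !ger0_norm ?normc_ge0// => h1.
  have h2 := Dtail N K; have h3 := htail K.
  have h4 : c * sigma - c * energy K < eps / 3 by apply: le_lt_trans hK; exact: ler_norm.
  set L := \sum_(k < K) _ in h1 h3; rewrite -/(DN N).
  have := le_normcD (DN N - D N K) (D N K - L).
  rewrite addrA subrK; have := le_normcD (DN N - L) (L - t).
  rewrite addrA subrK (distcC L t) => ? ?; lra.
rewrite /trace; apply: xget_unique => [e1 onb|t' ht'].
  by apply: normc_cvgP; exact: key.
have hC : hausdorff_space C^o by exact: norm_hausdorff.
apply: (cvg_unique hC (ht' e onb0)).
by apply: normc_cvgP; exact: key.
Unshelve. all: by end_near. Qed.

End Expansion.

End Trace.

(** * Affine changes of variables and the Poisson kernel *)

Section Lebesgue.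
Variable R : realType.
Local Notation mu := (@lebesgue_measure R).
Local Open Scope ereal_scope.

Lemma measurable_affine (a b : R) : measurable_fun setT (fun r : R => a * r + b)%R.
Proof. by apply: measurable_funD => //; apply: measurable_funM. Qed.

Lemma preimage_affine_itv (a b x y : R) : a != 0%R ->
  mu ((fun r => a * r + b)%R @^-1` `]x, y]) = (`|a|^-1)%:E * mu `]x, y].
Proof.
move=> a0; rewrite [in RHS]lebesgue_measure_itv /= lte_fin.
have ap : (0 < `|a|)%R by rewrite normr_gt0.
have sub (u v : R) : u%:E - v%:E = (u - v)%:E by [].
have [alt|agt|a0'] := ltgtP a 0%R; last by rewrite a0' eqxx in a0.
  rewrite (_ : _ @^-1` _ = `[(y - b) / a, (x - b) / a[%classic)%R; last first.
    apply/seteqP; split => r; rewrite /= !in_itv/= ler_ndivrMr// ltr_ndivlMr//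
      => /andP[h1 h2]; apply/andP; split; lra.
  rewrite lebesgue_measure_itv /= lte_fin ltr_nM2r ?invr_lt0// ltrD2r.
  case: ifPn => _; last by rewrite mule0.
  rewrite !sub -EFinM; congr (_%:E); rewrite ltr0_norm// invrN; field.
  by rewrite lt_eqF.
rewrite (_ : _ @^-1` _ = `](x - b) / a, (y - b) / a]%classic)%R; last first.
  apply/seteqP; split => r; rewrite /= !in_itv/= ltr_pdivrMr// ler_pdivlMr//
    => /andP[h1 h2]; apply/andP; split; lra.
rewrite lebesgue_measure_itv /= lte_fin ltr_pM2r ?invr_gt0// ltrD2r.
case: ifPn => _; last by rewrite mule0.
rewrite !sub -EFinM; congr (_%:E); rewrite gtr0_norm//; field.
by rewrite gt_eqF.
Qed.

(** By uniqueness of Lebesgue measure: |a| times its push-forward under the affine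
    map has the right value on intervals. *)
Lemma lebesgue_measure_affine (a b : R) (A : set R) : a != 0%R -> measurable A ->
  mu ((fun r => a * r + b)%R @^-1` A) = (`|a|^-1)%:E * mu A.
Proof.
move=> a0 mA.
pose phi : measurableTypeR R -> measurableTypeR R := fun r => (a * r + b)%R.
have mphi : measurable_fun setT phi by exact: measurable_affine.
have an : (0 <= `|a|)%R by [].
pose nu := mscale (NngNum an) (pushforward mu phi).
have pos : (0 < `|a|)%R by rewrite normr_gt0.
have nuE (B : set R) : nu mphi B =
  `|a|%:E * mu ((fun r : R => a * r + b)%R @^-1` B) by [].
have -> : mu A = nu mphi A.
  apply: (lebesgue_measure_unique (mu := nu mphi)) => // _ [[x y] _ <-].
  rewrite -[RHS]/(`|a|%:E * mu ((fun r : R => a * r + b)%R @^-1` `]x, y])).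
  by rewrite preimage_affine_itv// muleA -EFinM divff ?mul1e ?gt_eqF.
by rewrite nuE muleA -EFinM mulVf ?mul1e// gt_eqF.
Qed.

Lemma ge0_integral_affine (a b : R) (f : R -> \bar R) : a != 0%R ->
  measurable_fun setT f -> (forall r, 0 <= f r) ->
  \int[mu]_r f r = `|a|%:E * \int[mu]_r f (a * r + b)%R.
Proof.
move=> a0 mf f0.
pose phi : measurableTypeR R -> measurableTypeR R := fun r => (a * r + b)%R.
have mphi : measurable_fun setT phi by exact: measurable_affine.
have an : (0 <= `|a|)%R by [].
have := @ge0_integral_pushforward _ _ _ _ R phi mphi mu setT f measurableT mf
  (fun x _ => f0 x).
rewrite preimage_setT => <-.
have := @ge0_integral_mscale _ _ R (pushforward mu phi) setT measurableT
  (NngNum an) f mf (fun x _ => f0 x).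
move=> /(_ mphi) <-; apply: eq_measure_integral => A mA _.
rewrite -[RHS]/(`|a|%:E * mu ((fun r : R => a * r + b)%R @^-1` A)).
by rewrite lebesgue_measure_affine// muleA -EFinM divff ?mul1e ?normr_eq0.
Qed.

End Lebesgue.

Section Poisson.
Variable R : realType.
Local Notation mu := (@lebesgue_measure R).

(** The Fourier transform of exp(-eps |x|), for the kernel exp(2 pi i x z). *)
Definition poisson (eps z : R) : R := 2 * eps / (eps ^+ 2 + (2 * pi * z) ^+ 2).

Lemma poisson_ge0 eps z : 0 <= eps -> 0 <= poisson eps z.
Proof. by move=> e0; rewrite divr_ge0 ?mulr_ge0// addr_ge0 ?sqr_ge0. Qed.

Lemma poisson_scale eps z : 0 < eps -> eps * poisson eps (eps * z) = poisson 1 z.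
Proof.
move=> e0; rewrite /poisson.
have h1 : 1 + (2 * pi * z) ^+ 2 != 0 by rewrite gt_eqF// ltr_pwDl// sqr_ge0.
have h2 : eps ^+ 2 + (2 * pi * (eps * z)) ^+ 2 != 0.
  by rewrite gt_eqF// ltr_pwDl ?sqr_ge0// exprn_gt0.
by rewrite expr1n; move: (@pi R) h1 h2 => p h1 h2; field; rewrite ?h1 ?h2 ?lt0r_neq0.
Qed.

Lemma continuous_poisson eps : 0 < eps -> continuous (poisson eps).
Proof.
move=> e0 z; apply: cvgM; first exact: cvg_cst.
apply: cvgV.
  by rewrite gt_eqF// ltr_pwDl ?sqr_ge0// exprn_gt0.
apply: cvgD; first exact: cvg_cst.
rewrite expr2; under eq_fun do rewrite expr2.
by apply: cvgM; (apply: cvgM; [exact: cvg_cst|exact: cvg_id]).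
Qed.

Lemma poissonN eps z : poisson eps (- z) = poisson eps z.
Proof. by rewrite /poisson mulrN sqrrN. Qed.

Lemma ge0_FTC_is_derive (f F : R -> R) (l : R) :
  (forall x, 0 <= f x) -> continuous f -> (forall x : R, is_derive x 1 F (f x)) ->
  F x @[x --> +oo] --> l ->
  (\int[mu]_(x in [set x | (0 <= x)%R]) (f x)%:E = (l - F 0)%:E)%E.
Proof.
move=> f0 cf dF Fl; rewrite -set_itvcy (@ge0_continuous_FTC2y _ _ F 0 l)//.
- exact: continuous_subspaceT.
- apply: cvg_at_right_filter; apply: differentiable_continuous.
  by apply/derivable1_diffP; case: (dF 0).
- by move=> x _; rewrite derive1E; apply: derive_val.
Qed.

Lemma is_derive_lin (c x : R) : is_derive x 1 (fun y : R => c * y) c.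
Proof.
have h := @is_deriveZ R R R id c x 1 1 (is_derive_id _ _).
apply: (is_derive_eq h); exact: mulr1.
Qed.

Lemma is_derive_comp_lin (g : R -> R) (c x dg : R) :
  is_derive (c * x) 1 g dg -> is_derive x 1 (fun y : R => g (c * y)) (c * dg).
Proof.
move=> dg'; have h := is_derive1_comp (g := fun y : R => c * y) dg' (is_derive_lin c x).
by apply: (is_derive_eq h); exact: mulrC.
Qed.

Lemma integral_poisson1 : (\int[mu]_z (poisson 1 z)%:E = 1)%E.
Proof.
have pi0 : (pi : R) != 0 by rewrite gt_eqF// pi_gt0.
rewrite ge0_symfun_integralT; last 3 first.
- by move=> z; exact: poisson_ge0.
- exact: continuous_poisson.
- by move=> z /=; rewrite poissonN.
rewrite [X in (_ * X)%E](_ : _ = (pi^-1 * (pi / 2) - pi^-1 * atan (2 * pi * 0))%:E).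
- rewrite mulr0 atan0 mulr0 subr0 -EFinM; congr (_%:E).
  by rewrite (mulrA pi^-1) mulVf// mul1r divff.
apply: (@ge0_FTC_is_derive _ (fun z => pi^-1 * atan (2 * pi * z))).
- by move=> z; exact: poisson_ge0.
- exact: continuous_poisson.
- move=> z.
  have h := @is_deriveZ R R R _ pi^-1 _ _ _
    (is_derive_comp_lin (is_derive1_atan (2 * pi * z))).
  apply: (is_derive_eq h); rewrite /GRing.scale /= /poisson expr1n; move: (@pi R) pi0 => p p0; field.
  by rewrite p0 gt_eqF// ltr_pwDl// sqr_ge0.
- apply: cvgM; first exact: cvg_cst.
  apply: (cvg_comp _ _ _ (@cvgy_atan R)).
  apply: gt0_cvgMry; last exact: cvg_id.
  by rewrite mulr_gt0// pi_gt0.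
Qed.

(** Adding 1 to the cosine makes the integrand nonnegative, so that the
    fundamental theorem of calculus on a half-line applies before integrability
    is known. *)
Lemma integral_expR_cos (eps c : R) : 0 < eps ->
  (\int[mu]_(x in [set x | (0 <= x)%R]) (expR (- eps * x) * (1 + cos (c * x)))%:E =
  (eps^-1 + eps / (eps ^+ 2 + c ^+ 2))%:E)%E.
Proof.
move=> e0; have e0' : eps != 0 by rewrite gt_eqF.
have d0 : eps ^+ 2 + c ^+ 2 != 0 by rewrite gt_eqF// ltr_pwDl ?sqr_ge0// exprn_gt0.
pose d := (eps ^+ 2 + c ^+ 2)^-1.
(* exp(-eps x) * G x is an antiderivative: two integrations by parts. *)
pose G (x : R) := c * d * sin (c * x) + (- (eps * d) * cos (c * x) + - eps^-1).
pose F (x : R) := expR (- eps * x) * G x.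
transitivity ((0 - F 0)%:E); last first.
  rewrite /F /G !mulr0 expR0 sin0 cos0 mulr0 mulr1 mul1r !add0r opprD !opprK.
  by rewrite addrC.
apply: ge0_FTC_is_derive.
- by move=> x; rewrite mulr_ge0 ?expR_ge0//; have := cos_geN1 (c * x); lra.
- move=> x; apply: cvgM.
    apply: continuous_comp; last exact: continuous_expR.
    by apply: cvgM; [exact: cvg_cst|exact: cvg_id].
  apply: cvgD; first exact: cvg_cst.
  apply: continuous_comp; last exact: continuous_cos.
  by apply: cvgM; [exact: cvg_cst|exact: cvg_id].
- move=> x.
  have d1 : is_derive x 1 (fun x : R => expR (- eps * x)) (- eps * expR (- eps * x)).
    exact: (is_derive_comp_lin (is_derive_expR _)).
  have d2 : is_derive x 1 G (c * d * (c * cos (c * x)) +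
      (- (eps * d) * (c * - sin (c * x)) + 0)).
    have h1 := @is_deriveZ R R R _ (c * d) _ _ _
      (is_derive_comp_lin (is_derive_sin (c * x))).
    have h2 := @is_deriveZ R R R _ (- (eps * d)) _ _ _
      (is_derive_comp_lin (is_derive_cos (c * x))).
    exact: (is_deriveD h1 (is_deriveD h2 (@is_derive_cst R R R (- eps^-1) x 1))).
  apply: (is_derive_eq (is_deriveM d1 d2)).
  rewrite /GRing.scale /= /G /d.
  move: (expR _) (cos _) (sin _) => E Cx Sx; field.
  by rewrite e0' d0.
- pose K := `|c * d| + (`|eps * d| + `|eps^-1|).
  have expR0' : expR (- eps * x) @[x --> +oo] --> 0.
    under eq_fun do rewrite mulNr.
    apply: (cvg_comp (fun x => eps * x) (fun y => expR (- y)) _ (@cvgr_expR R)).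
    by apply: gt0_cvgMry => //; exact: cvg_id.
  apply/norm_cvg0P.
  apply: (@squeeze_cvgr _ _ _ _ (cst 0) (fun x => expR (- eps * x) * K)).
  + near=> x; rewrite normr_ge0 andTb normrM ger0_norm ?expR_ge0//.
    rewrite ler_wpM2l ?expR_ge0// (le_trans (ler_normD _ _))//.
    apply: lerD.
      by rewrite normrM -[leRHS]mulr1 ler_wpM2l// ler_norml sin_geN1 sin_le1.
    rewrite (le_trans (ler_normD _ _))// normrN lerD2r normrM normrN.
    by rewrite -[leRHS]mulr1 ler_wpM2l// ler_norml cos_geN1 cos_le1.
  + exact: cvg_cst.
  + by rewrite -(mul0r K); apply: cvgM => //; exact: cvg_cst.
Unshelve. all: by end_near. Qed.

Lemma continuous_exp_abs (eps : R) : continuous (fun x : R => expR (- eps * `|x|)).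
Proof.
move=> x; apply: continuous_comp; last exact: continuous_expR.
by apply: cvgM; [exact: cvg_cst|exact: norm_continuous].
Qed.

Lemma ge0_integral_exp_abs_cos (eps c : R) : 0 < eps ->
  (\int[mu]_x (expR (- eps * `|x|) * (1 + cos (c * x)))%:E =
  (2 / eps + 2 * eps / (eps ^+ 2 + c ^+ 2))%:E)%E.
Proof.
move=> e0; rewrite ge0_symfun_integralT; last 3 first.
- move=> x; rewrite mulr_ge0 ?expR_ge0//; have := cos_geN1 (c * x); lra.
- move=> x; apply: cvgM; first exact: continuous_exp_abs.
  apply: cvgD; first exact: cvg_cst.
  apply: continuous_comp; last exact: continuous_cos.
  by apply: cvgM; [exact: cvg_cst|exact: cvg_id].
- by move=> x /=; rewrite normrN mulrN cosN.
rewrite -[in RHS]mulrA -mulrDr EFinM -integral_expR_cos//; congr (_ * _)%E.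
by apply: eq_integral => x; rewrite inE /= => x0; rewrite ger0_norm.
Qed.

Lemma integral_exp_abs (eps : R) : 0 < eps ->
  (\int[mu]_x (expR (- eps * `|x|))%:E = (2 / eps)%:E)%E.
Proof.
move=> e0; have e0' : eps != 0 by rewrite gt_eqF.
have := ge0_integral_exp_abs_cos 0 e0.
rewrite expr0n addr0; under eq_integral do rewrite mul0r cos0 mulrC EFinM.
rewrite ge0_integralZl_EFin//; last first.
  apply: measurableT_comp => //; apply: continuous_measurable_fun.
  exact: continuous_exp_abs.
move=> h; have -> : (\int[mu]_x (expR (- eps * `|x|))%:E =
    (2^-1)%:E * ((1 + 1)%:E * \int[mu]_x (expR (- eps * `|x|))%:E))%E.
  by rewrite muleA -EFinM (_ : _ * _ = 1) ?mul1e//; field.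
by rewrite h -EFinM; congr (_%:E); field.
Qed.

Lemma integrable_exp_abs (eps : R) : 0 < eps ->
  mu.-integrable setT (fun x => (expR (- eps * `|x|))%:E).
Proof.
move=> e0; apply/integrableP; split.
  apply: measurableT_comp => //; apply: continuous_measurable_fun.
  exact: continuous_exp_abs.
under eq_integral do rewrite gee0_abs ?lee_fin ?expR_ge0//.
by rewrite integral_exp_abs// ltry.
Qed.

Lemma integrable_exp_abs_bounded (eps : R) (g : R -> R) : 0 < eps ->
  measurable_fun setT g -> (forall x, `|g x| <= 1) ->
  mu.-integrable setT (fun x => (expR (- eps * `|x|) * g x)%:E).
Proof.
move=> e0 mg g1; apply: (le_integrable _ _ _ (integrable_exp_abs e0)) => //.
  apply: measurableT_comp => //; apply: measurable_funM => //.
  by apply: continuous_measurable_fun; exact: continuous_exp_abs.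
move=> x _; rewrite /= lee_fin normrM ger0_norm ?expR_ge0//.
by rewrite -[leRHS]mulr1 ler_wpM2l ?expR_ge0.
Qed.

Lemma measurable_comp_lin (g : R -> R) (c : R) : continuous g ->
  measurable_fun setT (fun x => g (c * x)).
Proof.
move=> cg; apply: continuous_measurable_fun => x.
by apply: continuous_comp; [apply: cvgM; [exact: cvg_cst|exact: cvg_id]|exact: cg].
Qed.

Lemma Rintegral_exp_abs_cos (eps z : R) : 0 < eps ->
  \int[mu]_x (expR (- eps * `|x|) * cos (2 * pi * z * x)) = poisson eps z.
Proof.
move=> e0; set c := 2 * pi * z.
have ic : mu.-integrable setT (fun x => (expR (- eps * `|x|) * cos (c * x))%:E).
  apply: integrable_exp_abs_bounded => //.
    by apply: measurable_comp_lin; exact: continuous_cos.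
  by move=> x; rewrite ler_norml cos_geN1 cos_le1.
have ie := integrable_exp_abs e0.
have /(congr1 fine) := ge0_integral_exp_abs_cos c e0.
rewrite -/(Rintegral mu setT (fun x => expR (- eps * `|x|) * (1 + cos (c * x)))) /=.
rewrite (_ : Rintegral _ _ _ = \int[mu]_x expR (- eps * `|x|) +
    \int[mu]_x (expR (- eps * `|x|) * cos (c * x))); last first.
  rewrite -RintegralD//; apply: eq_Rintegral => x _; by rewrite mulrDr mulr1.
by rewrite {1}/Rintegral integral_exp_abs//= => /addrI.
Qed.

Lemma Rintegral_odd (h : R -> R) : mu.-integrable setT (EFin \o h) ->
  (forall x, h (- x) = - h x) -> \int[mu]_x h x = 0.
Proof.
move=> ih oddh; have mh : measurable_fun setT (EFin \o h) by exact: measurable_int ih.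
have fpos : (\int[mu]_x (EFin \o h)^\+ x)%E \is a fin_num.
  by apply: integrable_fin_num => //; exact: integrable_funepos.
rewrite /Rintegral integralE.
rewrite (_ : (\int[mu]_x (EFin \o h)^\- x = \int[mu]_x (EFin \o h)^\+ x)%E).
  by rewrite subee.
have := @ge0_integral_affine R (-1) 0 (EFin \o h)^\+%E.
rewrite oppr_eq0 oner_eq0 => ->//; last first.
  exact: measurable_funepos.
rewrite normrN normr1 mul1e; apply: eq_integral => x _.
by rewrite funepos.unlock funeneg.unlock /= mulN1r addr0 oddh.
Qed.

Lemma Rintegral_exp_abs_sin (eps z : R) : 0 < eps ->
  \int[mu]_x (expR (- eps * `|x|) * sin (2 * pi * z * x)) = 0.
Proof.
move=> e0; apply: Rintegral_odd.
  apply: integrable_exp_abs_bounded => //.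
    by apply: measurable_comp_lin; exact: continuous_sin.
  by move=> x; rewrite ler_norml sin_geN1 sin_le1.
by move=> x; rewrite normrN !mulrN sinN mulrN.
Qed.

Lemma integral_poisson (eps : R) : 0 < eps -> (\int[mu]_z (poisson eps z)%:E = 1)%E.
Proof.
move=> e0; rewrite (@ge0_integral_affine R eps 0 (fun z => (poisson eps z)%:E)) ?gt_eqF//; last 2 first.
- apply: measurableT_comp => //; apply: continuous_measurable_fun.
  exact: continuous_poisson.
- by move=> r; rewrite lee_fin poisson_ge0// ltW.
rewrite -ge0_integralZl_EFin//; last 2 first.
- by move=> r _; rewrite lee_fin poisson_ge0// ltW.
- apply: measurableT_comp => //.
  apply: (measurableT_comp _ (measurable_affine eps 0)).
  by apply: continuous_measurable_fun; exact: continuous_poisson.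
rewrite -integral_poisson1; apply: eq_integral => z _.
by rewrite addr0 -EFinM gtr0_norm// poisson_scale.
Qed.

End Poisson.

(** * Continuity of translations in the mean square *)

Section Translation.
Variable R : realType.
Local Notation mu := (@lebesgue_measure R).

Lemma cvge0P (u : nat -> \bar R) : (forall n, 0 <= u n)%E ->
  (forall e : R, 0 < e -> \forall n \near \oo, (u n < e%:E)%E) ->
  u n @[n --> \oo] --> 0%E.
Proof.
move=> u0 ue; apply/fine_cvgP; split.
  apply: filterS (ue 1 ltr01) => n un; rewrite ge0_fin_numE//.
  by apply: lt_trans un _; rewrite ltry.
apply/cvgrPdist_lt => e e0; apply: filterS (ue e e0) => n un.
rewrite sub0r normrN /= ger0_norm ?fine_ge0//.
by rewrite -lte_fin fineK// ge0_fin_numE// (lt_trans un)// ltry.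
Qed.

Definition sqn (f : R -> R) : \bar R := (\int[mu]_t (f t ^+ 2)%:E)%E.

Lemma measurable_sqr_EFin (f : R -> R) : measurable_fun setT f ->
  measurable_fun setT (fun t : R => (f t ^+ 2)%:E).
Proof.
by move=> mf; apply: measurableT_comp => //; exact: measurable_funX.
Qed.

Lemma sqn_ge0 f : (0 <= sqn f)%E.
Proof. by apply: integral_ge0 => t _; rewrite lee_fin sqr_ge0. Qed.

Lemma sqnD (f g : R -> R) : measurable_fun setT f -> measurable_fun setT g ->
  (sqn (fun t : R => f t + g t)%R <= 2%:E * sqn f + 2%:E * sqn g)%E.
Proof.
move=> mf mg; rewrite /sqn -!ge0_integralZl_EFin//;
  do ?[by move=> t _; rewrite lee_fin sqr_ge0]; do ?[exact: measurable_sqr_EFin].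
rewrite -ge0_integralD//;
  do ?[by move=> t _; rewrite -EFinM lee_fin mulr_ge0 ?sqr_ge0];
  do ?[by apply: measurable_funeM; exact: measurable_sqr_EFin].
apply: ge0_le_integral => //.
- by move=> t _; rewrite lee_fin sqr_ge0.
- by apply: measurable_sqr_EFin; exact: measurable_funD.
- by apply: emeasurable_funD; apply: measurable_funeM; exact: measurable_sqr_EFin.
move=> t _; rewrite -!EFinM -EFinD lee_fin; have := sqr_ge0 (f t - g t); nra.
Qed.

Lemma sqn_shift (f : R -> R) (z : R) : measurable_fun setT f ->
  sqn (fun t : R => f (t + z)) = sqn f.
Proof.
move=> mf; rewrite [RHS](@ge0_integral_affine R 1 z) ?oner_eq0//; last 2 first.
- exact: measurable_sqr_EFin.
- by move=> t; rewrite lee_fin sqr_ge0.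
by rewrite normr1 mul1e; apply: eq_integral => t _; rewrite mul1r.
Qed.

Lemma measurable_shift (f : R -> R) (z : R) : measurable_fun setT f ->
  measurable_fun setT (fun t : R => f (t + z)).
Proof.
move=> mf; apply: (measurableT_comp mf).
by apply: measurable_funD => //; exact: measurable_cst.
Qed.

Lemma sqn_shiftB (f : R -> R) (z : R) : measurable_fun setT f ->
  (sqn (fun t : R => f (t + z) - f t)%R <= 4%:E * sqn f)%E.
Proof.
move=> mf; apply: le_trans (sqnD (measurable_shift z mf) (g := fun t : R => - f t) _) _.
  exact: measurableT_comp.
rewrite sqn_shift// (_ : sqn (fun t : R => - f t) = sqn f); last first.
  by apply: eq_integral => t _; rewrite sqrrN.
rewrite -ge0_muleDl ?lee_fin// -EFinD (_ : 2 + 2 = 4 :> R)//; ring.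
Qed.

Lemma measurable_preimage_itv (f : R -> R) (i : interval R) : measurable_fun setT f ->
  measurable [set s | f s \in i].
Proof.
by move=> mf; have := mf measurableT _ (measurable_itv i); rewrite setTI.
Qed.

(** Functions that are continuous up to two jumps and vanish outside a bounded
    interval: their translates converge pointwise away from the jumps, under a
    fixed integrable bound. *)
Definition truncated_continuous (M : R) (h : R -> R) :=
  [/\ measurable_fun setT h, forall t, `|h t| <= M,
      forall t, M <= `|t| -> h t = 0 &
      forall t, `|t| < M -> {for t, continuous h}].

Lemma truncated_continuous_shift M h (z : nat -> R) (c : R) :
  0 < M -> truncated_continuous M h -> z @ \oo --> 0 -> (forall n, `|z n| <= c) ->
  sqn (fun t : R => h (t + z n) - h t) @[n --> \oo] --> 0%E.
Proof.
move=> M0 [mh hM h0 hc] z0 zc; have c0 : 0 <= c by exact: le_trans (zc 0%N).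
pose g (t : R) := ((2 * M) ^+ 2 * \1_(`[- (M + c), M + c]%classic) t)%:E.
have -> : 0%E = (\int[mu]_(t in setT) cst 0%E t)%E by rewrite integral0.
have [|||||_ _ //] := @dominated_convergence _ _ _ mu setT measurableT
  (fun n t => ((h (t + z n) - h t) ^+ 2)%:E) (cst 0%E) g.
- move=> n; apply: measurable_sqr_EFin; apply: measurable_funB => //.
  exact: measurable_shift.
- exact: measurable_cst.
- exists [set M; - M]; split.
  + by apply: measurableU; exact: measurable_set1.
  + apply/eqP; rewrite -measure_le0.
    apply: (le_trans (measureU2 _ _ _)); [exact: measurable_set1..|].
    rewrite [X in (X + _)%E](_ : _ = 0%E); last exact: lebesgue_measure_set1.
    rewrite [X in (_ + X)%E](_ : _ = 0%E); last exact: lebesgue_measure_set1.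
    by rewrite adde0.
  + move=> t; apply: contra_notP => tM _.
    have tM' : `|t| != M.
      apply: contra_notN tM => /eqP; case: (ler0P t) => _ <-; [right|left] => //.
      by rewrite opprK.
    have tz : t + z n @[n --> \oo] --> t.
      by rewrite -[X in _ --> X]addr0; apply: cvgD => //; exact: cvg_cst.
    have ht : h (t + z n) @[n --> \oo] --> h t.
      have [tltM|tgtM] := ltP `|t| M.
        exact: (cvg_comp _ _ tz (hc t tltM)).
      have tgt : M < `|t| by rewrite lt_neqAle eq_sym tM'.
      rewrite (h0 t)//; apply: cvg_near_cst.
      have /cvgrPdist_lt hn : `|t + z n| @[n --> \oo] --> `|t| by exact: cvg_norm.
      have tM0 : 0 < `|t| - M by rewrite subr_gt0.
      apply: filterS (hn _ tM0) => n.
      move=> /(le_lt_trans (ler_norm _)) ?; apply: h0; lra.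
    apply: cvg_EFin; first exact: nearW.
    rewrite /comp/= -[X in _ --> X](mulr0 0); under eq_fun do rewrite expr2.
    by apply: cvgM; rewrite -[X in _ --> X](subrr (h t));
      apply: cvgB => //; exact: cvg_cst.
- rewrite /g; under eq_fun do rewrite EFinM.
  apply: integrableZl => //; apply/integrableP; split.
    by apply: measurableT_comp => //; exact: measurable_indic.
  under eq_integral do rewrite gee0_abs ?lee_fin//.
  rewrite integral_indic// setIT /= lebesgue_measure_itv /=.
  by case: ifP => _; rewrite ?ltry// -EFinB ltry.
- apply: aeW => t n _; rewrite /g gee0_abs ?lee_fin ?sqr_ge0//.
  rewrite indicE; case: (boolP (t \in _)) => [_|].
    rewrite mulr1 -ler_sqrt ?exprn_ge0//; last by rewrite mulr_ge0// ltW.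
    rewrite !sqrtr_sqr (ger0_norm (_ : 0 <= 2 * M)); last by rewrite mulr_ge0// ltW.
    rewrite (le_trans (ler_normB _ _))//.
    by have := hM (t + z n); have := hM t; lra.
  rewrite notin_setE /= in_itv /= => /negP; rewrite -ler_norml -ltNge => tMc.
  have e1 : M <= `|t| by lra.
  have e2 : M <= `|t + z n|.
    have := ler_normB (t + z n) (z n); rewrite addrK; have := zc n; lra.
  by rewrite (h0 _ e1) (h0 _ e2) subrr expr0n /= mulr0.
Qed.

(** Cut v in the domain and in the range, approximate the result in the mean by a
    continuous function and clamp the latter to the range of the former. For
    functions bounded by M the squared distance is at most 2 M times the mean
    distance, so this approximates in the mean square as well. *)
Lemma truncated_continuous_dense (v : R -> R) (e : R) :
  measurable_fun setT v -> (sqn v < +oo)%E -> 0 < e ->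
  exists (M : R) (h : R -> R), [/\ 0 < M, truncated_continuous M h &
    (sqn (fun t : R => v t - h t)%R < e%:E)%E].
Proof.
move=> mv v2 e0.
pose w (n : nat) t := v t * \1_[set s | `|s| < n%:R /\ `|v s| <= n%:R] t.
have mw n : measurable_fun setT (w n).
  apply: measurable_funM => //; apply: measurable_indic.
  apply: measurableI.
    exact: (measurable_preimage_itv `]-oo, n%:R[ (@normr_measurable R setT)).
  exact: (measurable_preimage_itv `]-oo, n%:R] (measurableT_comp (@normr_measurable R setT) mv)).
have wE n t : w n t = if `[< `|t| < n%:R /\ `|v t| <= n%:R >] then v t else 0.
  rewrite /w indicE; case: asboolP => h; first by rewrite mem_set ?mulr1.
  by rewrite memNset ?mulr0.
have vw : sqn (fun t : R => v t - w n t) @[n --> \oo] --> 0%E.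
  have -> : 0%E = (\int[mu]_(t in setT) cst 0%E t)%E by rewrite integral0.
  have [|||||_ _ //] := @dominated_convergence _ _ _ mu setT measurableT
    (fun n t => ((v t - w n t) ^+ 2)%:E) (cst 0%E) (fun t : R => (v t ^+ 2)%:E).
  - by move=> n; apply: measurable_sqr_EFin; exact: measurable_funB.
  - exact: measurable_cst.
  - apply: aeW => t _; apply: cvg_near_cst.
    exists (Num.trunc (`|t| + `|v t|)).+1 => // n /= tn.
    have lt : `|t| + `|v t| < n%:R.
      by apply: lt_le_trans (truncnS_gt _) _; rewrite ler_nat.
    rewrite wE asboolT ?subrr ?expr0n//.
    by split; [|apply: ltW]; apply: le_lt_trans lt; rewrite ?lerDl ?lerDr.
  - apply/integrableP; split; first exact: measurable_sqr_EFin.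
    by under eq_integral do rewrite gee0_abs ?lee_fin ?sqr_ge0//.
  - apply: aeW => t n _; rewrite gee0_abs ?lee_fin ?sqr_ge0// wE.
    by case: ifP => _; rewrite ?subrr ?subr0// expr0n sqr_ge0.
have e4 : 0 < e / 4 by rewrite divr_gt0.
have [n n0 vwn] : exists2 n, (0 < n)%N & (sqn (fun t : R => v t - w n t)%R < (e / 4)%:E)%E.
  have /fine_cvgP[fin /cvgrPdist_lt/(_ _ e4) near0] := vw.
  have [k _ hk] := filterI fin near0.
  have [fk] := hk k.+1 (leqnSn k); rewrite sub0r normrN /= ger0_norm; last first.
    by rewrite fine_ge0// sqn_ge0.
  by move=> lt; exists k.+1 => //; rewrite -(fineK fk) lte_fin.
pose M : R := n%:R; have M0 : 0 < M by rewrite ltr0n.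
have wM t : `|w n t| <= M.
  by rewrite wE; case: asboolP => [[]//|_]; rewrite normr0 ltW.
pose E := `[(- M)%R, M]%classic.
have muE : (mu E < +oo)%E.
  by rewrite lebesgue_measure_itv /=; case: ifP => _; rewrite ?ltry// -EFinB ltry.
have iw : mu.-integrable E (EFin \o w n).
  apply: measurable_bounded_integrable => //; [exact: measurable_itv|exact: (measurable_funTS (mw n))|].
  exists M; split; rewrite ?num_real// => x Mx t _ /=.
  by apply: (le_trans (wM t)); exact: ltW.
have [g [cg ig gw]] := approximation_continuous_integrable
  (measurable_itv _) muE iw.
(* The choice for which 2 * (2 * M * d) is half of e. *)
pose d : R := e / (8 * M).
have d0 : 0 < d by rewrite divr_gt0// mulr_gt0.
have [k gk] : exists k, (\int[mu]_(z in E) `|(w n z - g k z)%:E| < d%:E)%E.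
  have /fine_cvgP[fin /cvgrPdist_lt/(_ _ d0) near0] := gw.
  have [k _ hk] := filterI fin near0; exists k.
  have [fk] := hk k (leqnn k); rewrite sub0r normrN /= ger0_norm; last first.
    by rewrite fine_ge0// integral_ge0.
  by move=> lt; rewrite -(fineK fk) lte_fin.
pose clamp (x : R) := Num.max (- M) (Num.min M x).
have clampM x : `|clamp x| <= M.
  rewrite ler_norml /clamp le_max lexx orTb ge_max ge_min lexx orTb andbT andTb; lra.
have clampB x y : `|x| <= M -> `|x - clamp y| <= `|x - y|.
  rewrite ler_norml => /andP[h1 h2].
  have h3 := ler_norm (x - y); have := ler_norm (y - x); rewrite distrC => h4.
  rewrite ler_norml /clamp; apply/andP.
  case: (leP M y) => My; first by rewrite max_r; [split; lra|lra].
  by case: (leP (- M) y) => My'; split; lra.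
have cclamp : continuous clamp.
  move=> x; apply: (@continuous_max R R (cst (- M)) ((cst M) \min id) x).
    exact: cst_continuous.
  by apply: continuous_min; [exact: cst_continuous|exact: cvg_id].
pose h t := clamp (g k t) * \1_[set s | `|s| < M] t.
have hE t : h t = if `|t| < M then clamp (g k t) else 0.
  rewrite /h indicE; case: ifPn => tM; first by rewrite mem_set ?mulr1.
  by rewrite memNset ?mulr0// => /=; apply/negP.
have mh : measurable_fun setT h.
  apply: measurable_funM.
    apply: continuous_measurable_fun => x.
    by apply: continuous_comp; [exact: cg|exact: cclamp].
  apply: measurable_indic.
  exact: (measurable_preimage_itv `]-oo, M[ (@normr_measurable R setT)).
exists M, h; split => //.
  split => // t.
  - by rewrite hE; case: ifP => // _; rewrite normr0 ltW.
  - by move=> Mt; rewrite hE ltNge Mt.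
  - move=> tM; suff : h s @[s --> t] --> h t by [].
    rewrite (hE t) tM.
    apply: (@cvg_trans _ (clamp (g k s) @[s --> t])).
      apply: near_eq_cvg; near=> s; rewrite hE ifT//.
      near: s; exact: (cvgr_lt `|t| (@norm_continuous _ _ t)).
    exact: (cvg_comp _ _ (cg k t) (cclamp (g k t))).
apply: (@le_lt_trans _ _ (2%:E * sqn (fun t : R => v t - w n t)%R +
    2%:E * sqn (fun t : R => w n t - h t)%R)%E).
  have := @sqnD (fun t : R => v t - w n t) (fun t : R => w n t - h t).
  rewrite (_ : (fun t : R => v t - w n t + (w n t - h t)) = (fun t : R => v t - h t)).
    2: by apply/funext => t; rewrite addrA subrK.
  by apply; exact: measurable_funB.
have wh : (sqn (fun t : R => w n t - h t)%R < ((2 * M) * d)%:E)%E.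
  apply: (@le_lt_trans _ _ (\int[mu]_(t in E) ((2 * M)%:E * `|(w n t - g k t)%:E|))%E).
    rewrite [leRHS]integral_mkcond; apply: ge0_le_integral => //.
    - by move=> t _; rewrite lee_fin sqr_ge0.
    - by apply: measurable_sqr_EFin; exact: measurable_funB.
    - apply/(measurable_restrictT _ (measurable_itv _)).
      apply: measurable_funeM; apply: measurableT_comp => //.
      apply: measurableT_comp => //; apply: measurable_funB.
        exact: measurable_funTS.
      by apply: measurable_funTS; exact: continuous_measurable_fun.
    move=> t _; rewrite patchE; case: ifPn => [|]; rewrite ?inE ?notin_setE.
      move=> tE; rewrite -EFinM lee_fin hE; case: ifPn => tM.
        rewrite -real_normK ?num_real// expr2; apply: ler_pM => //.
          rewrite (le_trans (ler_normB _ _))//.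
          by have := wM t; have := clampM (g k t); lra.
        exact: clampB.
      rewrite wE asboolF; last by case=> h1 _; rewrite h1 in tM.
      by rewrite subrr expr0n /= mulr_ge0// mulr_ge0// ltW.
    rewrite /E /= in_itv /= -ler_norml => /negP; rewrite -ltNge => Mt.
    rewrite hE ifF; last by apply/negbTE; rewrite -leNgt ltW.
    rewrite wE asboolF ?subrr ?expr0n//= => -[h1 _].
    by have := lt_trans Mt h1; rewrite ltxx.
  rewrite ge0_integralZl_EFin//; last 3 first.
  - exact: measurable_itv.
  - apply: measurableT_comp => //; apply: measurableT_comp => //.
    apply: measurable_funB; first exact: (measurable_funTS (mw n)).
    by apply: measurable_funTS; exact: continuous_measurable_fun.
  - by rewrite mulr_ge0// ltW.
  by rewrite [ltRHS]EFinM lte_pmul2l ?lte_fin ?mulr_gt0.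
rewrite (_ : e%:E = 2%:E * (e / 4)%:E + 2%:E * (2 * M * d)%:E)%E; last first.
  rewrite -!EFinM -EFinD; congr (_%:E); rewrite /d; field; exact: lt0r_neq0.
by apply: lteD; rewrite lte_pmul2l.
Unshelve. all: by end_near. Qed.

(** Translating preserves the mean square, so v may be replaced by a nearby
    truncated continuous function, at the cost of a fixed multiple of the
    distance. *)
Lemma sqn_translation_cvg (v : R -> R) (z : nat -> R) (c : R) :
  measurable_fun setT v -> (sqn v < +oo)%E ->
  z @ \oo --> 0 -> (forall n, `|z n| <= c) ->
  sqn (fun t : R => v (t + z n) - v t) @[n --> \oo] --> 0%E.
Proof.
move=> mv v2 z0 zc; apply: cvge0P => [n|e e0]; first exact: sqn_ge0.
have e16 : 0 < e / 16 by rewrite divr_gt0.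
have e4 : 0 < e / 4 by rewrite divr_gt0.
have [M [h [M0 hh vh]]] := truncated_continuous_dense mv v2 e16.
have mh : measurable_fun setT h by case: hh.
have /fine_cvgP[fin /cvgrPdist_lt/(_ _ e4) near0] :=
  truncated_continuous_shift M0 hh z0 zc.
apply: filterS (filterI fin near0) => n [fn].
rewrite sub0r normrN /= ger0_norm; last by rewrite fine_ge0// sqn_ge0.
move=> hn; have {}hn : (sqn (fun t : R => h (t + z n) - h t)%R < (e / 4)%:E)%E.
  by rewrite -(fineK fn) lte_fin.
apply: (@le_lt_trans _ _ (2%:E * (4%:E * sqn (fun t : R => v t - h t)%R) +
    2%:E * sqn (fun t : R => h (t + z n) - h t)%R)%E).
  have mvh : measurable_fun setT (fun t : R => v t - h t) by exact: measurable_funB.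
  apply: (@le_trans _ _ (2%:E * sqn (fun t : R => (v (t + z n) - h (t + z n)) - (v t - h t))%R
    + 2%:E * sqn (fun t : R => h (t + z n) - h t)%R)%E); last first.
    by apply: leeD => //; rewrite lee_pmul2l//; exact: (sqn_shiftB (z n) mvh).
  have := @sqnD (fun t : R => (v (t + z n) - h (t + z n)) - (v t - h t))
     (fun t : R => h (t + z n) - h t).
  rewrite (_ : (fun t : R => v (t + z n) - h (t + z n) - (v t - h t) +
    (h (t + z n) - h t)) = (fun t : R => v (t + z n) - v t)).
    2: by apply/funext => t; ring.
  apply; apply: measurable_funB => //; last exact: measurable_shift.
  exact: (measurable_shift (z n) mvh).
rewrite (_ : e%:E = 2%:E * (4%:E * (e / 16)%:E) + 2%:E * (e / 4)%:E)%E; last first.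
  by rewrite -!EFinM -EFinD; congr (_%:E); field.
by apply: lteD; rewrite !lte_pmul2l.
Qed.

End Translation.

(** * Plancherel's theorem for integrable square-integrable functions *)

Section PartialIntegral.
Context d1 d2 (T1 : measurableType d1) (T2 : measurableType d2) (R : realType).
Variable m : {sigma_finite_measure set T2 -> \bar R}.

Lemma measurable_Rintegral (f : T1 * T2 -> R) : measurable_fun setT f ->
  measurable_fun setT (fun x => \int[m]_y f (x, y)).
Proof.
move=> mf; have mEf : measurable_fun setT (EFin \o f) by exact: measurableT_comp.
have mpos := @measurable_fun_fubini_tonelli_F _ _ _ _ R m (EFin \o f)^\+%E
  (measurable_funepos mEf) (fun x => funepos_ge0 (EFin \o f) x).
have mneg := @measurable_fun_fubini_tonelli_F _ _ _ _ R m (EFin \o f)^\-%E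
  (measurable_funeneg mEf) (fun x => funeneg_ge0 (EFin \o f) x).
apply: (measurableT_comp (f := fine)); first exact: fine_measurable.
apply: eq_measurable_fun (emeasurable_funB mpos mneg) => x _ /=.
rewrite [RHS]integralE /fubini_F; congr (_ - _)%E; apply: eq_integral => y _.
  by rewrite !funeposE.
by rewrite !funenegE.
Qed.

Lemma cmeasurable_cintegral (f : T1 * T2 -> R[i]) : cmeasurable_fun setT f ->
  cmeasurable_fun setT (fun x => cintegral m setT (fun y => f (x, y))).
Proof.
by move=> [fr fi]; split; [exact: measurable_Rintegral fr|exact: measurable_Rintegral fi].
Qed.

End PartialIntegral.

Section Plancherel.
Variable R : realType.
Local Notation C := R[i].
Local Notation mu := (@lebesgue_measure R).

Lemma sigma_finite_lebesgue2 : sigma_finite setT (mu \x mu)%E.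
Proof.
have /sigma_finiteP[F [TF ndF Foo]] := sigma_finiteT mu.
exists (fun n => F n `*` F n).
 rewrite -setXTT TF predeqE => -[x y]; split.
    move=> [/= [n _ Fnx] [k _ Fky]]; exists (maxn n k) => //; split.
    - by move: x Fnx; exact/subsetPset/ndF/leq_maxl.
    - by move: y Fky; exact/subsetPset/ndF/leq_maxr.
  by move=> [n _ []/= ? ?]; split; exists n.
move=> k; have [? ?] := Foo k.
split; first exact: measurableX.
by rewrite product_measure1E// lte_mul_pinfty// ge0_fin_numE.
Qed.

(** Lebesgue measure on the plane with its sigma-finiteness attached, as Fubini's
    theorem for the triple integral below requires. *)
Definition lebesgue2 :
    {sigma_finite_measure set (measurableTypeR R * measurableTypeR R)%type -> \bar R} :=
  HB.pack_for (SigmaFiniteMeasure.type (measurableTypeR R * measurableTypeR R)%type R)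
    (mu \x mu)%E (Measure_isSigmaFinite.Build _ _ _ (mu \x mu)%E sigma_finite_lebesgue2).
Local Notation mu2 := lebesgue2.

Lemma integrable_prod_mul (a b : R -> R) :
  mu.-integrable setT (EFin \o a) -> mu.-integrable setT (EFin \o b) ->
  mu2.-integrable setT (fun p : R * R => (a p.1 * b p.2)%:E) /\
  \int[mu2]_p (a p.1 * b p.2) = \int[mu]_s a s * \int[mu]_t b t.
Proof.
move=> ia ib.
have ma : measurable_fun setT a by apply/measurable_EFinP; exact: measurable_int ia.
have mb : measurable_fun setT b by apply/measurable_EFinP; exact: measurable_int ib.
have mab : measurable_fun setT (fun p : R * R => (a p.1 * b p.2)%:E).
  apply: measurableT_comp => //; apply: measurable_funM.
    exact: (measurableT_comp ma measurable_fst).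
  exact: (measurableT_comp mb measurable_snd).
have iab : mu2.-integrable setT (fun p : R * R => (a p.1 * b p.2)%:E).
  apply/integrable12ltyP => //=.
  have na : (\int[mu]_t `|a t|%:E < +oo)%E by have /integrableP[] := ia.
  have nb : (\int[mu]_t `|b t|%:E \is a fin_num)%E.
    by rewrite ge0_fin_numE ?integral_ge0//; have /integrableP[] := ib.
  under eq_integral => s _.
    under eq_integral do rewrite normrM EFinM.
    rewrite ge0_integralZl//; last by do 2 apply: measurableT_comp.
    rewrite -(fineK nb); over.
  rewrite /= ge0_integralZr//; last 2 first.
  - by do 2 apply: measurableT_comp.
  - by rewrite lee_fin fine_ge0// integral_ge0.
  by rewrite lte_mul_pinfty ?integral_ge0 ?ltry// ge0_fin_numE ?integral_ge0.
split => //; rewrite /Rintegral -integral12_prod_meas1//.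
rewrite /fubini_F /=.
under eq_integral => s _.
  under eq_integral do rewrite EFinM.
  rewrite integralZl// -[X in (_ * X)%E]fineK; last exact: integrable_fin_num.
  over.
rewrite /= -/(Rintegral mu setT b) integralZr// fineM//.
exact: integrable_fin_num.
Qed.

Definition cis (t : R) : C := cos t +i* sin t.

Lemma normc_cis t : normc (cis t) = 1.
Proof. by rewrite /cis /ComplexField.Normc.normc cos2Dsin2 sqrtr1. Qed.

Section Composition.
Context d (T : measurableType d).

Lemma cmeasurable_comp (u : R -> C) (phi : T -> R) : cmeasurable_fun setT u ->
  measurable_fun setT phi -> cmeasurable_fun setT (fun t => u (phi t)).
Proof.
by move=> [mr mi] mphi; split; [exact: (measurableT_comp mr mphi)|
  exact: (measurableT_comp mi mphi)].
Qed.

Lemma cmeasurable_cis (phi : T -> R) : measurable_fun setT phi ->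
  cmeasurable_fun setT (fun t => cis (phi t)).
Proof.
move=> mphi; split; apply: measurableT_comp mphi.
  by apply: continuous_measurable_fun; exact: continuous_cos.
by apply: continuous_measurable_fun; exact: continuous_sin.
Qed.

End Composition.

Definition fourier (u : R -> C) (x : R) : C :=
  cintegral mu setT (fun r => cis (2 * pi * x * r) * u r).

Variable u : R -> C.
Hypothesis iu : cintegrable mu setT u.
Hypothesis u2 : (\int[mu]_r (normc (u r) ^+ 2)%:E < +oo)%E.

Let mu_u : cmeasurable_fun setT u.
Proof. exact: (cintegrable_measurable iu). Qed.

Let mre : measurable_fun setT (fun r => complex.Re (u r)).
Proof. by case: mu_u. Qed.
Let mim : measurable_fun setT (fun r => complex.Im (u r)).
Proof. by case: mu_u. Qed.

Lemma fourier_integrable x :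
  cintegrable mu setT (fun r => cis (2 * pi * x * r) * u r).
Proof.
apply: (@cintegrable_le _ _ _ mu setT measurableT _ (fun r => normc (u r))).
- by apply: cmeasurableM => //; apply: cmeasurable_cis; exact: measurable_funM.
- exact: (@cintegrable_normc _ _ _ mu setT measurableT _ iu).
- by move=> r _; rewrite normcM normc_cis mul1r.
Qed.

Let H (x : R) (p : R * R) : R :=
  complex.Re (u p.1 * conjc (u p.2)) * cos (2 * pi * (p.1 - p.2) * x) -
  complex.Im (u p.1 * conjc (u p.2)) * sin (2 * pi * (p.1 - p.2) * x).

(** Written as a double integral, the square allows Fubini's theorem to carry out
    the integral over x first. *)
Lemma sqr_normc_fourier x :
  normc (fourier u x) ^+ 2 = \int[mu2]_p H x p.
Proof.
have [ir ii] := fourier_integrable x.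
have [i1 e1] := integrable_prod_mul ir ir.
have [i2 e2] := integrable_prod_mul ii ii.
rewrite sqr_normcE !expr2 /= -e1 -e2 -RintegralD//.
apply: eq_Rintegral => p _; rewrite /H.
rewrite (_ : 2 * pi * (p.1 - p.2) * x = 2 * pi * x * p.1 - 2 * pi * x * p.2).
  2: by ring.
rewrite cosB sinB !(ReM, ImM, ReJ, ImJ) /=; ring.
Qed.

Lemma normr_H_le x p : `|H x p| <= normc (u p.1) * normc (u p.2).
Proof.
rewrite /H; set y := _ * x.
rewrite (_ : _ - _ = complex.Re (u p.1 * conjc (u p.2) * cis y)).
  2: by rewrite [RHS]ReM.
apply: (le_trans (Re_le_normc _)).
by rewrite !normcM normc_cis mulr1 normc_conj.
Qed.

Let mcomp d (T : measurableType d) (phi : T -> R) (f : R -> R) :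
  measurable_fun setT phi -> measurable_fun setT f ->
  measurable_fun setT (fun t => f (phi t)).
Proof. by move=> mphi mf; exact: measurableT_comp. Qed.

Let mucomp d (T : measurableType d) (phi : T -> R) :
  measurable_fun setT phi -> cmeasurable_fun setT (fun t => u (phi t)).
Proof. exact: cmeasurable_comp. Qed.

Let K (eps : R) (z : R * (R * R)) : R := expR (- eps * `|z.1|) * H z.1 z.2.

Lemma measurable_K eps : measurable_fun setT (K eps).
Proof.
have m1 : measurable_fun setT (fun z : R * (R * R) => z.2.1).
  exact: (measurableT_comp measurable_fst measurable_snd).
have m2 : measurable_fun setT (fun z : R * (R * R) => z.2.2).
  exact: (measurableT_comp measurable_snd measurable_snd).
have m0 : measurable_fun setT (fun z : R * (R * R) => z.1) by exact: measurable_fst.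
have m3 : measurable_fun setT (fun z : R * (R * R) => 2 * pi * (z.2.1 - z.2.2) * z.1).
  by apply: measurable_funM => //; apply: measurable_funM => //; exact: measurable_funB.
have [mr mi] : cmeasurable_fun setT (fun z : R * (R * R) => u z.2.1 * conjc (u z.2.2)).
  apply: cmeasurableM; first exact: mucomp.
  by apply: cmeasurable_conj; exact: mucomp.
apply: measurable_funM.
  apply: (mcomp m0 (f := fun x => expR (- eps * `|x|))).
  by apply: continuous_measurable_fun; exact: continuous_exp_abs.
apply: measurable_funB; apply: measurable_funM => //.
  apply: (mcomp m3); apply: continuous_measurable_fun; exact: continuous_cos.
apply: (mcomp m3); apply: continuous_measurable_fun; exact: continuous_sin.
Qed.

Lemma measurable_K1 eps x : measurable_fun setT (fun p : R * R => (K eps (x, p))%:E).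
Proof.
have h : measurable_fun setT (fun p : R * R => K eps (x, p)).
  exact: (measurableT_comp (measurable_K eps) (pair1_measurable x)).
exact: measurableT_comp.
Qed.

Let inormc : mu.-integrable setT (fun r => (normc (u r))%:E).
Proof. exact: (@cintegrable_normc _ _ _ mu setT measurableT _ iu). Qed.

Lemma integrable_K eps : 0 < eps ->
  (mu \x mu2)%E.-integrable setT (EFin \o K eps).
Proof.
move=> e0; have [inn _] := integrable_prod_mul inormc inormc.
have mK : measurable_fun setT (EFin \o K eps).
  by apply: measurableT_comp => //; exact: measurable_K.
apply/(@integrable12ltyP _ _ _ _ R mu mu2 (EFin \o K eps) mK).
have fin : (\int[mu2]_p `|(normc (u p.1) * normc (u p.2))%:E| \is a fin_num)%E.
  by apply: integrable_fin_num => //; exact: integrable_abse.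
apply: (@le_lt_trans _ _ (\int[mu]_x (\int[mu2]_p `|(normc (u p.1) * normc (u p.2))%:E| *
    (expR (- eps * `|x|))%:E))%E).
  apply: ge0_le_integral => //.
  - by move=> x _; exact: integral_ge0.
  - apply: (@measurable_fun_fubini_tonelli_F _ _ _ _ R mu2 (abse \o (EFin \o K eps))) => //.
      by do 2 apply: measurableT_comp => //; exact: measurable_K.
    by move=> z; exact: abse_ge0.
  - apply: measurable_funeM; apply: measurableT_comp => //.
    by apply: continuous_measurable_fun; exact: continuous_exp_abs.
  move=> x _; rewrite muleC -ge0_integralZl//; last first.
    by apply: measurableT_comp => //; exact: measurable_int inn.
  apply: ge0_le_integral => //.
  - by apply: measurableT_comp => //; exact: measurable_K1.
  - apply: measurable_funeM.
    by apply: measurableT_comp => //; exact: measurable_int inn.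
  move=> p _; rewrite -EFinM lee_fin normrM ger0_norm ?expR_ge0//.
  rewrite ler_wpM2l ?expR_ge0//= (le_trans (normr_H_le _ _))// ler_norm//.
rewrite -(fineK fin) ge0_integralZl//; last 2 first.
- apply: measurableT_comp => //.
  by apply: continuous_measurable_fun; exact: continuous_exp_abs.
- by rewrite lee_fin fine_ge0// integral_ge0.
by rewrite integral_exp_abs// -EFinM ltry.
Qed.

(** The weight makes the triple integral absolutely convergent, and the integral
    over x of the weighted exponential is the Poisson kernel. *)
Lemma integral_fourier_weighted eps : 0 < eps ->
  (\int[mu]_x (expR (- eps * `|x|) * normc (fourier u x) ^+ 2)%:E =
   \int[mu2]_p (complex.Re (u p.1 * conjc (u p.2)) * poisson eps (p.1 - p.2))%:E)%E.
Proof.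
move=> e0; have iK := integrable_K e0; have [inn _] := integrable_prod_mul inormc inormc.
have iH x : mu2.-integrable setT (EFin \o H x).
  apply: (le_integrable _ _ _ inn) => //.
    apply: eq_measurable_fun (measurable_K1 0 x) => p _.
    by rewrite /K /= oppr0 mul0r expR0 mul1r.
  by move=> p _; rewrite /= lee_fin (le_trans (normr_H_le _ _))// ler_norm.
transitivity (\int[mu]_x \int[mu2]_p (EFin \o K eps) (x, p))%E.
  apply: eq_integral => x _; rewrite sqr_normc_fourier EFinM /K /=.
  have -> : (\int[mu2]_p H x p)%:E = (\int[mu2]_p (H x p)%:E)%E.
    by rewrite fineK//; apply: integrable_fin_num => //; exact: iH.
  by rewrite -(integralZl measurableT (iH x)); apply: eq_integral => p _; rewrite EFinM.
apply: etrans (Fubini iK) _; apply: eq_integral => p _; rewrite /K /H /=.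
set al := complex.Re _; set be := complex.Im _.
have ic : mu.-integrable setT (EFin \o fun x => expR (- eps * `|x|) *
    cos (2 * pi * (p.1 - p.2) * x)).
  apply: integrable_exp_abs_bounded => //.
    by apply: measurable_comp_lin; exact: continuous_cos.
  by move=> x; rewrite ler_norml cos_geN1 cos_le1.
have isn : mu.-integrable setT (EFin \o fun x => expR (- eps * `|x|) *
    sin (2 * pi * (p.1 - p.2) * x)).
  apply: integrable_exp_abs_bounded => //.
    by apply: measurable_comp_lin; exact: continuous_sin.
  by move=> x; rewrite ler_norml sin_geN1 sin_le1.
transitivity (al%:E * (\int[mu]_x (expR (- eps * `|x|) *
      cos (2 * pi * (p.1 - p.2) * x)))%:E - be%:E * (\int[mu]_x (expR (- eps * `|x|) *
      sin (2 * pi * (p.1 - p.2) * x)))%:E)%E; last first.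
  by rewrite Rintegral_exp_abs_cos// Rintegral_exp_abs_sin// mule0 sube0 EFinM.
rewrite !fineK; do ?[exact: integrable_fin_num].
rewrite -!integralZl// -integralB//; do ?[exact: integrableZl].
by apply: eq_integral => x _; rewrite -!EFinM -EFinB; congr (_%:E); ring.
Qed.

Let sqS : \bar R := (\int[mu]_r (normc (u r) ^+ 2)%:E)%E.

Let sqS_ge0 : (0 <= sqS)%E.
Proof. by apply: integral_ge0 => r _; rewrite lee_fin sqr_ge0. Qed.

Let sqS_fin : sqS \is a fin_num.
Proof. by rewrite ge0_fin_numE. Qed.

Let mnormc2 d (T : measurableType d) (f : T -> C) : cmeasurable_fun setT f ->
  measurable_fun setT (fun t => (normc (f t) ^+ 2)%:E).
Proof.
move=> mf; apply: measurableT_comp => //; apply: measurable_funX.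
exact: cmeasurable_normc.
Qed.

Let mpoisson d (T : measurableType d) eps (phi : T -> R) : 0 < eps ->
  measurable_fun setT phi -> measurable_fun setT (fun t => (poisson eps (phi t))%:E).
Proof.
move=> e0 mphi; apply: measurableT_comp => //; apply: (mcomp mphi).
by apply: continuous_measurable_fun; exact: continuous_poisson.
Qed.

(** The squared modulus of continuity of u in the mean. *)
Definition modulus (z : R) : \bar R :=
  (\int[mu]_t (normc (u (t + z) - u t) ^+ 2)%:E)%E.

Let mdiff : measurable_fun setT
  (fun p : R * R => (normc (u (p.2 + p.1) - u p.2) ^+ 2)%:E).
Proof.
apply: mnormc2; apply: cmeasurableB; apply: mucomp => //.
by apply: measurable_funD.
Qed.

Lemma measurable_modulus : measurable_fun setT modulus.
Proof.
apply: (@measurable_fun_fubini_tonelli_F _ _ _ _ R mu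
  (fun p : R * R => (normc (u (p.2 + p.1) - u p.2) ^+ 2)%:E)) => //.
by move=> p; rewrite lee_fin sqr_ge0.
Qed.

Lemma sqSE : sqS = (sqn (fun r => complex.Re (u r)) + sqn (fun r => complex.Im (u r)))%E.
Proof.
rewrite /sqn -ge0_integralD//; do ?[by move=> t _; rewrite lee_fin sqr_ge0];
  do ?[exact: measurable_sqr_EFin].
by apply: eq_integral => r _; rewrite sqr_normcE EFinD.
Qed.

Lemma modulusE z : modulus z =
  (sqn (fun t => complex.Re (u (t + z)) - complex.Re (u t))%R +
   sqn (fun t => complex.Im (u (t + z)) - complex.Im (u t))%R)%E.
Proof.
have mr := measurable_funB (measurable_shift z mre) mre.
have mi := measurable_funB (measurable_shift z mim) mim.
rewrite /sqn -ge0_integralD//; do ?[by move=> t _; rewrite lee_fin sqr_ge0];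
  do ?[exact: (measurable_sqr_EFin mr)|exact: (measurable_sqr_EFin mi)].
by apply: eq_integral => r _; rewrite sqr_normcE -EFinD !reimE.
Qed.

Lemma modulus_ge0 z : (0 <= modulus z)%E.
Proof. by apply: integral_ge0 => r _; rewrite lee_fin sqr_ge0. Qed.

Lemma modulus_le z : (modulus z <= 4%:E * sqS)%E.
Proof.
rewrite modulusE sqSE ge0_muleDr ?sqn_ge0//.
by apply: leeD; [exact: (sqn_shiftB z mre)|exact: (sqn_shiftB z mim)].
Qed.

Lemma modulus_cvg (z : nat -> R) (c : R) : z @ \oo --> 0 -> (forall n, `|z n| <= c) ->
  modulus (z n) @[n --> \oo] --> 0%E.
Proof.
move=> z0 zc.
have [sr si] : (sqn (fun r => complex.Re (u r)) < +oo)%E /\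
    (sqn (fun r => complex.Im (u r)) < +oo)%E.
  move: u2; rewrite -/sqS sqSE => h; split; apply: le_lt_trans h.
    by rewrite leeDl ?sqn_ge0.
  by rewrite leeDr ?sqn_ge0.
have -> : (fun n => modulus (z n)) = (fun n =>
    sqn (fun t => complex.Re (u (t + z n)) - complex.Re (u t))%R +
    sqn (fun t => complex.Im (u (t + z n)) - complex.Im (u t))%R)%E.
  by apply/funext => n; exact: modulusE.
rewrite -[X in _ --> X](adde0 0%E); apply: cvgeD => //.
  exact: (sqn_translation_cvg mre sr z0 zc).
exact: (sqn_translation_cvg mim si z0 zc).
Qed.

(** The part of the weighted integral that is missing from Plancherel's identity;
    it vanishes in the limit because the Poisson kernels concentrate at 0. *)
Definition defect (eps : R) : \bar R := (\int[mu]_z ((poisson eps z)%:E * modulus z))%E.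

Let pe_ge0 (eps z : R) : 0 < eps -> (0 <= (poisson eps z)%:E)%E.
Proof. by move=> e0; rewrite lee_fin poisson_ge0// ltW. Qed.

Lemma integral_poisson_affine (eps a b : R) : 0 < eps -> `|a| = 1 ->
  (\int[mu]_t (poisson eps (a * t + b))%:E = 1)%E.
Proof.
move=> e0 a1; rewrite -(integral_poisson e0) [RHS](@ge0_integral_affine R a b).
- by rewrite a1 mul1e.
- by rewrite -normr_eq0 a1 oner_eq0.
- exact: mpoisson.
- by move=> r; exact: pe_ge0.
Qed.

Let mfst : measurable_fun setT (fun p : R * R => p.1). Proof. exact: measurable_fst. Qed.
Let msnd : measurable_fun setT (fun p : R * R => p.2). Proof. exact: measurable_snd. Qed.
Let mfst_snd : measurable_fun setT (fun p : R * R => p.1 - p.2).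
Proof. exact: measurable_funB. Qed.

Lemma integral_left eps : 0 < eps ->
  (\int[mu2]_p ((normc (u p.1) ^+ 2)%:E * (poisson eps (p.1 - p.2))%:E) = sqS)%E.
Proof.
move=> e0; rewrite fubini_tonelli1 //; last 2 first.
- apply: emeasurable_funM; last exact: mpoisson.
  by apply: mnormc2; exact: mucomp.
- by move=> p; rewrite mule_ge0 ?pe_ge0// lee_fin sqr_ge0.
apply: eq_integral => s _.
rewrite -[LHS]/(\int[mu]_t ((normc (u s) ^+ 2)%:E * (poisson eps (s - t)%R)%:E))%E.
rewrite ge0_integralZl//; last 3 first.
- by apply: mpoisson => //; apply: measurable_funB.
- by move=> t _; exact: pe_ge0.
- by rewrite lee_fin sqr_ge0.
rewrite (_ : (\int[_]_(_ in _) _)%E = 1%E) ?mule1//.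
rewrite -(@integral_poisson_affine eps (-1) s e0) ?normrN ?normr1//.
by apply: eq_integral => t _; rewrite mulN1r addrC.
Qed.

Lemma integral_right eps : 0 < eps ->
  (\int[mu2]_p ((normc (u p.2) ^+ 2)%:E * (poisson eps (p.1 - p.2))%:E) = sqS)%E.
Proof.
move=> e0; rewrite fubini_tonelli2 //; last 2 first.
- apply: emeasurable_funM; last exact: mpoisson.
  by apply: mnormc2; exact: mucomp.
- by move=> p; rewrite mule_ge0 ?pe_ge0// lee_fin sqr_ge0.
apply: eq_integral => s _.
rewrite -[LHS]/(\int[mu]_t ((normc (u s) ^+ 2)%:E * (poisson eps (t - s)%R)%:E))%E.
rewrite ge0_integralZl//; last 3 first.
- by apply: mpoisson => //; apply: measurable_funB.
- by move=> t _; exact: pe_ge0.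
- by rewrite lee_fin sqr_ge0.
rewrite (_ : (\int[_]_(_ in _) _)%E = 1%E) ?mule1//.
rewrite -(@integral_poisson_affine eps 1 (- s) e0) ?normr1//.
by apply: eq_integral => t _; rewrite mul1r.
Qed.

Lemma integral_defect eps : 0 < eps ->
  (\int[mu2]_p ((normc (u p.1 - u p.2) ^+ 2)%:E * (poisson eps (p.1 - p.2))%:E) =
  defect eps)%E.
Proof.
move=> e0; rewrite fubini_tonelli2 //; last 2 first.
- apply: emeasurable_funM; last exact: mpoisson.
  by apply: mnormc2; apply: cmeasurableB; exact: mucomp.
- by move=> p; rewrite mule_ge0 ?pe_ge0// lee_fin sqr_ge0.
transitivity (\int[mu]_t \int[mu]_z
    ((normc (u (t + z) - u t) ^+ 2)%:E * (poisson eps z)%:E))%E.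
  apply: eq_integral => t _.
  rewrite -[LHS]/(\int[mu]_s ((normc (u s - u t) ^+ 2)%:E * (poisson eps (s - t)%R)%:E))%E.
  rewrite (@ge0_integral_affine R 1 t (fun s =>
    (normc (u s - u t) ^+ 2)%:E * (poisson eps (s - t)%R)%:E)%E) ?oner_eq0//.
  - rewrite normr1 mul1e; apply: eq_integral => z _.
    by rewrite mul1r addrK (addrC z t).
  - apply: emeasurable_funM; last by apply: mpoisson => //; apply: measurable_funB.
    apply: mnormc2; apply: (cmeasurableB mu_u).
    exact: cmeasurable_cst.
  - by move=> r; rewrite mule_ge0 ?pe_ge0// lee_fin sqr_ge0.
pose f (p : R * R) : \bar R :=
  ((normc (u (p.2 + p.1) - u p.2) ^+ 2)%:E * (poisson eps p.1)%:E)%E.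
have mf : measurable_fun setT f.
  by apply: emeasurable_funM; [exact: mdiff|exact: mpoisson].
have f0 p : (0 <= f p)%E by rewrite mule_ge0 ?pe_ge0// lee_fin sqr_ge0.
rewrite -(@fubini_tonelli _ _ _ _ R mu mu f mf f0).
apply: eq_integral => z _.
rewrite -[LHS]/(\int[mu]_t ((normc (u (t + z)%R - u t) ^+ 2)%:E * (poisson eps z)%:E))%E.
rewrite ge0_integralZr//; first by rewrite muleC.
- have := measurableT_comp mdiff (pair1_measurable z); exact.
- by move=> t _; rewrite lee_fin sqr_ge0.
- exact: pe_ge0.
Qed.

(** Rescaling fixes the kernel and moves eps into the modulus, where dominated
    convergence and the continuity of translations apply. *)
Lemma defect_scale eps : 0 < eps ->
  defect eps = (\int[mu]_w ((poisson 1 w)%:E * modulus (eps * w)))%E.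
Proof.
move=> e0; rewrite /defect (@ge0_integral_affine R eps 0) ?gt_eqF//; last 2 first.
- by apply: emeasurable_funM; [exact: mpoisson|exact: measurable_modulus].
- by move=> r; rewrite mule_ge0 ?pe_ge0 ?modulus_ge0.
rewrite -ge0_integralZl//; last 2 first.
- apply: (measurableT_comp (f := fun z => ((poisson eps z)%:E * modulus z)%E)
    _ (measurable_affine eps 0)).
  by apply: emeasurable_funM; [exact: mpoisson|exact: measurable_modulus].
- by move=> r _; rewrite mule_ge0 ?pe_ge0 ?modulus_ge0.
apply: eq_integral => w _; rewrite addr0 muleA -EFinM gtr0_norm//.
by rewrite poisson_scale.
Qed.

Lemma defect_cvg : defect n.+1%:R^-1 @[n --> \oo] --> 0%E.
Proof.
have e0 n : 0 < n.+1%:R^-1 :> R by rewrite invr_gt0.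
have -> : (fun n => defect n.+1%:R^-1) = (fun n =>
    \int[mu]_w ((poisson 1 w)%:E * modulus (n.+1%:R^-1 * w)))%E.
  by apply/funext => n; rewrite defect_scale.
have mpm n : measurable_fun setT (fun w => ((poisson 1 w)%:E * modulus (n.+1%:R^-1 * w))%E).
  apply: emeasurable_funM; first exact: mpoisson.
  apply: (measurableT_comp measurable_modulus).
  by apply: measurable_funM.
have -> : 0%E = (\int[mu]_(t in setT) cst 0%E t)%E by rewrite integral0.
have [||||_ _ //] := @dominated_convergence _ _ _ mu setT measurableT
  (fun n w => ((poisson 1 w)%:E * modulus (n.+1%:R^-1 * w))%E) (cst 0%E)
  (fun w => ((4 * fine sqS)%:E * (poisson 1 w)%:E)%E) mpm.
- exact: measurable_cst.
- apply: aeW => w _; rewrite -[X in _ --> X](mule0 (poisson 1 w)%:E).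
  apply: cvgeZl => //.
  apply: (@modulus_cvg (fun n => n.+1%:R^-1 * w) `|w|).
    by rewrite -[X in _ --> X](mul0r w); apply: cvgM; [exact: cvg_harmonic|exact: cvg_cst].
  move=> n; rewrite normrM ger0_norm ?invr_ge0// -[leRHS]mul1r ler_wpM2r//.
  by rewrite invf_le1// ler1n.
- apply: integrableZl => //; apply/integrableP; split; first exact: mpoisson.
  under eq_integral do rewrite gee0_abs ?pe_ge0//.
  by rewrite integral_poisson1 ltry.
- apply: aeW => w n _; rewrite gee0_abs ?mule_ge0 ?pe_ge0 ?modulus_ge0//.
  rewrite muleC lee_wpmul2r ?pe_ge0//.
  by apply: (le_trans (modulus_le _)); rewrite EFinM fineK.
Qed.

Lemma defect_fin eps : 0 < eps -> defect eps \is a fin_num.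
Proof.
move=> e0; rewrite ge0_fin_numE; last first.
  by apply: integral_ge0 => z _; rewrite mule_ge0 ?pe_ge0 ?modulus_ge0.
apply: (@le_lt_trans _ _ (\int[mu]_z ((4 * fine sqS)%:E * (poisson eps z)%:E))%E).
  apply: ge0_le_integral => //.
  - by move=> z _; rewrite mule_ge0 ?pe_ge0 ?modulus_ge0.
  - by apply: emeasurable_funM; [exact: mpoisson|exact: measurable_modulus].
  - by apply: measurable_funeM; exact: mpoisson.
  move=> z _; rewrite muleC lee_wpmul2r ?pe_ge0//.
  by apply: (le_trans (modulus_le _)); rewrite EFinM fineK.
rewrite ge0_integralZl//.
- by rewrite integral_poisson// mule1 ltry.
- exact: mpoisson.
- by move=> z _; exact: pe_ge0.
- by rewrite lee_fin mulr_ge0// fine_ge0.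
Qed.

(** Polarization: Re (u_s conj u_t) is half of |u_s|^2 + |u_t|^2 - |u_s - u_t|^2. *)
Lemma integral_fourier_defect eps : 0 < eps ->
  (\int[mu]_x (expR (- eps * `|x|) * normc (fourier u x) ^+ 2)%:E =
   sqS - (2^-1)%:E * defect eps)%E.
Proof.
move=> e0; rewrite integral_fourier_weighted//.
pose A (p : R * R) : \bar R := ((normc (u p.1) ^+ 2)%:E * (poisson eps (p.1 - p.2))%:E)%E.
pose B (p : R * R) : \bar R := ((normc (u p.2) ^+ 2)%:E * (poisson eps (p.1 - p.2))%:E)%E.
pose D (p : R * R) : \bar R :=
  ((normc (u p.1 - u p.2) ^+ 2)%:E * (poisson eps (p.1 - p.2))%:E)%E.
have integ (v : R * R -> C) : cmeasurable_fun setT v ->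
    (\int[mu2]_p ((normc (v p) ^+ 2)%:E * (poisson eps (p.1 - p.2))%:E) \is a fin_num)%E ->
    mu2.-integrable setT
      (fun p => (normc (v p) ^+ 2)%:E * (poisson eps (p.1 - p.2))%:E)%E.
  move=> mv fin; apply/integrableP; split.
    by apply: emeasurable_funM; [exact: mnormc2|exact: mpoisson].
  under eq_integral do rewrite gee0_abs ?mule_ge0 ?pe_ge0 ?lee_fin ?sqr_ge0//.
  by move: fin; rewrite ge0_fin_numE// integral_ge0// => p _;
    rewrite mule_ge0 ?pe_ge0// lee_fin sqr_ge0.
have iA : mu2.-integrable setT A.
  by apply: integ; [exact: mucomp|rewrite integral_left].
have iB : mu2.-integrable setT B.
  by apply: integ; [exact: mucomp|rewrite integral_right].
have iD : mu2.-integrable setT D.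
  apply: integ; last by rewrite integral_defect// defect_fin.
  by apply: cmeasurableB; exact: mucomp.
transitivity (\int[mu2]_p ((2^-1)%:E * (A p + B p - D p)))%E.
  apply: eq_integral => p _; rewrite /A /B /D -!EFinM.
  by congr (_%:E); rewrite !sqr_normcE !reimE; field.
have iAB := integrableD measurableT iA iB.
have iABD := integrableB measurableT iAB iD.
apply: etrans (integralZl measurableT iABD (2^-1)) _.
transitivity ((2^-1)%:E * (sqS + sqS - defect eps))%E.
  congr (_ * _)%E; apply: etrans (integralB measurableT iAB iD) _.
  congr (_ - _)%E; last exact: integral_defect.
  apply: etrans (integralD measurableT iA iB) _.
  by congr (_ + _)%E; [exact: integral_left|exact: integral_right].
rewrite -(fineK sqS_fin) -(fineK (defect_fin e0)).
move: (fine sqS) (fine (defect eps)) => a b.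
rewrite -[LHS]/((2^-1 * (a + a - b))%:E) -[RHS]/((a - 2^-1 * b)%:E).
by congr (_%:E); field.
Qed.

Lemma measurable_fourier : cmeasurable_fun setT (fourier u).
Proof.
apply: (@cmeasurable_cintegral _ _ _ _ R mu
  (fun p : R * R => cis (2 * pi * p.1 * p.2) * u p.2)).
apply: cmeasurableM; last exact: mucomp.
have m12 : measurable_fun setT (fun p : R * R => 2 * pi * p.1 * p.2).
  by apply: measurable_funM => //; exact: measurable_funM.
exact: cmeasurable_cis.
Qed.

(** As eps decreases to 0 the weight exp(-eps |x|) increases to 1, so that the
    weighted integrals converge monotonically, while their defects vanish. *)
Theorem plancherel :
  (\int[mu]_x (normc (fourier u x) ^+ 2)%:E = \int[mu]_r (normc (u r) ^+ 2)%:E)%E.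
Proof.
pose g n (x : R) : \bar R :=
  (expR (- n.+1%:R^-1 * `|x|) * normc (fourier u x) ^+ 2)%:E.
have e0 n : 0 < n.+1%:R^-1 :> R by rewrite invr_gt0.
have mg n : measurable_fun setT (g n).
  apply: measurableT_comp => //; apply: measurable_funM.
    by apply: continuous_measurable_fun; exact: continuous_exp_abs.
  by apply: measurable_funX; apply: cmeasurable_normc; exact: measurable_fourier.
have h1 : (\int[mu]_x g n x)%E @[n --> \oo] --> sqS.
  have -> : (fun n => \int[mu]_x g n x)%E =
      (fun n => sqS - (2^-1)%:E * defect n.+1%:R^-1)%E.
    by apply/funext => n; rewrite /g integral_fourier_defect.
  rewrite -[X in _ --> X]sube0 -[X in (_ - X)%E](mule0 (2^-1)%:E).
  apply: cvgeB; [by rewrite mule0 fin_num_adde_defl|exact: cvg_cst|].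
  by apply: cvgeZl => //; exact: defect_cvg.
have h2 : (\int[mu]_x g n x)%E @[n --> \oo] -->
    (\int[mu]_x limn (g^~ x))%E.
  apply: cvg_monotone_convergence => //.
  - by move=> n x _; rewrite lee_fin mulr_ge0 ?expR_ge0 ?sqr_ge0.
  - move=> x _ n m nm; rewrite lee_fin ler_wpM2r ?sqr_ge0// ler_expR.
    rewrite ler_wpM2r// lerN2 lef_pV2 ?posrE// ler_nat//.
rewrite -/sqS -(cvg_unique _ h2 h1)//.
apply: eq_integral => x _; apply/esym/cvg_lim => //.
apply: cvg_EFin; first exact: nearW.
have h3 : - n.+1%:R^-1 @[n --> \oo] --> (- 0 : R).
  by apply: cvgN; exact: cvg_harmonic.
have : expR (- n.+1%:R^-1 * `|x|) @[n --> \oo] --> expR (- 0 * `|x|).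
  apply: continuous_cvg; first exact: continuous_expR.
  by apply: cvgM => //; exact: cvg_cst.
rewrite oppr0 mul0r expR0 => h4.
by rewrite /comp /g /= -[X in _ --> X]mul1r; apply: cvgM => //; exact: cvg_cst.
Qed.

End Plancherel.

(** * Dilations and the representation U *)

Section HaarMeasure.
Variable R : realType.
Local Notation C := R[i].
Local Notation mu := (@lebesgue_measure R).
Local Notation Rplus := (`]0%R, +oo[%classic : set R).

(** Extension by 0 to the whole line, where the change of variables and the
    Fourier transform live. *)
Definition pospart (u : R -> C) : R -> C := fun r => if 0 < r then u r else 0.

Lemma pospart_gt0 u r : 0 < r -> pospart u r = u r.
Proof. by rewrite /pospart => ->. Qed.

Lemma mem_Rplus (r : R) : (r \in Rplus) = (0 < r).
Proof.
by apply/idP/idP => [/set_mem|h]; [rewrite RplusE|apply/mem_set; rewrite RplusE].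
Qed.

Lemma cmeasurable_pospart u : cmeasurable_fun Rplus u ->
  cmeasurable_fun setT (pospart u).
Proof.
move=> [mr mi].
have h (v : R -> R) : measurable_fun Rplus v ->
    measurable_fun setT (fun r : R => if 0 < r then v r else 0).
  move=> mv; rewrite (_ : (fun r : R => _) = v \_ Rplus).
    exact: (measurable_restrictT v (@measurable_Rplus R)).1 mv.
  by apply/funext => r; rewrite patchE mem_Rplus.
split; [apply: eq_measurable_fun (h _ mr)|apply: eq_measurable_fun (h _ mi)];
  by move=> r _; rewrite /pospart; case: ifP.
Qed.

Lemma integral_Rplus (f : R -> \bar R) :
  (\int[mu]_(r in Rplus) f r = \int[mu]_r (if (0 < r)%R then f r else 0))%E.
Proof.
rewrite integral_mkcond; by apply: eq_integral => r _; rewrite patchE mem_Rplus.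
Qed.

Lemma measurable_invr_pos : measurable_fun setT (fun r : R => if 0 < r then r^-1 else 0).
Proof.
have [h _] := cmeasurable_pospart (cmeasurable_invr R).
by apply: eq_measurable_fun h => r _; rewrite /pospart; case: ifP.
Qed.

(** The measure dr/r is the Haar measure of the multiplicative group. *)
Lemma haar_dilation (g : R -> R) (a : R) : 0 < a -> measurable_fun setT g ->
  (forall r, 0 <= g r) ->
  (\int[mu]_(r in Rplus) (g (a * r) / r)%:E = \int[mu]_(r in Rplus) (g r / r)%:E)%E.
Proof.
move=> a0 mg g0; rewrite !integral_Rplus.
pose F (r : R) : \bar R := (g r * (if (0 < r)%R then r^-1 else 0))%:E.
have FE r : (if (0 < r)%R then (g r / r)%:E else 0%E) = F r.
  by rewrite /F; case: ifP => // _; rewrite mulr0.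
apply: etrans (_ : \int[mu]_r F r = _)%E; last first.
  by apply: eq_integral => r _; rewrite FE.
have mF : measurable_fun setT F.
  by apply: measurableT_comp => //; apply: measurable_funM => //; exact: measurable_invr_pos.
have F0 r : (0 <= F r)%E.
  by rewrite lee_fin mulr_ge0//; case: ifP => // r0; rewrite invr_ge0 ltW.
rewrite [RHS](@ge0_integral_affine R a 0 F) ?gt_eqF// gtr0_norm//.
rewrite -ge0_integralZl//; last 2 first.
- exact: (measurableT_comp mF (measurable_affine a 0)).
- by rewrite lee_fin ltW.
apply: eq_integral => r _; rewrite /F addr0 pmulr_rgt0// -EFinM.
case: ifP => r0; last by rewrite mulr0 mulr0.
congr (_%:E); rewrite invfM mulrCA mulrA [a * _]mulrC; field.
by rewrite !gt_eqF.
Qed.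

Lemma ae_pos_dilation (P : R -> Prop) (a : R) : 0 < a ->
  {ae mu, forall r, 0 < r -> P r} -> {ae mu, forall r, 0 < r -> P (a * r)}.
Proof.
move=> a0 [N [mN N0 sub]].
exists ((fun r : R => a * r + 0) @^-1` N); split.
- rewrite -[X in measurable X]setTI.
  exact: (measurable_affine a 0).
- by rewrite lebesgue_measure_affine ?gt_eqF// N0 mule0.
move=> r nP; apply: sub => /= h; apply: nP => r0.
by move: h; rewrite addr0; apply; rewrite mulr_gt0.
Qed.

(** The values at f + g and f + i g separate the two mixed terms. The subspace W
    is there for forms that involve the unbounded operator D. *)
Lemma polarization (V : lmodType C) (W : V -> Prop) (B : V -> V -> C) :
  (forall f g, W f -> W g -> W (f + g)) -> (forall c f, W f -> W (c *: f)) ->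
  (forall f g h, W f -> W g -> W h -> B (f + g) h = B f h + B g h) ->
  (forall f g h, W f -> W g -> W h -> B h (f + g) = B h f + B h g) ->
  (forall c f g, W f -> W g -> B (c *: f) g = c * B f g) ->
  (forall c f g, W f -> W g -> B f (c *: g) = conjc c * B f g) ->
  (forall f, W f -> B f f = 0) ->
  forall f g, W f -> W g -> B f g = 0.
Proof.
move=> WD WZ BDl BDr BZl BZr B0 f g Wf Wg.
have Wig := WZ 'i%C g Wg.
have h1 := B0 _ (WD _ _ Wf Wg); have h2 := B0 _ (WD _ _ Wf Wig).
move: h1 h2; rewrite !BDl ?BDr//; do ?[exact: WD].
rewrite !BZl// !BZr// !B0// !mulr0 !addr0 !add0r.
move: (B f g) (B g f) => [x y] [z t].
by move=> /eqP + /eqP; rewrite !eq_complex /= => /andP[/eqP h1 /eqP h2]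
  /andP[/eqP h3 /eqP h4]; apply: complex_eqP => /=; lra.
Qed.

End HaarMeasure.

Section Representation.
Variable R : realType.
Local Notation C := R[i].
Local Notation mu := (@lebesgue_measure R).
Local Notation Rplus := (`]0%R, +oo[%classic : set R).
Local Notation L2 := (L2 R).
Implicit Types (f g : L2) (x a : R).

Definition Ufun x a (u : R -> C) : R -> C := fun r => cis (2 * pi * x * r) * u (a * r).

Lemma cmeasurable_dilation a (u : R -> C) : 0 < a -> cmeasurable_fun Rplus u ->
  cmeasurable_fun Rplus (fun r => u (a * r)).
Proof.
move=> a0 /cmeasurable_pospart mu'.
apply: (@cmeasurable_eq _ _ _ _ (fun r => pospart u (a * r))).
  by move=> r /set_mem; rewrite RplusE => r0; rewrite pospart_gt0// mulr_gt0.
case: mu' => mr mi; split; apply: measurable_funTS.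
  by apply: (measurableT_comp mr); exact: measurable_funM.
by apply: (measurableT_comp mi); exact: measurable_funM.
Qed.

Lemma cmeasurable_Ufun x a u : 0 < a -> cmeasurable_fun Rplus u ->
  cmeasurable_fun Rplus (Ufun x a u).
Proof.
move=> a0 mu'; apply: cmeasurableM; last exact: cmeasurable_dilation.
have [h1 h2] : cmeasurable_fun setT (fun r : R => cis (2 * pi * x * r)).
  by apply: cmeasurable_cis; exact: measurable_funM.
by split; apply: measurable_funTS.
Qed.

Lemma integral_Ufun x a (u : R -> C) : 0 < a -> cmeasurable_fun Rplus u ->
  (\int[mu]_(r in Rplus) (normc (Ufun x a u r) ^+ 2 / r)%:E =
   \int[mu]_(r in Rplus) (normc (u r) ^+ 2 / r)%:E)%E.
Proof.
move=> a0 mu'; have mp := cmeasurable_pospart mu'.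
transitivity (\int[mu]_(r in Rplus) (normc (pospart u (a * r)) ^+ 2 / r)%:E)%E.
  apply: eq_integral => r /set_mem; rewrite RplusE => r0.
  by rewrite pospart_gt0 ?mulr_gt0// normcM normc_cis mul1r.
rewrite (haar_dilation (g := fun r => normc (pospart u r) ^+ 2))//.
- by apply: eq_integral => r /set_mem; rewrite RplusE => r0; rewrite pospart_gt0.
- by apply: measurable_funX; exact: cmeasurable_normc.
- by move=> r; exact: sqr_ge0.
Qed.

Lemma sqint_Ufun x a u : 0 < a -> sqint u -> sqint (Ufun x a u).
Proof.
move=> a0 [mu' Iu]; split; first exact: cmeasurable_Ufun.
by rewrite integral_Ufun.
Qed.

Lemma U_fn x a f : 0 < a ->
  {ae mu, forall r, 0 < r -> L2fn (U x a f) r = cis (2 * pi * x * r) * L2fn f (a * r)}.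
Proof. by move=> a0; apply: L2class_fn; exact: (sqint_Ufun x a0 (L2fn_sqint f)). Qed.

Lemma U_linear x a : 0 < a -> linear (@U R x a).
Proof.
move=> a0 c f g; apply: L2_ext.
have h1 := U_fn x (c *: f + g) a0.
have h2 := ae_pos_dilation a0 (L2fnD (c *: f) g).
have h3 := ae_pos_dilation a0 (L2fnZ c f).
have h4 := L2fnD (c *: U x a f) (U x a g).
have h5 := L2fnZ c (U x a f).
have h6 := U_fn x f a0; have h7 := U_fn x g a0.
have h23 : {ae mu, forall r, 0 < r ->
    L2fn (c *: f + g) (a * r) = c * L2fn f (a * r) + L2fn g (a * r)}.
  by apply: ae_pos_mp2 h2 h3 => r _ -> ->.
have h67 : {ae mu, forall r, 0 < r -> L2fn (U x a f) r = cis (2 * pi * x * r) * L2fn f (a * r)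
    /\ L2fn (U x a g) r = cis (2 * pi * x * r) * L2fn g (a * r)}.
  by apply: ae_pos_mp2 h6 h7.
have h123 : {ae mu, forall r, 0 < r -> L2fn (U x a (c *: f + g)) r =
    cis (2 * pi * x * r) * (c * L2fn f (a * r) + L2fn g (a * r))}.
  by apply: ae_pos_mp2 h1 h23 => r _ -> ->.
have h45 : {ae mu, forall r, 0 < r -> L2fn (c *: U x a f + U x a g) r =
    c * L2fn (U x a f) r + L2fn (U x a g) r}.
  by apply: ae_pos_mp2 h4 h5 => r _ -> ->.
have h4567 : {ae mu, forall r, 0 < r -> L2fn (c *: U x a f + U x a g) r =
    cis (2 * pi * x * r) * (c * L2fn f (a * r) + L2fn g (a * r))}.
  by apply: ae_pos_mp2 h45 h67 => r _ -> [-> ->]; ring.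
by apply: ae_pos_mp2 h123 h4567 => r _ -> ->.
Qed.

Lemma sqr_L2norm_ae f (u : R -> C) : cmeasurable_fun Rplus u ->
  {ae mu, forall r, 0 < r -> L2fn f r = u r} ->
  (L2norm f ^+ 2)%:E = (\int[mu]_(r in Rplus) (normc (u r) ^+ 2 / r)%:E)%E.
Proof.
move=> mu' fu; rewrite sqr_L2norm_int; apply: ae_eq_integral => //.
- exact: measurable_int (sqint_integrable (L2fn_sqint f)).
- exact: measurable_sqr_normc_inv.
- by apply: ae_mp fu => r fu; rewrite RplusE => r0; rewrite fu.
Qed.

Lemma U_isometry x a f : 0 < a -> L2norm (U x a f) = L2norm f.
Proof.
move=> a0; apply/eqP; rewrite -(eqrXn2 (n := 2)) ?L2norm_ge0//; apply/eqP.
have : (L2norm (U x a f) ^+ 2)%:E = (L2norm f ^+ 2)%:E.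
  rewrite (sqr_L2norm_ae (u := Ufun x a (L2fn f)) _ (U_fn x f a0)).
    by rewrite integral_Ufun ?sqr_L2norm_int//; exact: L2fn_measurable.
  by apply: cmeasurable_Ufun => //; exact: L2fn_measurable.
by move=> [].
Qed.

Lemma U_inner x a f g : 0 < a -> inner (U x a f) (U x a g) = inner f g.
Proof.
move=> a0; have lU := U_linear x a0.
apply/eqP; rewrite -subr_eq0; apply/eqP.
apply: (polarization (W := fun _ : L2 => True)
  (B := fun f g => inner (U x a f) (U x a g) - inner f g)) => //.
- by move=> ? ? ? _ _ _; rewrite (linear_opD _ _ lU) !innerDl opprD addrACA.
- by move=> ? ? ? _ _ _; rewrite (linear_opD _ _ lU) !innerDr opprD addrACA.
- by move=> ? ? ? _ _; rewrite (linear_opZ _ _ lU) !innerZl mulrBr.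
- by move=> ? ? ? _ _; rewrite (linear_opZ _ _ lU) !innerZr mulrBr.
- by move=> h _; rewrite !inner_selfE U_isometry// subrr.
Qed.

Lemma U_inv x a f : 0 < a -> U x a (U (- x / a) a^-1 f) = f.
Proof.
move=> a0; have ai : 0 < a^-1 by rewrite invr_gt0.
apply: L2_ext; have h1 := U_fn x (U (- x / a) a^-1 f) a0.
have h2 := ae_pos_dilation a0 (U_fn (- x / a) f ai).
apply: ae_pos_mp2 h1 h2 => r r0 -> ->.
rewrite (mulrA a^-1) mulVf ?mul1r ?gt_eqF// mulrA.
rewrite (_ : cis _ * cis _ = 1) ?mul1r//.
have -> : 2 * pi * (- x / a) * (a * r) = - (2 * pi * x * r).
  by move: (@pi R) => p; field; rewrite gt_eqF.
apply: complex_eqP; rewrite ?ReM ?ImM /= cosN sinN; last by ring.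
by rewrite -[RHS](@cos2Dsin2 _ (2 * pi * x * r)); ring.
Qed.

(** The adjoint is a chosen operator that is specified only if some adjoint
    exists. One does, because the isometry U(x,a) has the right inverse
    U(-x/a, 1/a). *)
Lemma U_adjoint x a : 0 < a -> is_adjoint (@U R x a) (adjoint (@U R x a)).
Proof.
move=> a0; rewrite /adjoint; case: xgetP => [B _ //|none].
exfalso; apply: (none (U (- x / a) a^-1)) => f g.
by rewrite -{1}(U_inv x g a0) U_inner.
Qed.

Lemma adjoint_linear A B : is_adjoint A B -> linear (B : L2 -> L2).
Proof.
move=> AB c f g; apply: inner_inj => h.
rewrite inner_conj [RHS]inner_conj; congr (conjc _).
by rewrite -AB innerDr innerZr innerDr innerZr !AB.
Qed.

Lemma adjoint_U_bounded x a : 0 < a -> bounded_op (adjoint (@U R x a)).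
Proof.
move=> a0; have UA := U_adjoint x a0; split; first exact: adjoint_linear UA.
exists 1 => f; rewrite mul1r; set B := adjoint _.
have [->|n0] := eqVneq (L2norm (B f)) 0; first exact: L2norm_ge0.
have p0 : 0 < L2norm (B f) by rewrite lt_neqAle eq_sym n0 L2norm_ge0.
rewrite -(ler_pM2l p0) -expr2 -[leLHS]ger0_norm ?sqr_ge0// -normc_real -inner_selfE.
by rewrite -UA; apply: (le_trans (inner_CS _ _)); rewrite U_isometry.
Qed.

Lemma bounded_op_comp A B : bounded_op A -> bounded_op B -> bounded_op ((A : L2 -> L2) \o B).
Proof.
move=> bA bB; have [lA _] := bA; have [lB _] := bB.
have [M M0 hM] := bounded_op_ge0 bA; have [N N0 hN] := bounded_op_ge0 bB.
split=> [c f g /=|]; first by rewrite (linear_opD _ _ lB) (linear_opZ _ _ lB) (linear_opD _ _ lA) (linear_opZ _ _ lA).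
exists (M * N) => f /=; apply: (le_trans (hM _)).
by rewrite -mulrA ler_wpM2l.
Qed.

Lemma U_bounded x a : 0 < a -> bounded_op (@U R x a).
Proof.
by move=> a0; split; [exact: U_linear|exists 1 => f; rewrite U_isometry// mul1r].
Qed.

(** For B = U^* S U the terms <B v_k, u_k> of the series for tr(T o B) become
    matrix coefficients of S when U^* is moved to the right. *)
Lemma aff_conv_expansion T S (e u v : nat -> L2) (M x a : R) :
  0 < a -> bounded_op S -> is_onb e ->
  (forall n, \sum_(k < n) L2norm (u k) ^+ 2 <= M) ->
  (forall k, L2norm (v k) = L2norm (u k)) ->
  (forall f, L2norm (T f - \sum_(k < n) inner f (u k) *: v k)
      @[n --> \oo] --> (0 : R)) ->
  normc (\sum_(k < n) inner (S (U (- x) a (v k))) (U (- x) a (u k))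
    - aff_conv T S (x, a)) @[n --> \oo] --> (0 : R).
Proof.
move=> a0 bS onb uM vu Tuv.
have bB := bounded_op_comp (adjoint_U_bounded (- x) a0)
  (bounded_op_comp bS (U_bounded (- x) a0)).
have := trace_comp_expansion uM vu Tuv onb bB.
rewrite (_ : (fun n => _) = (fun n => normc (\sum_(k < n) inner (S (U (- x) a (v k))) (U (- x) a (u k))
    - aff_conv T S (x, a)))) //.
apply/funext => n; congr (normc (_ - _)); apply: eq_bigr => k _ /=.
rewrite inner_conj -(U_adjoint (- x) a0) -inner_conj//.
Qed.

End Representation.

(** * The matrix coefficients of D U(-x,a) *)

Section DufloMoore.
Variable R : realType.
Local Notation C := R[i].
Local Notation mu := (@lebesgue_measure R).
Local Notation Rplus := (`]0%R, +oo[%classic : set R).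
Local Notation L2 := (L2 R).
Implicit Types (f g p q : L2) (x a r : R).

(** The density of dr/r extended by 0, so that integrals over the half-line
    become integrals over the line, where translations and the Fourier transform
    are available. *)
Definition ipos (r : R) : R := if 0 < r then r^-1 else 0.

Lemma ipos_ge0 r : 0 <= ipos r.
Proof. by rewrite /ipos; case: ifP => // /ltW; rewrite invr_ge0. Qed.

Lemma measurable_ipos : measurable_fun setT ipos.
Proof. exact: measurable_invr_pos. Qed.

Lemma measurable_sqrt : measurable_fun setT (@Num.sqrt R).
Proof. by apply: continuous_measurable_fun; exact: sqrt_continuous. Qed.

Lemma cmeasurable_sqrt : cmeasurable_fun Rplus (fun r => (Num.sqrt r)%:C).
Proof. by apply: cmeasurable_real; apply: measurable_funTS; exact: measurable_sqrt. Qed.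

Lemma sqint_ae (u v : R -> C) : cmeasurable_fun Rplus u -> sqint v ->
  {ae mu, forall r, 0 < r -> u r = v r} -> sqint u.
Proof.
move=> mu' [mv Iv] uv; split=> //; apply: le_lt_trans Iv.
rewrite le_eqVlt; apply/orP; left; apply/eqP; apply: ae_eq_integral => //.
- exact: measurable_sqr_normc_inv.
- exact: measurable_sqr_normc_inv.
- by apply: ae_mp uv => r uv; rewrite RplusE => r0; rewrite uv.
Qed.

Lemma sqintD (u v : R -> C) : sqint u -> sqint v -> sqint (u + v).
Proof.
move=> su sv; have [_ h] := @sqint_submod_closed R.
have /asboolP := h 1 u v (asboolT su) (asboolT sv).
by rewrite scale1r.
Qed.

Lemma sqintZ c (u : R -> C) : sqint u -> sqint (c *: u).
Proof.
move=> su; have [h0 h] := @sqint_submod_closed R.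
have /asboolP := h c u 0 (asboolT su) h0.
by rewrite addr0.
Qed.

Lemma cmeasurable_mul_fun (w : R -> R) f : measurable_fun Rplus w ->
  cmeasurable_fun Rplus (Defs.mul_fun w f).
Proof.
move=> mw; apply: cmeasurableM; last exact: L2fn_measurable.
exact: cmeasurable_real.
Qed.

Lemma measurable_sqrt_pos : measurable_fun Rplus (fun r => Num.sqrt r).
Proof. by apply: measurable_funTS; exact: measurable_sqrt. Qed.

Lemma domD_add f g : domD f -> domD g -> domD (f + g).
Proof.
move=> Df Dg; apply: (sqint_ae _ (sqintD Df Dg)).
  exact: cmeasurable_mul_fun measurable_sqrt_pos.
apply: ae_pos_mp (L2fnD f g) => r _ e.
by rewrite /Defs.mul_fun -/(L2fn _) e mulrDr.
Qed.

Lemma domD_scale c f : domD f -> domD (c *: f).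
Proof.
move=> Df; apply: (sqint_ae _ (sqintZ c Df)).
  exact: cmeasurable_mul_fun measurable_sqrt_pos.
apply: ae_pos_mp (L2fnZ c f) => r _ e.
rewrite /Defs.mul_fun -/(L2fn _) e mulrCA //.
Qed.

Definition Dop f : L2 := mul_op (fun r => Num.sqrt r) f.

Lemma Dop_fn f : domD f ->
  {ae mu, forall r, 0 < r -> L2fn (Dop f) r = (Num.sqrt r)%:C * L2fn f r}.
Proof. by move=> Df; exact: L2class_fn. Qed.

Lemma DopD f g : domD f -> domD g -> Dop (f + g) = Dop f + Dop g.
Proof.
move=> Df Dg; apply: L2_ext.
have h1 := ae_pos_mp2 (fun r _ e1 e2 => etrans e1 (congr1 _ e2))
  (Dop_fn (domD_add Df Dg)) (L2fnD f g).
have h2 := ae_pos_mp2 (fun r _ e1 e2 => conj e1 e2) (Dop_fn Df) (Dop_fn Dg).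
have h3 := ae_pos_mp2 (fun r _ e1 (e2 : _ /\ _) => conj e1 e2) (L2fnD (Dop f) (Dop g)) h2.
by apply: ae_pos_mp2 h1 h3 => r _ -> [-> [-> ->]]; rewrite mulrDr.
Qed.

Lemma DopZ c f : domD f -> Dop (c *: f) = c *: Dop f.
Proof.
move=> Df; apply: L2_ext.
have h1 := ae_pos_mp2 (fun r _ e1 e2 => etrans e1 (congr1 _ e2))
  (Dop_fn (domD_scale c Df)) (L2fnZ c f).
have h2 := ae_pos_mp2 (fun r _ e1 e2 => conj e1 e2) (L2fnZ c (Dop f)) (Dop_fn Df).
by apply: ae_pos_mp2 h1 h2 => r _ -> [-> ->]; rewrite mulrCA.
Qed.

Lemma sqint_DU x a f : 0 < a -> domD f ->
  sqint (fun r => (Num.sqrt r)%:C * Ufun x a (L2fn f) r).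
Proof.
move=> a0 Df.
have E r : 0 < r -> (Num.sqrt r)%:C * Ufun x a (L2fn f) r =
    ((Num.sqrt a)^-1)%:C * Ufun x a (Defs.mul_fun (fun r => Num.sqrt r) f) r.
  move=> r0; rewrite /Ufun /Defs.mul_fun -/(L2fn f) sqrtrM ?ltW// rmorphM /=.
  have sa : Num.sqrt a != 0 by rewrite gt_eqF// sqrtr_gt0.
  rewrite mulrCA [RHS]mulrCA; congr (_ * _); rewrite !mulrA -rmorphM /= mulVf//.
  by rewrite mul1r.
apply: (sqint_ae _ (sqintZ ((Num.sqrt a)^-1)%:C (sqint_Ufun x a0 Df))).
  apply: cmeasurableM; first exact: cmeasurable_sqrt.
  by apply: cmeasurable_Ufun => //; exact: L2fn_measurable.
by apply: aeW => r r0; rewrite E.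
Qed.

Lemma mul_fun_U x a f : 0 < a ->
  {ae mu, forall r, 0 < r -> Defs.mul_fun (fun r => Num.sqrt r) (U x a f) r =
    (Num.sqrt r)%:C * Ufun x a (L2fn f) r}.
Proof. by move=> a0; apply: ae_pos_mp (U_fn x f a0) => r _ e; rewrite /Defs.mul_fun -/(L2fn _) e. Qed.

Lemma U_domD x a f : 0 < a -> domD f -> domD (U x a f).
Proof.
move=> a0 Df; apply: (sqint_ae _ (sqint_DU x a0 Df)); last exact: mul_fun_U.
exact: cmeasurable_mul_fun measurable_sqrt_pos.
Qed.

Lemma DU_fn x a f : 0 < a -> domD f -> {ae mu, forall r, 0 < r ->
  L2fn (Dop (U x a f)) r = (Num.sqrt r)%:C * Ufun x a (L2fn f) r}.
Proof.
move=> a0 Df.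
by apply: ae_pos_mp2 (L2class_fn (U_domD x a0 Df)) (mul_fun_U x f a0) => r _ -> ->.
Qed.

Lemma cintegrable_pospart (u : R -> C) : cintegrable mu Rplus u ->
  cintegrable mu setT (pospart u).
Proof.
move=> [ir ii].
have h (v : R -> R) : mu.-integrable Rplus (EFin \o v) ->
    mu.-integrable setT (fun r => (if 0 < r then v r else 0)%:E).
  move=> iv; have := iv; rewrite integrable_mkcond//.
  apply: eq_integrable => // r _; rewrite patchE mem_Rplus.
  by case: ifP.
by split; [apply: eq_integrable (h _ ir)|apply: eq_integrable (h _ ii)] => // r _;
  rewrite /pospart; case: ifP.
Qed.

Lemma cintegral_pospart (u : R -> C) :
  cintegral mu Rplus u = cintegral mu setT (pospart u).
Proof.
by apply: complex_eqP; rewrite /= /Rintegral integral_Rplus; congr fine;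
  apply: eq_integral => r _; rewrite /pospart; case: ifP.
Qed.

Definition pfn f : R -> C := pospart (L2fn f).

Lemma cmeasurable_pfn f : cmeasurable_fun setT (pfn f).
Proof. by apply: cmeasurable_pospart; exact: L2fn_measurable. Qed.

(** For fixed a the coefficient <D U(-x,a) f, p> is the Fourier transform of this
    function of r at the point -x: the factor r^(1/2) of D turns the density
    1/r of the inner product into r^(-1/2). *)
Definition coef_fun f p (a : R) : R -> C := fun r =>
  pfn f (a * r) * conjc (pfn p r) * (Num.sqrt (ipos r))%:C.

Definition coef f p (z : R * R) : C := fourier (coef_fun f p z.2) (- z.1).

Lemma coef_funE x a f p r : 0 < a ->
  cis (2 * pi * x * r) * coef_fun f p a r = pospart (inner_fun
    (fun r => (Num.sqrt r)%:C * Ufun x a (L2fn f) r) (L2fn p)) r.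
Proof.
move=> a0; rewrite /coef_fun /ipos /pospart; case: ifPn => r0; last first.
  by rewrite sqrtr0 !mulr0.
rewrite /pfn !pospart_gt0 ?mulr_gt0// /inner_fun /Ufun invr_real.
have -> : Num.sqrt r^-1 = Num.sqrt r * r^-1 :> R.
  have sr : Num.sqrt r != 0 by rewrite gt_eqF// sqrtr_gt0.
  rewrite sqrtrV ?ltW// -[in X in _ * X^-1](sqr_sqrtr (ltW r0)).
  by field.
rewrite rmorphM /=; ring.
Qed.

Lemma coef_inner x a f p : 0 < a -> domD f ->
  inner (Dop (U (- x) a f)) p = coef f p (x, a).
Proof.
move=> a0 Df; rewrite (innerE (v := L2fn p) _ _ (DU_fn (- x) a0 Df)).
- rewrite cintegral_pospart; apply: eq_cintegral => r _.
  by rewrite coef_funE.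
- by case: (sqint_DU (- x) a0 Df).
- exact: L2fn_measurable.
- exact: aeW.
Qed.

Lemma cintegrable_coef_fun a f p : 0 < a -> domD f ->
  cintegrable mu setT (coef_fun f p a).
Proof.
move=> a0 Df; have := cintegrable_pospart
  (inner_fun_integrable (sqint_DU 0 a0 Df) (L2fn_sqint p)).
apply: eq_cintegrable => // r _; rewrite -coef_funE//.
rewrite mulr0 mul0r /cis cos0 sin0.
by rewrite -[(_ +i* _)]/(1%:C) mul1r.
Qed.

Section Measurability.
Context d (T : measurableType d).

Lemma cmeasurable_coef_fun f p (phi psi : T -> R) : measurable_fun setT phi ->
  measurable_fun setT psi -> cmeasurable_fun setT (fun t => coef_fun f p (phi t) (psi t)).
Proof.
move=> mphi mpsi; apply: cmeasurableM.
  apply: cmeasurableM.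
    by apply: cmeasurable_comp; [exact: cmeasurable_pfn|exact: measurable_funM].
  by apply: cmeasurable_conj; apply: cmeasurable_comp => //; exact: cmeasurable_pfn.
apply: cmeasurable_real; apply: (measurableT_comp measurable_sqrt).
exact: (measurableT_comp measurable_ipos mpsi).
Qed.

End Measurability.

Lemma cmeasurable_coef f p : cmeasurable_fun setT (coef f p).
Proof.
have m1 : measurable_fun setT (fun z : (R * R) * R => z.1.1).
  exact: (measurableT_comp measurable_fst measurable_fst).
have m2 : measurable_fun setT (fun z : (R * R) * R => z.1.2).
  exact: (measurableT_comp measurable_snd measurable_fst).
have m3 : measurable_fun setT (fun z : (R * R) * R => z.2) by exact: measurable_snd.
apply: (@cmeasurable_cintegral _ _ _ _ R mu (fun z : (R * R) * R =>
  cis (2 * pi * (- z.1.1) * z.2) * coef_fun f p z.1.2 z.2)).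
apply: cmeasurableM; last exact: cmeasurable_coef_fun.
apply: cmeasurable_cis; apply: measurable_funM => //; apply: measurable_funM => //.
exact: measurableT_comp.
Qed.

Lemma sqr_L2norm_ipos f :
  (L2norm f ^+ 2)%:E = (\int[mu]_r (normc (pfn f r) ^+ 2 * ipos r)%:E)%E.
Proof.
rewrite sqr_L2norm_int integral_Rplus; apply: eq_integral => r _.
by rewrite /pfn /ipos /pospart; case: ifP; rewrite ?mulr0.
Qed.

Lemma sqr_L2norm_dilation f r : 0 < r ->
  (\int[mu]_a (normc (pfn f (a * r)) ^+ 2 * ipos a)%:E)%E = (L2norm f ^+ 2)%:E.
Proof.
move=> r0; have mg : measurable_fun setT (fun r => normc (pfn f r) ^+ 2).
  by apply: measurable_funX; apply: cmeasurable_normc; exact: cmeasurable_pfn.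
have := haar_dilation r0 mg (fun r => sqr_ge0 _).
rewrite !integral_Rplus => h.
transitivity (\int[mu]_a (if (0 < a)%R then (normc (pfn f (r * a)) ^+ 2 / a)%:E else 0))%E.
  by apply: eq_integral => a _; rewrite /ipos (mulrC r); case: ifP; rewrite ?mulr0.
rewrite h sqr_L2norm_ipos; apply: eq_integral => a _.
by rewrite /ipos; case: ifP; rewrite ?mulr0.
Qed.

Lemma sqr_normc_coef_fun f p a r :
  normc (coef_fun f p a r) ^+ 2 = normc (pfn f (a * r)) ^+ 2 * normc (pfn p r) ^+ 2 * ipos r.
Proof.
rewrite !normcM normc_conj normc_real !exprMn.
by rewrite real_normK ?num_real// sqr_sqrtr// ipos_ge0.
Qed.

Lemma measurable_sqr_normc d (T : measurableType d) (F : T -> C) (h : T -> R) :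
  cmeasurable_fun setT F -> measurable_fun setT h ->
  measurable_fun setT (fun t => (normc (F t) ^+ 2 * h t)%:E).
Proof.
move=> mF mh; apply: measurableT_comp => //; apply: measurable_funM => //.
by apply: measurable_funX; exact: cmeasurable_normc.
Qed.

(** The integral over a comes first: by invariance of da/a it yields the squared
    norm of f whatever r is, and the remaining integral is that of p. *)
Lemma integral_coef_fun f p :
  (\int[mu]_a \int[mu]_r (normc (coef_fun f p a r) ^+ 2 * ipos a)%:E =
   (L2norm f ^+ 2 * L2norm p ^+ 2)%:E)%E.
Proof.
pose F (z : R * R) : \bar R := (normc (coef_fun f p z.1 z.2) ^+ 2 * ipos z.1)%:E.
have mF : measurable_fun setT F.
  apply: measurable_sqr_normc.
    by apply: cmeasurable_coef_fun; [exact: measurable_fst|exact: measurable_snd].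
  exact: (measurableT_comp measurable_ipos measurable_fst).
have F0 z : (0 <= F z)%E by rewrite lee_fin mulr_ge0 ?sqr_ge0 ?ipos_ge0.
apply: etrans (@fubini_tonelli _ _ _ _ R mu mu F mF F0) _.
transitivity (\int[mu]_r ((L2norm f ^+ 2)%:E * (normc (pfn p r) ^+ 2 * ipos r)%:E))%E.
  apply: eq_integral => r _; rewrite /F /=.
  transitivity (\int[mu]_a ((normc (pfn p r) ^+ 2 * ipos r)%:E *
      (normc (pfn f (a * r)) ^+ 2 * ipos a)%:E))%E.
    apply: eq_integral => a _; rewrite sqr_normc_coef_fun -EFinM; congr (_%:E); ring.
  have [r0|r0] := ltP 0 r.
    rewrite ge0_integralZl//; first by rewrite sqr_L2norm_dilation// muleC.
    - apply: measurable_sqr_normc; last exact: measurable_ipos.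
      apply: cmeasurable_comp; first exact: cmeasurable_pfn.
      exact: measurable_funM.
    - by move=> a _; rewrite lee_fin mulr_ge0 ?sqr_ge0 ?ipos_ge0.
    - by rewrite lee_fin mulr_ge0 ?sqr_ge0 ?ipos_ge0.
  have ir : ipos r = 0 by rewrite /ipos ltNge r0.
  by rewrite ir mulr0 mule0 integral0_eq// => a _; rewrite mul0e.
rewrite ge0_integralZl//.
- by rewrite -sqr_L2norm_ipos EFinM.
- by apply: measurable_sqr_normc; [exact: cmeasurable_pfn|exact: measurable_ipos].
- by move=> a _; rewrite lee_fin mulr_ge0 ?sqr_ge0 ?ipos_ge0.
- by rewrite lee_fin sqr_ge0.
Qed.

End DufloMoore.

(** * Termwise integration of absolutely summable series *)

Section SeriesOfIntegrals.
Context d (T : measurableType d) (R : realType).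
Variables (mu : {measure set T -> \bar R}) (D : set T).
Hypothesis mD : measurable D.

Lemma integral_normcD (f g : T -> R[i]) : cintegrable mu D f -> cintegrable mu D g ->
  (\int[mu]_(t in D) (normc (f t + g t))%:E <=
   \int[mu]_(t in D) (normc (f t))%:E + \int[mu]_(t in D) (normc (g t))%:E)%E.
Proof.
move=> If Ig.
have mn (h : T -> R[i]) : cintegrable mu D h -> measurable_fun D (fun t => (normc (h t))%:E).
  move=> Ih; apply: measurableT_comp => //; apply: cmeasurable_normc.
  exact: cintegrable_measurable Ih.
rewrite -ge0_integralD//; do ?[by move=> t _; rewrite lee_fin normc_ge0];
  do ?[exact: mn].
apply: ge0_le_integral => //.
- by move=> t _; rewrite lee_fin normc_ge0.
- by apply: mn; exact: cintegrableD.
- by apply: emeasurable_funD; exact: mn.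
- by move=> t _; rewrite -EFinD lee_fin; exact: le_normcD.
Qed.

(** The partial sums are a Cauchy sequence for the mean distance, by comparison
    with the convergent series of bounds; the pointwise limit is therefore also
    the limit in the mean. *)
Lemma cintegral_series (F : nat -> T -> R[i]) (f : T -> R[i]) (c : nat -> R) (sigma : R) :
  (forall n, cintegrable mu D (F n)) ->
  (forall n, (\int[mu]_(t in D) (normc (F n t))%:E <= (c n)%:E)%E) ->
  \sum_(k < n) c k @[n --> \oo] --> sigma ->
  (forall t, D t -> normc (\sum_(k < n) F k t - f t) @[n --> \oo] --> (0 : R)) ->
  [/\ cintegrable mu D f, (\int[mu]_(t in D) (normc (f t))%:E <= sigma%:E)%E &
    normc (\sum_(k < n) cintegral mu D (F k) - cintegral mu D f) @[n --> \oo] --> (0 : R)].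
Proof.
move=> IF Fc cs Ff; pose G n t := \sum_(k < n) F k t.
have IG n : cintegrable mu D (G n).
  by apply: (cintegrable_sum mD (index_enum _) (fun k : 'I_n => IF k)).
have c0 n : 0 <= c n.
  by rewrite -lee_fin; apply: le_trans (Fc n); apply: integral_ge0 => t _;
    rewrite lee_fin normc_ge0.
have Gdiff n m : (n <= m)%N -> (\int[mu]_(t in D) (normc (G m t - G n t))%:E <=
    (\sum_(k < m) c k - \sum_(k < n) c k)%:E)%E.
  move=> nm; rewrite -(subnK nm) addnC; elim: (m - n)%N => [|p IH].
    rewrite addn0 subrr integral0_eq// => t _.
    by rewrite subrr normc0.
  have IGp : cintegrable mu D (fun t => G (n + p)%N t - G n t).
    apply: (eq_cintegrable mD _ (cintegrableD mD (IG (n + p)%N) (cintegrableZ mD (-1) (IG n)))).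
    by move=> t _; rewrite mulN1r.
  have -> : (\int[mu]_(t in D) (normc (G (n + p.+1)%N t - G n t))%:E =
     \int[mu]_(t in D) (normc ((G (n + p)%N t - G n t) + F (n + p)%N t))%:E)%E.
    by apply: eq_integral => t _; rewrite /G addnS big_ord_recr /= addrAC.
  apply: (le_trans (integral_normcD IGp (IF _))).
  by rewrite addnS big_ord_recr /= (addrAC (\sum_(k < n + p) c k)) EFinD leeD.
have s_le n : \sum_(k < n) c k <= sigma.
  apply: (cvgr_to_ge cs); exists n => // m /= nm.
  rewrite -(subnK nm) addnC; elim: (m - n)%N => [|p IH]; first by rewrite addn0.
  by rewrite addnS big_ord_recr /=; apply: (le_trans IH); rewrite lerDl.
have b0 : sigma - \sum_(k < n) c k @[n --> \oo] --> (0 : R).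
  by rewrite -[X in _ --> X](subrr sigma); apply: cvgB => //; exact: cvg_cst.
have [If fb fl] := cintegral_cvg_L1 mD IG Ff
  (fun n m nm => le_trans (Gdiff n m nm) (lerB (s_le m) (lexx _) : _%:E <= _%:E)%E) b0.
split => //.
  apply: le_trans (_ : _ <= \int[mu]_(t in D) (normc (f t - G 0%N t))%:E)%E _.
    rewrite le_eqVlt; apply/orP; left; apply/eqP; apply: eq_integral => t _.
    by rewrite /G big_ord0 subr0.
  by apply: (le_trans (fb 0%N)); rewrite big_ord0 subr0.
rewrite (_ : (fun n => _) = (fun n => normc (cintegral mu D (G n) - cintegral mu D f)))//.
by apply/funext => n; rewrite (cintegral_sum mD (index_enum _) (fun k : 'I_n => IF k)).
Qed.

End SeriesOfIntegrals.

(** * The Duflo-Moore orthogonality relation *)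

(** The infimum of the bounds over the parameter l is the product s t. *)
Lemma amgm_inf (R : realType) (X s t : R) : 0 <= s -> 0 <= t ->
  (forall l, 0 < l -> X <= (l * s ^+ 2 + l^-1 * t ^+ 2) / 2) -> X <= s * t.
Proof.
move=> s0 t0 h; apply/ler_addgt0Pr => e e0.
(* The minimizer is l = t / s; shifting both by d keeps it positive and finite. *)
pose d := e / (s + t + 1); have st : 0 < s + t + 1 by lra.
have d0 : 0 < d by rewrite divr_gt0.
have sd : 0 < s + d by lra.
have td : 0 < t + d by lra.
apply: le_trans (h ((t + d) / (s + d)) _) _; first by rewrite divr_gt0.
have h1 : s ^+ 2 / (s + d) <= s by rewrite ler_pdivrMr// expr2; nra.
have h2 : t ^+ 2 / (t + d) <= t by rewrite ler_pdivrMr// expr2; nra.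
have -> : (t + d) / (s + d) * s ^+ 2 + ((t + d) / (s + d))^-1 * t ^+ 2 =
    (t + d) * (s ^+ 2 / (s + d)) + (s + d) * (t ^+ 2 / (t + d)).
  by field; rewrite !gt_eqF.
have de : d * (s + t) <= e.
  by rewrite /d mulrAC ler_pdivrMr// ler_pM2l//; lra.
have h3 : (t + d) * (s ^+ 2 / (s + d)) <= (t + d) * s by rewrite ler_pM2l.
have h4 : (s + d) * (t ^+ 2 / (t + d)) <= (s + d) * t by rewrite ler_pM2l.
rewrite ler_pdivrMr//; nra.
Qed.

Section DufloMooreRelation.
Variable R : realType.
Local Notation C := R[i].
Local Notation mu := (@lebesgue_measure R).
Local Notation mu2 := (@lebesgue2 R).
Local Notation L2 := (L2 R).
Local Notation Aff := (@Aff R).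
Implicit Types (f g p q : L2).

Lemma measurable_Aff : measurable (Aff : set (measurableTypeR R * measurableTypeR R)).
Proof.
rewrite (_ : Aff = setT `*` `]0, +oo[%classic); first by apply: measurableX => //; exact: measurable_itv.
by apply/seteqP; split => z; rewrite /Aff /= in_itv /= andbT; tauto.
Qed.

Lemma mem_Aff (z : R * R) : (z \in Aff) = (0 < z.2).
Proof. by apply/idP/idP => [/set_mem|h]; [|apply/mem_set]. Qed.

Lemma cmeasurable_Aff (F : R * R -> C) : cmeasurable_fun setT F ->
  cmeasurable_fun Aff (fun z => F z / (z.2)%:C).
Proof.
move=> mF; apply: (@cmeasurable_eq _ _ _ _ (fun z => F z * (ipos z.2)%:C)).
  by move=> z; rewrite mem_Aff => z0; rewrite /ipos z0 invr_real.
have [h1 h2] : cmeasurable_fun setT (fun z : R * R => F z * (ipos z.2)%:C).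
  apply: cmeasurableM => //; apply: cmeasurable_real.
  exact: (measurableT_comp (@measurable_ipos R) measurable_snd).
by split; apply: measurable_funTS.
Qed.

Lemma normc_div (z : C) (r : R) : 0 < r -> normc (z / r%:C) = normc z / r.
Proof.
move=> r0; rewrite normcM invr_real normc_real.
by rewrite gtr0_norm ?invr_gt0.
Qed.

Lemma integral_Aff (h : R * R -> R) :
  (\int[mu2]_(z in Aff) (h z / z.2)%:E = \int[mu2]_z (h z * ipos z.2)%:E)%E.
Proof.
rewrite integral_mkcond; apply: eq_integral => z _; rewrite patchE mem_Aff /ipos.
by case: ifP => //; rewrite mulr0.
Qed.

Lemma integral_reflection (h : R -> \bar R) (k : R) : 0 <= k ->
  measurable_fun setT h -> (forall x : R, 0 <= h x)%E ->
  (\int[mu]_x (k%:E * h (- (x : R))%R) = k%:E * \int[mu]_x h x)%E.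
Proof.
move=> k0 mh h0; rewrite ge0_integralZl//; last first.
  exact: (measurableT_comp mh).
congr (_ * _)%E; rewrite [RHS](@ge0_integral_affine R (-1) 0) ?oppr_eq0 ?oner_eq0//.
rewrite normrN normr1 mul1e; apply: eq_integral => x _.
by rewrite mulN1r addr0.
Qed.

(** Plancherel's theorem in x, then Tonelli. The function of r to which the former
    applies is square-integrable for almost every a only; this follows from the
    finiteness of the double integral itself. *)
Theorem duflo_moore_norm f p : domD f ->
  (\int[mu2]_(z in Aff) (normc (coef f p z) ^+ 2 / z.2)%:E =
   (L2norm f ^+ 2 * L2norm p ^+ 2)%:E)%E.
Proof.
move=> Df; rewrite (integral_Aff (fun z => normc (coef f p z) ^+ 2)).
pose G (z : R * R) : \bar R := (normc (coef f p z) ^+ 2 * ipos z.2)%:E.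
have mG : measurable_fun setT G.
  apply: measurable_sqr_normc; first exact: cmeasurable_coef.
  exact: (measurableT_comp (@measurable_ipos R) measurable_snd).
have G0 z : (0 <= G z)%E by rewrite lee_fin mulr_ge0 ?sqr_ge0 ?ipos_ge0.
apply: etrans (@fubini_tonelli2 _ _ _ _ R mu mu G mG G0) _.
rewrite -integral_coef_fun.
pose F (z : R * R) : \bar R := (normc (coef_fun f p z.1 z.2) ^+ 2 * ipos z.1)%:E.
have mF : measurable_fun setT F.
  apply: measurable_sqr_normc.
    by apply: cmeasurable_coef_fun; [exact: measurable_fst|exact: measurable_snd].
  exact: (measurableT_comp (@measurable_ipos R) measurable_fst).
have F0 z : (0 <= F z)%E by rewrite lee_fin mulr_ge0 ?sqr_ge0 ?ipos_ge0.
have mIF := @measurable_fun_fubini_tonelli_F _ _ _ _ R mu F mF F0.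
have mIG := @measurable_fun_fubini_tonelli_G _ _ _ _ R mu G mG G0.
have intF : mu.-integrable setT (fun a => \int[mu]_r F (a, r))%E.
  apply/integrableP; split; first exact: mIF.
  under eq_integral do rewrite gee0_abs ?integral_ge0//.
  by rewrite integral_coef_fun ltry.
apply: ae_eq_integral => //.
have := integrable_ae measurableT intF.
apply: (ae_mp (P := fun a => setT a -> (\int[mu]_r F (a, r))%E \is a fin_num)) => a.
move=> /(_ Logic.I) fin _; rewrite /fubini_G.
have [a0|a0] := ltP 0 a; last first.
  have ia : ipos a = 0 by rewrite /ipos ltNge a0.
  by rewrite !integral0_eq// => r _; rewrite /G /= ia mulr0.
have ipa : 0 < ipos a by rewrite /ipos a0 invr_gt0.
have mcf : cmeasurable_fun setT (coef_fun f p a).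
  by apply: (@cmeasurable_coef_fun R _ _ f p (fun=> a) id) => //; exact: measurable_cst.
have mcf2 : measurable_fun setT (fun r => (normc (coef_fun f p a r) ^+ 2)%:E).
  by apply: measurableT_comp => //; apply: measurable_funX; exact: cmeasurable_normc.
have FE : (\int[mu]_r F (a, r) =
    (ipos a)%:E * \int[mu]_r (normc (coef_fun f p a r) ^+ 2)%:E)%E.
  rewrite -ge0_integralZl//; last 2 first.
  - by move=> r _; rewrite lee_fin sqr_ge0.
  - by rewrite lee_fin ltW.
  by apply: eq_integral => r _; rewrite /F /= mulrC.
have u2 : (\int[mu]_r (normc (coef_fun f p a r) ^+ 2)%:E < +oo)%E.
  move: fin; rewrite FE; set I := (\int[_]_(_ in _) _)%E.
  have I0 : (0 <= I)%E by apply: integral_ge0 => r _; rewrite lee_fin sqr_ge0.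
  by case: I I0 => [r|//|//] _; [rewrite ltry|rewrite gt0_muley ?lte_fin].
have icf := cintegrable_coef_fun p a0 Df.
rewrite FE -(plancherel icf u2).
transitivity (\int[mu]_x ((ipos a)%:E * (normc (fourier (coef_fun f p a) (- x)) ^+ 2)%:E))%E.
  by apply: eq_integral => x _; rewrite /G /coef /= mulrC.
apply: (@integral_reflection (fun x => (normc (fourier (coef_fun f p a) x) ^+ 2)%:E)).
- exact: ltW.
- apply: measurableT_comp => //; apply: measurable_funX; apply: cmeasurable_normc.
  exact: measurable_fourier.
- by move=> x; rewrite lee_fin sqr_ge0.
Qed.

Lemma coefD_l f g p z : 0 < z.2 -> domD f -> domD g ->
  coef (f + g) p z = coef f p z + coef g p z.
Proof.
case: z => x a /= a0 Df Dg; rewrite -!coef_inner//; last exact: domD_add.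
by rewrite (linear_opD _ _ (U_linear _ a0)) DopD ?innerDl//; exact: U_domD.
Qed.

Lemma coefZ_l c f p z : 0 < z.2 -> domD f ->
  coef (c *: f) p z = c * coef f p z.
Proof.
case: z => x a /= a0 Df; rewrite -!coef_inner//; last exact: domD_scale.
by rewrite (linear_opZ _ _ (U_linear _ a0)) DopZ ?innerZl//; exact: U_domD.
Qed.

Lemma coefD_r f p q z : 0 < z.2 -> domD f ->
  coef f (p + q) z = coef f p z + coef f q z.
Proof. by case: z => x a /= a0 Df; rewrite -!coef_inner// innerDr. Qed.

Lemma coefZ_r c f p z : 0 < z.2 -> domD f ->
  coef f (c *: p) z = conjc c * coef f p z.
Proof. by case: z => x a /= a0 Df; rewrite -!coef_inner// innerZr. Qed.

Definition cross f g p q (z : R * R) : C := coef f p z * conjc (coef g q z) / (z.2)%:C.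

Lemma cmeasurable_cross f g p q : cmeasurable_fun Aff (cross f g p q).
Proof.
apply: (@cmeasurable_Aff (fun z => coef f p z * conjc (coef g q z))).
by apply: cmeasurableM; [|apply: cmeasurable_conj]; exact: cmeasurable_coef.
Qed.

Lemma normc_cross f g p q z : 0 < z.2 ->
  normc (cross f g p q z) = normc (coef f p z) * normc (coef g q z) / z.2.
Proof.
by move=> z0; rewrite normc_div// normcM normc_conj.
Qed.

(** Cauchy-Schwarz on the group, obtained by integrating the inequality between
    means with a free parameter. *)
Lemma integral_cross_le f g p q : domD f -> domD g ->
  (\int[mu2]_(z in Aff) (normc (cross f g p q z))%:E <=
   (L2norm f * L2norm p * (L2norm g * L2norm q))%:E)%E.
Proof.
move=> Df Dg; set I := (\int[_]_(_ in _) _)%E.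
have I0 : (0 <= I)%E by apply: integral_ge0 => z _; rewrite lee_fin normc_ge0.
have mc f' p' : measurable_fun Aff (fun z => (normc (coef f' p' z) ^+ 2 / z.2)%:E).
  apply: (@eq_measurable_fun _ _ _ _ _ (fun z => (normc (coef f' p' z) ^+ 2 * ipos z.2)%:E)).
    by move=> z; rewrite mem_Aff /ipos => ->.
  apply: measurable_funTS; apply: measurable_sqr_normc; first exact: cmeasurable_coef.
  exact: (measurableT_comp (@measurable_ipos R) measurable_snd).
have c0 f' p' z : Aff z -> (0 <= (normc (coef f' p' z) ^+ 2 / z.2)%:E)%E.
  by move=> z0; rewrite lee_fin divr_ge0 ?sqr_ge0// ltW.
have bound l : 0 < l -> (I <= ((l * (L2norm f * L2norm p) ^+ 2 +
    l^-1 * (L2norm g * L2norm q) ^+ 2) / 2)%:E)%E.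
  move=> l0; have l20 : 0 <= l / 2 by rewrite divr_ge0 ?ltW.
  have l20' : 0 <= l^-1 / 2 by rewrite divr_ge0 ?invr_ge0 ?ltW.
  have -> : (((l * (L2norm f * L2norm p) ^+ 2 + l^-1 * (L2norm g * L2norm q) ^+ 2) / 2)%:E =
    (l / 2)%:E * (L2norm f ^+ 2 * L2norm p ^+ 2)%:E +
    (l^-1 / 2)%:E * (L2norm g ^+ 2 * L2norm q ^+ 2)%:E)%E.
    rewrite -!EFinM -EFinD; congr EFin; rewrite !exprMn.
    by rewrite mulrDl [l * _ / 2]mulrAC [l^-1 * _ / 2]mulrAC.
  rewrite -!duflo_moore_norm//.
  rewrite -ge0_integralZl//; last 3 first.
  - exact: measurable_Aff.
  - exact: mc.
  - exact: c0.
  rewrite -ge0_integralZl//; last 3 first.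
  - exact: measurable_Aff.
  - exact: mc.
  - exact: c0.
  rewrite -ge0_integralD//; last 5 first.
  - exact: measurable_Aff.
  - by move=> z z0; rewrite mule_ge0// c0.
  - by apply: measurable_funeM; exact: mc.
  - by move=> z z0; rewrite mule_ge0// c0.
  - by apply: measurable_funeM; exact: mc.
  apply: ge0_le_integral => //.
  - exact: measurable_Aff.
  - by move=> z _; rewrite lee_fin normc_ge0.
  - apply: measurableT_comp => //; apply: cmeasurable_normc; exact: cmeasurable_cross.
  - by apply: emeasurable_funD; apply: measurable_funeM; exact: mc.
  move=> z z0; rewrite -!EFinM -EFinD lee_fin normc_cross// !mulrA -mulrDl.
  rewrite ler_pM2r ?invr_gt0//.
  move: (normc (coef f p z)) (normc (coef g q z)) => s t.
  rewrite -subr_ge0 (_ : _ - _ = (l * s - t) ^+ 2 / (2 * l)).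
    by rewrite divr_ge0 ?sqr_ge0// mulr_ge0// ltW.
  by field; rewrite gt_eqF.
have Ifin : I \is a fin_num.
  by rewrite ge0_fin_numE//; apply: le_lt_trans (bound 1 ltr01) _; exact: ltry.
rewrite -(fineK Ifin) lee_fin; apply: amgm_inf; rewrite ?mulr_ge0 ?L2norm_ge0//.
by move=> l l0; rewrite -lee_fin fineK//; exact: bound.
Qed.

Lemma cintegrable_cross f g p q : domD f -> domD g ->
  cintegrable mu2 Aff (cross f g p q).
Proof.
move=> Df Dg; apply/(cintegrableP _ measurable_Aff); split.
  exact: cmeasurable_cross.
by apply: le_lt_trans (integral_cross_le p q Df Dg) _; exact: ltry.
Qed.

(** Two polarizations of the norm identity: in the pair (f,g) at p = q, inside
    dom D, and then in the pair (q,p). *)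
Theorem duflo_moore f g p q : domD f -> domD g ->
  cintegral mu2 Aff (cross f g p q) = inner f g * inner q p.
Proof.
pose J f g p q := cintegral mu2 Aff (cross f g p q).
have JD f1 g1 p1 q1 f2 g2 p2 q2 f3 g3 p3 q3 : domD f1 -> domD g1 -> domD f2 -> domD g2 ->
   (forall z, Aff z -> cross f3 g3 p3 q3 z = cross f1 g1 p1 q1 z + cross f2 g2 p2 q2 z) ->
   J f3 g3 p3 q3 = J f1 g1 p1 q1 + J f2 g2 p2 q2.
  move=> D1 D2 D3 D4 e; rewrite /J; apply: etrans (@eq_cintegral _ _ R mu2 Aff _ _ e) _.
  by apply: cintegralD; [exact: measurable_Aff|exact: cintegrable_cross|exact: cintegrable_cross].
have JZ c f1 g1 p1 q1 f3 g3 p3 q3 : domD f1 -> domD g1 ->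
   (forall z, Aff z -> cross f3 g3 p3 q3 z = c * cross f1 g1 p1 q1 z) ->
   J f3 g3 p3 q3 = c * J f1 g1 p1 q1.
  move=> D1 D2 e; rewrite /J; apply: etrans (@eq_cintegral _ _ R mu2 Aff _ _ e) _.
  by apply: cintegralZ; [exact: measurable_Aff|exact: cintegrable_cross].
have diag f1 p1 : domD f1 -> J f1 f1 p1 p1 = inner f1 f1 * inner p1 p1.
  move=> Df; have e z : Aff z ->
      cross f1 f1 p1 p1 z = (normc (coef f1 p1 z) ^+ 2 / z.2)%:C.
    by move=> z0; rewrite /cross mul_conjc invr_real// -rmorphM.
  rewrite /J; apply: etrans (@eq_cintegral _ _ R mu2 Aff _ _ e) _.
  rewrite !inner_selfE -rmorphM; apply: complex_eqP => /=.
    by rewrite /Rintegral duflo_moore_norm.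
  by rewrite /Rintegral integral0.
move=> Df Dg.
have step1 p1 : J f g p1 p1 = inner f g * inner p1 p1.
  apply/eqP; rewrite -subr_eq0; apply/eqP.
  apply: (@polarization R _ (@domD R) (fun f g => J f g p1 p1 - inner f g * inner p1 p1)) => //.
  - exact: domD_add.
  - exact: domD_scale.
  - move=> f1 g1 h1 Df1 Dg1 Dh1; rewrite innerDl (JD f1 h1 p1 p1 g1 h1 p1 p1)//.
      by rewrite mulrDl opprD addrACA.
    by move=> z z0; rewrite /cross coefD_l// !mulrDl.
  - move=> f1 g1 h1 Df1 Dg1 Dh1; rewrite innerDr (JD h1 f1 p1 p1 h1 g1 p1 p1)//.
      by rewrite mulrDl opprD addrACA.
    by move=> z z0; rewrite /cross coefD_l// conjcD mulrDr mulrDl.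
  - move=> c f1 g1 Df1 Dg1; rewrite innerZl (JZ c f1 g1 p1 p1)//.
      by rewrite mulrBr mulrA.
    by move=> z z0; rewrite /cross coefZ_l// !mulrA.
  - move=> c f1 g1 Df1 Dg1; rewrite innerZr (JZ (conjc c) f1 g1 p1 p1)//.
      by rewrite mulrBr mulrA.
    by move=> z z0; rewrite /cross coefZ_l// conjcM mulrCA -!mulrA.
  - by move=> f1 Df1; rewrite diag// subrr.
apply/eqP; rewrite -subr_eq0; apply/eqP.
apply: (@polarization R _ (fun=> True) (fun q p => J f g p q - inner f g * inner q p)) => //.
- move=> q1 q2 p1 _ _ _; rewrite innerDl (JD f g p1 q1 f g p1 q2)//.
    by rewrite mulrDr opprD addrACA.
  by move=> z z0; rewrite /cross coefD_r// conjcD mulrDr mulrDl.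
- move=> q1 q2 p1 _ _ _; rewrite innerDr (JD f g q1 p1 f g q2 p1)//.
    by rewrite mulrDr opprD addrACA.
  by move=> z z0; rewrite /cross coefD_r// !mulrDl.
- move=> c q1 p1 _ _; rewrite innerZl (JZ c f g p1 q1)//.
    by rewrite mulrBr mulrCA.
  by move=> z z0; rewrite /cross coefZ_r// conjcM conjcK mulrCA -!mulrA.
- move=> c q1 p1 _ _; rewrite innerZr (JZ (conjc c) f g p1 q1)//.
    by rewrite mulrBr mulrCA.
  by move=> z z0; rewrite /cross coefZ_r// !mulrA.
- by move=> p1 _; rewrite step1 subrr.
Qed.

End DufloMooreRelation.

(** * Admissible operators and truncations *)

Section Quantization.
Variable R : realType.
Local Notation C := R[i].
Local Notation mu := (@lebesgue_measure R).
Local Notation Rplus := (`]0%R, +oo[%classic : set R).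
Local Notation L2 := (L2 R).
Implicit Types (f g h : L2).

Lemma measurable_sqrtV_pos : measurable_fun Rplus (fun r : R => (Num.sqrt r)^-1).
Proof.
apply: (@eq_measurable_fun _ _ _ _ _ (fun r : R => ipos (Num.sqrt r))).
  by move=> r; rewrite mem_Rplus => r0; rewrite /ipos sqrtr_gt0 r0.
apply: measurable_funTS.
exact: (measurableT_comp (@measurable_ipos R) (@measurable_sqrt R)).
Qed.

Lemma mulVsqrtC (r : R) : 0 < r -> ((Num.sqrt r)^-1)%:C * (Num.sqrt r)%:C = 1 :> C.
Proof. by move=> r0; rewrite -rmorphM mulVf// gt_eqF// sqrtr_gt0. Qed.

Lemma Dinv_fn f : domDinv f ->
  {ae mu, forall r, 0 < r -> L2fn (Dinv f) r = ((Num.sqrt r)^-1)%:C * L2fn f r}.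
Proof. exact: L2class_fn. Qed.

Lemma Dop_mulV_fn f : domD f -> {ae mu, forall r, 0 < r ->
  Defs.mul_fun (fun r => (Num.sqrt r)^-1) (Dop f) r = L2fn f r}.
Proof.
move=> Df; apply: ae_pos_mp (Dop_fn Df) => r r0 e.
by rewrite /Defs.mul_fun -/(L2fn _ _) e mulrA mulVsqrtC// mul1r.
Qed.

Lemma domDinv_Dop f : domD f -> domDinv (Dop f).
Proof.
move=> Df; apply: sqint_ae (L2fn_sqint f) (Dop_mulV_fn Df).
exact: cmeasurable_mul_fun measurable_sqrtV_pos.
Qed.

Lemma Dinv_Dop f : domD f -> Dinv (Dop f) = f.
Proof.
move=> Df; apply: L2_ext.
by apply: ae_pos_mp2 (L2class_fn (domDinv_Dop Df)) (Dop_mulV_fn Df) => r _ -> ->.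
Qed.

Lemma inner_Dinv_Dop h g : domDinv h -> domD g -> inner (Dinv h) (Dop g) = inner h g.
Proof.
move=> Dh Dg; rewrite (innerE _ _ (Dinv_fn Dh) (Dop_fn Dg)).
- apply: eq_cintegral => r; rewrite RplusE => r0; rewrite /inner_fun.
  rewrite conjcM (_ : conjc (Num.sqrt r)%:C = (Num.sqrt r)%:C); last first.
    by apply: complex_eqP; rewrite !reimE /= ?oppr0.
  by rewrite mulrACA mulVsqrtC// mul1r.
- exact: cmeasurable_mul_fun measurable_sqrtV_pos.
- exact: cmeasurable_mul_fun (@measurable_sqrt_pos R).
Qed.

(** On dom D the operators D and D^-1 cancel, and S f lies in dom D^-1, where
    D^-1 can be moved to the other side of the inner product. *)
Lemma admissible_form S A f g : (forall f, domD f -> domDinv (S f)) ->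
  DinvSDinv_extension S A -> domD f -> domD g ->
  inner (S f) g = inner (A (Dop f)) (Dop g).
Proof.
move=> SD [_ AE] Df Dg; rewrite AE; last exact: domDinv_Dop.
by rewrite Dinv_Dop// inner_Dinv_Dop//; exact: SD.
Qed.

Lemma L2norm_le f g :
  {ae mu, forall r, 0 < r -> normc (L2fn f r) <= normc (L2fn g r)} ->
  L2norm f <= L2norm g.
Proof.
move=> fg; rewrite -ler_sqr ?nnegrE ?L2norm_ge0// -lee_fin !sqr_L2norm_int.
apply: ae_ge0_le_integral => //.
- exact: sqr_normc_inv_ge0.
- exact: measurable_int (sqint_integrable (L2fn_sqint f)).
- exact: sqr_normc_inv_ge0.
- exact: measurable_int (sqint_integrable (L2fn_sqint g)).
apply: ae_mp fg => r fg; rewrite RplusE => r0.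
by rewrite lee_fin ler_pM2r ?invr_gt0// ler_sqr ?nnegrE ?normc_ge0//; exact: fg.
Qed.

Lemma sqint_le (u v : R -> C) k : cmeasurable_fun Rplus u -> sqint v -> 0 <= k ->
  (forall r, 0 < r -> normc (u r) ^+ 2 <= k * normc (v r) ^+ 2) -> sqint u.
Proof.
move=> mu' sv k0 uv; split => //; have [_ Iv] := sv.
have mv := measurable_int _ (sqint_integrable sv).
apply: (@le_lt_trans _ _ (k%:E * (\int[mu]_(r in Rplus) (normc (v r) ^+ 2 / r)%:E))%E).
  rewrite -ge0_integralZl//; last first.
    exact: sqr_normc_inv_ge0.
  apply: ge0_le_integral => //.
  - exact: sqr_normc_inv_ge0.
  - exact: measurable_sqr_normc_inv.
  - exact: measurable_funeM.
  move=> r; rewrite RplusE => r0; rewrite -EFinM lee_fin mulrA.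
  by rewrite ler_pM2r ?invr_gt0//; exact: uv.
by rewrite lte_mul_pinfty ?lee_fin.
Qed.

(** Cutting f off at r = n makes r bounded on its support, which puts it in
    dom D. *)
Definition cutoff n f : R -> C := fun r => if r <= n%:R then L2fn f r else 0.

Definition trunc n f : L2 := L2class (cutoff n f).

Lemma cmeasurable_cutoff n f : cmeasurable_fun Rplus (cutoff n f).
Proof.
apply: (@cmeasurable_eq _ _ _ _ (fun r => (\1_(`]-oo, n%:R] : set R) r)%:C * L2fn f r)).
  move=> r _; rewrite /cutoff indicE mem_setE in_itv /=.
  by case: ifP; rewrite ?mul1r ?mul0r.
apply: cmeasurableM; last exact: L2fn_measurable.
by apply: cmeasurable_real; apply: measurable_funTS; exact: measurable_indic.
Qed.

Lemma sqint_cutoff n f : sqint (cutoff n f).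
Proof.
apply: (@sqint_le _ (L2fn f) 1) => //; [exact: cmeasurable_cutoff|exact: L2fn_sqint|].
move=> r r0; rewrite mul1r /cutoff; case: ifP => // _.
by rewrite normc0 expr0n sqr_ge0.
Qed.

Lemma trunc_fn n f : {ae mu, forall r, 0 < r -> L2fn (trunc n f) r = cutoff n f r}.
Proof. exact: L2class_fn (sqint_cutoff n f). Qed.

Lemma domD_trunc n f : domD (trunc n f).
Proof.
apply: (@sqint_ae _ _ (fun r => (Num.sqrt r)%:C * cutoff n f r)).
- exact: cmeasurable_mul_fun (@measurable_sqrt_pos R).
- apply: (@sqint_le _ (L2fn f) n%:R) => //; [|exact: L2fn_sqint|].
    by apply: cmeasurableM; [exact: cmeasurable_sqrt|exact: cmeasurable_cutoff].
  move=> r r0; rewrite normcM exprMn /cutoff; case: ifP => [rn|_].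
    rewrite normc_real ger0_norm ?sqrtr_ge0// sqr_sqrtr ?(ltW r0)//.
    by rewrite ler_wpM2r ?sqr_ge0.
  by rewrite normc0 expr0n mulr0 mulr_ge0 ?sqr_ge0.
- by apply: ae_pos_mp (trunc_fn n f) => r _ e; rewrite /Defs.mul_fun -/(L2fn _ _) e.
Qed.

Lemma L2norm_trunc_le n f : L2norm (trunc n f) <= L2norm f.
Proof.
apply: L2norm_le; apply: ae_pos_mp (trunc_fn n f) => r _ ->; rewrite /cutoff.
by case: ifP => // _; rewrite normc0 normc_ge0.
Qed.

Lemma subr_trunc_fn n f : {ae mu, forall r, 0 < r ->
  L2fn (f - trunc n f) r = if r <= n%:R then 0 else L2fn f r}.
Proof.
apply: ae_pos_mp2 (L2fnB f (trunc n f)) (trunc_fn n f) => r _ -> ->.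
by rewrite /cutoff; case: ifP; rewrite ?subrr ?subr0.
Qed.

Lemma L2norm_truncB n m f : (n <= m)%N ->
  L2norm (trunc m f - trunc n f) <= L2norm (f - trunc n f).
Proof.
move=> nm; apply: L2norm_le.
have h : {ae mu, forall r, 0 < r ->
    L2fn (trunc m f - trunc n f) r = cutoff m f r - cutoff n f r}.
  have h12 := ae_pos_mp2 (fun r _ e1 e2 => conj e1 e2) (trunc_fn m f) (trunc_fn n f).
  by apply: ae_pos_mp2 (L2fnB (trunc m f) (trunc n f)) h12 => r _ -> [-> ->].
apply: ae_pos_mp2 h (subr_trunc_fn n f) => r _ -> ->; rewrite /cutoff.
case: (leP r n%:R) => rn; case: (leP r m%:R) => rm; rewrite ?subrr ?subr0//.
  by move: rm; rewrite ltNge (le_trans rn)// ler_nat.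
by rewrite normc0 normc_ge0.
Qed.

Lemma trunc_cvg f : L2norm (f - trunc n f) @[n --> \oo] --> (0 : R).
Proof.
pose w n (r : R) : C := if r <= n%:R then 0 else L2fn f r.
have mw n : cmeasurable_fun Rplus (w n).
  apply: (@cmeasurable_eq _ _ _ _ (fun r => L2fn f r - cutoff n f r)).
    by move=> r _; rewrite /w /cutoff; case: ifP; rewrite ?subrr ?subr0.
  by apply: cmeasurableB; [exact: L2fn_measurable|exact: cmeasurable_cutoff].
have Iw n : (\int[mu]_(r in Rplus) (normc (w n r) ^+ 2 / r)%:E =
    (L2norm (f - trunc n f) ^+ 2)%:E)%E.
  by rewrite (sqr_L2norm_ae (mw n) (subr_trunc_fn n f)).
have [|||||_ _] := @dominated_convergence _ _ _ mu Rplus (@measurable_Rplus R)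
  (fun n r => (normc (w n r) ^+ 2 / r)%:E) (fun=> 0%E)
  (fun r => (normc (L2fn f r) ^+ 2 / r)%:E).
- by move=> n; exact: measurable_sqr_normc_inv.
- exact: measurable_cst.
- apply: aeW => r _; apply: cvg_near_cst.
  exists (Num.truncn r).+1 => // n /= rn; rewrite /w ifT.
    by rewrite normc0 expr0n mul0r.
  by rewrite (le_trans (ltW (truncnS_gt r)))// ler_nat.
- exact: sqint_integrable (L2fn_sqint f).
- apply: aeW => r n; rewrite RplusE => r0.
  rewrite gee0_abs ?lee_fin ?divr_ge0 ?sqr_ge0 ?(ltW r0)// ler_pM2r ?invr_gt0//.
  rewrite /w; case: ifP => // _.
  by rewrite normc0 expr0n sqr_ge0.
rewrite integral0 (_ : [sequence _]_n = fun n => (L2norm (f - trunc n f) ^+ 2)%:E); last first.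
  by apply/funext => n; exact: Iw.
move=> /fine_cvgP[_ h].
rewrite (_ : (fun n => _) = (fun n => Num.sqrt (L2norm (f - trunc n f) ^+ 2))); last first.
  by apply/funext => n; rewrite sqrtr_sqr ger0_norm// L2norm_ge0.
by rewrite -[X in _ --> X]sqrtr0; apply: continuous_cvg; [exact: sqrt_continuous|exact: h].
Qed.

End Quantization.

(** * The integral of a matrix coefficient of S *)

Section OrbitIntegral.
Variable R : realType.
Local Notation C := R[i].
Local Notation mu2 := (@lebesgue2 R).
Local Notation L2 := (L2 R).
Local Notation Aff := (@Aff R).
Implicit Types (f g h : L2).

Variables (S A : L2 -> L2) (e p q : nat -> L2) (M sigma : R).
Hypothesis bS : bounded_op S.
Hypothesis SA : forall f g, domD f -> domD g -> inner (S f) g = inner (A (Dop f)) (Dop g).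
Hypothesis onb : is_onb e.
Hypothesis pM : forall n, \sum_(k < n) L2norm (p k) ^+ 2 <= M.
Hypothesis qp : forall k, L2norm (q k) = L2norm (p k).
Hypothesis Apq : forall f,
  L2norm (A f - \sum_(k < n) inner f (p k) *: q k) @[n --> \oo] --> (0 : R).
Hypothesis psigma : energy p n @[n --> \oo] --> sigma.

(** The density 1/a is included, so that the integral against dx da is the one
    against the right Haar measure. *)
Definition orbit_form f g (z : R * R) : C :=
  inner (S (U (- z.1) z.2 f)) (U (- z.1) z.2 g) / (z.2)%:C.

Lemma cross_expansion f g z : Aff z -> domD f -> domD g ->
  normc (\sum_(k < n) cross f g (p k) (q k) z - orbit_form f g z) @[n --> \oo] --> (0 : R).
Proof.
case: z => x a; rewrite /Aff /= => a0 Df Dg.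
have h := inner_expansion Apq (Dop (U (- x) a f)) (Dop (U (- x) a g)).
have -> : (fun n => normc (\sum_(k < n) cross f g (p k) (q k) (x, a) - orbit_form f g (x, a))) =
   (fun n => normc (\sum_(k < n) inner (Dop (U (- x) a f)) (p k) *
       inner (q k) (Dop (U (- x) a g)) -
     inner (A (Dop (U (- x) a f))) (Dop (U (- x) a g))) * a^-1).
  apply/funext => n; rewrite -normc_div// /orbit_form SA; [|exact: U_domD|exact: U_domD].
  rewrite mulrBl mulr_suml; congr (normc (_ - _)); apply: eq_bigr => k _.
  by rewrite /cross coef_inner// (inner_conj (q k)) coef_inner.
by rewrite -(mul0r a^-1); apply: cvgM => //; exact: cvg_cst.
Qed.

(** Expanding A turns the orbit form into a series of products of coefficients,
    each of which is integrated by the Duflo-Moore relation; the norms of the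
    terms are summable because p_k and q_k have the same norm. *)
Lemma orbit_form_domD f g : domD f -> domD g ->
  [/\ cintegrable mu2 Aff (orbit_form f g),
      (\int[mu2]_(z in Aff) (normc (orbit_form f g z))%:E <=
        (L2norm f * L2norm g * sigma)%:E)%E &
      cintegral mu2 Aff (orbit_form f g) = inner f g * trace A].
Proof.
move=> Df Dg.
have cs : \sum_(k < n) L2norm f * L2norm (p k) * (L2norm g * L2norm (q k)) @[n --> \oo] -->
    L2norm f * L2norm g * sigma.
  rewrite (_ : (fun n => _) = (fun n => L2norm f * L2norm g * energy p n)); last first.
    by apply/funext => n; rewrite /energy mulr_sumr; apply: eq_bigr => k _; rewrite qp mulrACA.
  by apply: cvgM => //; exact: cvg_cst.
have [If fb fl] := cintegral_series (@measurable_Aff R)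
  (fun n => cintegrable_cross (p n) (q n) Df Dg)
  (fun n => integral_cross_le (p n) (q n) Df Dg) cs
  (fun z Az => cross_expansion Az Df Dg).
split => //; apply: (normc_cvg_unique fl).
have bid : bounded_op (@id L2).
  by split=> //; exists 1 => h; rewrite mul1r.
have := trace_comp_expansion pM qp Apq onb bid.
rewrite (_ : A \o id = A)// => h.
rewrite (_ : (fun n => _) = (fun n => normc (inner f g) *
    normc (\sum_(k < n) inner (q k) (p k) - trace A))); last first.
  apply/funext => n; rewrite -normcM mulrBr mulr_sumr.
  by congr (normc (_ - _)); apply: eq_bigr => k _; exact: duflo_moore.
by rewrite -(mulr0 (normc (inner f g))); apply: cvgM => //; exact: cvg_cst.
Qed.

Lemma orbit_formB_l f g h z : Aff z ->
  orbit_form (f - g) h z = orbit_form f h z - orbit_form g h z.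
Proof.
move=> z0; have [lS _] := bS.
by rewrite /orbit_form (linear_opB _ _ (U_linear _ z0)) (linear_opB _ _ lS) innerBl mulrBl.
Qed.

Lemma orbit_formB_r f g h z : Aff z ->
  orbit_form h (f - g) z = orbit_form h f z - orbit_form h g z.
Proof.
by move=> z0; rewrite /orbit_form (linear_opB _ _ (U_linear _ z0)) innerBr mulrBl.
Qed.

Lemma normc_orbit_form_le : exists2 K, 0 <= K & forall f g z, Aff z ->
  normc (orbit_form f g z) <= K * (L2norm f * L2norm g) / z.2.
Proof.
have [K K0 SK] := bounded_op_ge0 bS; exists K => // f g z z0.
rewrite normc_div// ler_pM2r ?invr_gt0//; apply: le_trans (inner_CS _ _) _.
by rewrite (U_isometry _ g z0) mulrA ler_wpM2r ?L2norm_ge0// -(U_isometry (- z.1) f z0).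
Qed.

Lemma domD_truncB n m f : domD (trunc m f - trunc n f).
Proof.
by rewrite -scaleN1r; apply: domD_add; [|apply: domD_scale]; exact: domD_trunc.
Qed.

Lemma sigma_ge0 : 0 <= sigma.
Proof.
by apply: (cvgr_to_ge psigma); exists 0%N => // n _; apply: sumr_ge0 => k _; exact: sqr_ge0.
Qed.

(** Up to a factor, this bounds the effect of truncating both arguments of a
    bounded sesquilinear form. *)
Definition trunc_error f g n := L2norm (f - trunc n f) * L2norm g + L2norm f * L2norm (g - trunc n g).

Lemma trunc_error_cvg f g : trunc_error f g n @[n --> \oo] --> (0 : R).
Proof.
rewrite /trunc_error -[X in _ --> X](addr0 0) -[X in _ --> X + _](mul0r (L2norm g)).
rewrite -[X in _ --> _ + X](mulr0 (L2norm f)).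
by apply: cvgD; apply: cvgM; do ?[exact: cvg_cst]; exact: trunc_cvg.
Qed.

Lemma orbit_form_trunc f g z : Aff z ->
  normc (orbit_form (trunc n f) (trunc n g) z - orbit_form f g z) @[n --> \oo] --> (0 : R).
Proof.
move=> z0; have [K K0 SK] := normc_orbit_form_le.
apply: (@squeeze_cvgr _ _ _ _ (cst 0) (fun n => K / z.2 * trunc_error f g n)).
- near=> n; rewrite normc_ge0 distcC/=.
  have -> : orbit_form f g z - orbit_form (trunc n f) (trunc n g) z =
     orbit_form (f - trunc n f) g z + orbit_form (trunc n f) (g - trunc n g) z.
    by rewrite orbit_formB_l// orbit_formB_r// addrA subrK.
  apply: le_trans (le_normcD _ _) _; rewrite mulrDr lerD//.
    by apply: le_trans (SK _ _ _ z0) _; rewrite mulrAC.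
  apply: le_trans (SK _ _ _ z0) _; rewrite mulrAC ler_wpM2l ?divr_ge0 ?(ltW z0)//.
  by rewrite ler_wpM2r ?L2norm_ge0// L2norm_trunc_le.
- exact: cvg_cst.
- rewrite -(mulr0 (K / z.2)); apply: cvgM; first exact: cvg_cst.
  exact: trunc_error_cvg.
Unshelve. all: by end_near. Qed.

(** The estimate on dom D involves the norms of f and g only, not those of D f and
    D g; it makes the orbit forms of the truncations a Cauchy sequence in the mean,
    whose pointwise limit is the orbit form of f and g. *)
Lemma orbit_form_integral f g :
  [/\ cintegrable mu2 Aff (orbit_form f g),
      (\int[mu2]_(z in Aff) (normc (orbit_form f g z))%:E <=
        (L2norm f * L2norm g * sigma)%:E)%E &
      cintegral mu2 Aff (orbit_form f g) = inner f g * trace A].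
Proof.
have s0 := sigma_ge0.
pose F n := orbit_form (trunc n f) (trunc n g).
pose b n := trunc_error f g n * sigma.
have b0 : b @ \oo --> (0 : R).
  rewrite /b -[X in _ --> X](mul0r sigma); apply: cvgM; last exact: cvg_cst.
  exact: trunc_error_cvg.
have IF n : cintegrable mu2 Aff (F n).
  by have [] := orbit_form_domD (domD_trunc n f) (domD_trunc n g).
have Fb n m : (n <= m)%N ->
    (\int[mu2]_(z in Aff) (normc (F m z - F n z))%:E <= (b n)%:E)%E.
  move=> nm.
  have [I1 B1 _] := orbit_form_domD (domD_truncB n m f) (domD_trunc m g).
  have [I2 B2 _] := orbit_form_domD (domD_trunc n f) (domD_truncB n m g).
  have -> : (\int[mu2]_(z in Aff) (normc (F m z - F n z))%:E =
     \int[mu2]_(z in Aff) (normc (orbit_form (trunc m f - trunc n f) (trunc m g) z +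
        orbit_form (trunc n f) (trunc m g - trunc n g) z))%:E)%E.
    apply: eq_integral => z /set_mem z0.
    by rewrite orbit_formB_l// orbit_formB_r// addrA subrK.
  apply: le_trans (integral_normcD (@measurable_Aff R) I1 I2) _.
  apply: le_trans (leeD B1 B2) _.
  rewrite -EFinD lee_fin /b /trunc_error mulrDl.
  apply: lerD; apply: (ler_wpM2r s0); apply: ler_pM; rewrite ?L2norm_ge0//.
  - exact: L2norm_truncB.
  - exact: L2norm_trunc_le.
  - exact: L2norm_trunc_le.
  - exact: L2norm_truncB.
have [If fb fl] := cintegral_cvg_L1 (@measurable_Aff R) IF
  (fun z Az => @orbit_form_trunc f g z Az) Fb b0.
split => //.
- have le n : (\int[mu2]_(z in Aff) (normc (orbit_form f g z))%:E <=
      (b n + L2norm f * L2norm g * sigma)%:E)%E.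
    have Id : cintegrable mu2 Aff (fun z => orbit_form f g z - F n z).
      apply: (@eq_cintegrable _ _ R mu2 Aff (@measurable_Aff R) (fun z => orbit_form f g z + (-1) * F n z)).
        by move=> z _; rewrite mulN1r.
      exact: (cintegrableD (@measurable_Aff R) If (cintegrableZ (@measurable_Aff R) (-1) (IF n))).
    have -> : (\int[mu2]_(z in Aff) (normc (orbit_form f g z))%:E =
       \int[mu2]_(z in Aff) (normc ((orbit_form f g z - F n z) + F n z))%:E)%E.
      by apply: eq_integral => z _; rewrite subrK.
    apply: le_trans (integral_normcD (@measurable_Aff R) Id (IF n)) _.
    rewrite EFinD leeD//.
    have [_ B _] := orbit_form_domD (domD_trunc n f) (domD_trunc n g).
    apply: le_trans B _; rewrite lee_fin; apply: (ler_wpM2r s0).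
    by apply: ler_pM; rewrite ?L2norm_ge0//; exact: L2norm_trunc_le.
  have fin : (\int[mu2]_(z in Aff) (normc (orbit_form f g z))%:E)%E \is a fin_num.
    rewrite ge0_fin_numE; first by apply: le_lt_trans (le 0%N) _; exact: ltry.
    by apply: integral_ge0 => z _; rewrite lee_fin normc_ge0.
  rewrite -(fineK fin) lee_fin -subr_le0; apply: (cvgr_to_ge b0).
  by exists 0%N => // n _; rewrite lerBlDr -lee_fin fineK//; exact: le.
apply: (normc_cvg_unique fl).
have -> : (fun n => normc (cintegral mu2 Aff (F n) - inner f g * trace A)) =
  (fun n => normc (inner (trunc n f) (trunc n g) - inner f g) * normc (trace A)).
  apply/funext => n; rewrite -normcM mulrBl; congr (normc (_ - _)).
  by have [] := orbit_form_domD (domD_trunc n f) (domD_trunc n g).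
rewrite -(mul0r (normc (trace A))); apply: cvgM; last exact: cvg_cst.
apply: (@squeeze_cvgr _ _ _ _ (cst 0) (trunc_error f g)).
- near=> n; rewrite normc_ge0 distcC/=.
  have -> : inner f g - inner (trunc n f) (trunc n g) =
     inner (f - trunc n f) g + inner (trunc n f) (g - trunc n g).
    by rewrite innerBl innerBr addrA subrK.
  apply: le_trans (le_normcD _ _) _; rewrite lerD ?inner_CS//.
  apply: le_trans (inner_CS _ _) _.
  by rewrite ler_wpM2r ?L2norm_ge0// L2norm_trunc_le.
- exact: cvg_cst.
- exact: trunc_error_cvg.
Unshelve. all: by end_near. Qed.

End OrbitIntegral.

(** * The convolution of a trace-class operator with an admissible one *)

(** Summing the integrals <v_k, u_k> tr(A) over the rank one pieces of T produces
    tr(T) tr(A); the norms of v_k and u_k are square-summable, so the series of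
    matrix coefficients converges in the mean to the convolution. *)
Theorem theorem4 (R : realType) (S T : L2 R -> L2 R)
    (hS : admissible S) (hT : trace_class T) :
  L1r (aff_conv T S) /\
  int_Aff (aff_conv T S) = trace T * trace (DinvSDinv S).
Proof.
have [_ bS SD _ exA] := hS.
have AE : DinvSDinv_extension S (DinvSDinv S) := xgetPex (fun=> 0) exA.
have [e [p [q [M [onb pM qp Apq]]]]] := trace_class_expansion (proj1 AE).
have [sigma psigma] := energy_cvg pM.
have [e' [u [v [M' [onb' uM vu Tuv]]]]] := trace_class_expansion hT.
have [tau utau] := energy_cvg uM.
have orbit k := orbit_form_integral bS
  (fun f g Df Dg => admissible_form SD AE Df Dg) onb pM qp Apq psigma (v k) (u k).
have If k : cintegrable (@lebesgue2 R) (@Aff R) (orbit_form S (v k) (u k)).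
  by have [] := orbit k.
have Ib k : (\int[@lebesgue2 R]_(z in @Aff R) (normc (orbit_form S (v k) (u k) z))%:E <=
    (L2norm (v k) * L2norm (u k) * sigma)%:E)%E.
  by have [] := orbit k.
have cs : \sum_(k < n) L2norm (v k) * L2norm (u k) * sigma @[n --> \oo] --> tau * sigma.
  rewrite (_ : (fun n => _) = (fun n => energy u n * sigma)); last first.
    by apply/funext => n; rewrite /energy mulr_suml; apply: eq_bigr => k _; rewrite vu.
  by apply: cvgM => //; exact: cvg_cst.
have lim z : Aff z -> normc (\sum_(k < n) orbit_form S (v k) (u k) z -
    aff_conv T S z / (z.2)%:C) @[n --> \oo] --> (0 : R).
  case: z => x a; rewrite /Aff /= => a0.
  have h := aff_conv_expansion x a0 bS onb' uM vu Tuv.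
  rewrite (_ : (fun n => _) = (fun n => normc (\sum_(k < n)
      inner (S (U (- x) a (v k))) (U (- x) a (u k)) - aff_conv T S (x, a)) * a^-1)).
    by rewrite -(mul0r a^-1); apply: cvgM => //; exact: cvg_cst.
  by apply/funext => n; rewrite -normc_div// mulrBl mulr_suml.
have [L1 _ intl] := cintegral_series (@measurable_Aff R) If Ib cs lim.
split; first exact: L1.
apply: esym; apply: (normc_cvg_unique _ intl).
have bid : bounded_op (@id (L2 R)) by split=> //; exists 1 => h; rewrite mul1r.
have := trace_comp_expansion uM vu Tuv onb' bid; rewrite (_ : T \o id = T)// => htr.
rewrite (_ : (fun n => _) = (fun n => normc (\sum_(k < n) inner (v k) (u k) - trace T) *
    normc (trace (DinvSDinv S)))).
  by rewrite -(mul0r (normc (trace (DinvSDinv S)))); apply: cvgM => //; exact: cvg_cst.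
apply/funext => n; rewrite -normcM mulrBl mulr_suml.
by congr (normc (_ - _)); apply: eq_bigr => k _; have [] := orbit k.
Qed.
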